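(* Let $\nu>0$, $\kappa\in(0,1]$ and $N\sim\mathrm{FP}(\nu,\kappa)$. Then $N$ satisfies the following mixed Poisson representation: $N\,|\,U\sim\mathrm{Poisson}(\nu U)$ with $U\sim\mathrm{ML}(\kappa)$. That is, the distribution $\mathrm{FP}(\nu,\kappa)$ coincides with the (unconditional) distribution of a random variable which, conditionally on $U\sim\mathrm{ML}(\kappa)$, is Poisson distributed with mean $\nu U$.
   Context: The Mittag-Leffler function is $\mathcal{E}_\kappa(z)=\sum_{m=0}^\infty \frac{z^m}{\Gamma(\kappa m+1)}$, $z\in\mathbb{R}$. Fractional Poisson distribution: for $\nu>0$ and $\kappa\in(0,1]$, let $\{\Delta_k\}_{k\ge1}$ be i.i.d. waiting times with $P(\Delta_k\le t)=1-\mathcal{E}_\kappa(-\nu t^\kappa)$ for $t>0$, let $T_0=0$, $T_n=\Delta_1+\cdots+\Delta_n$, and $N_{\nu,\kappa}(t)=\sup\{n\ge0:T_n\le t\}$. $N\sim\mathrm{FP}(\nu,\kappa)$ means that $N$ has the distribution of $N_{\nu,\kappa}(1)$. Its probability mass function is $$P(N=n)=\frac{\nu^n}{n!}\sum_{i=0}^\infty\frac{(i+n)!}{i!}\frac{(-\nu)^i}{\Gamma(\kappa(i+n)+1)},\quad n=0,1,2,\ldots,$$ and its probability generating function is $E(s^N)=\mathcal{E}_\kappa(\nu(s-1))$. (Type 2) Mittag-Leffler distribution: for $\kappa\in(0,1)$, $U\sim\mathrm{ML}(\kappa)$ means that $U$ is a positive random variable with density $$f_\kappa(u)=\frac{1}{\pi\kappa}\sum_{j=1}^\infty\frac{(-1)^{j-1}}{j!}\sin(\pi\kappa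 j)\,\Gamma(\kappa j+1)\,u^{j-1},\quad u>0,$$ and its moment generating function is $E(e^{sU})=\mathcal{E}_\kappa(s)$, $s\in\mathbb{R}$. For $\kappa=1$, $\mathrm{ML}(1)$ denotes the point mass at $1$. *)

(* Defs.v *)
From HB Require Import structures.
From mathcomp Require Import all_boot all_order all_algebra.
From mathcomp Require Import all_classical all_reals all_analysis.

Set Implicit Arguments.
Unset Strict Implicit.
Unset Printing Implicit Defensive.

Import Order.TTheory GRing.Theory Num.Theory.
Import numFieldNormedType.Exports.

Local Open Scope classical_set_scope.
Local Open Scope ring_scope.

(* Euler's integral; only used for a > 0, where it converges. *)
Definition Gamma {R : realType} (a : R) : R :=
  \int[lebesgue_measure]_(x in `]0, +oo[) (x `^ (a - 1) * expR (- x)).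

Definition mittag_leffler {R : realType} (kappa z : R) : R :=
  limn (series (fun m : nat => z ^+ m / Gamma (kappa * m%:R + 1))).

Definition ml_density {R : realType} (kappa u : R) : R :=
  (pi * kappa)^-1 *
  limn (fun n : nat => \sum_(1 <= j < n.+1)
    ((-1) ^+ j.-1 / (j`!)%:R * sin (pi * kappa * j%:R) *
     Gamma (kappa * j%:R + 1) * u ^+ j.-1)).

(* U ~ ML(kappa).  Integrating the density over A `&` ]0, +oo[ makes U positive
   almost surely; ML(1) is the point mass at 1. *)
Definition is_ML {R : realType} (kappa : R)
    d (T : measurableType d) (P : probability T R) (U : {RV P >-> R}) : Prop :=
  forall A : set R, measurable A ->
    distribution P U A =
    if kappa < 1 then
      (\int[lebesgue_measure]_(u in A `&` `]0%R, +oo[) (ml_density kappa u)%:E)%E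
    else \d_(1 : R) A.

Definition mutually_independent {R : realType}
    d (T : measurableType d) (P : probability T R)
    (X : nat -> {RV P >-> R}) : Prop :=
  forall (J : seq nat) (A : nat -> set R), uniq J ->
    (forall k, measurable (A k)) ->
    P (\bigcap_(k in [set` J]) (X k @^-1` A k)) =
    (\prod_(k <- J) P (X k @^-1` A k))%E.

(* Delta k is the (k+1)-st waiting time.  The values of the distribution
   function for t > 0 determine it everywhere, since they tend to 0 at 0+. *)
Definition waiting_times {R : realType} (nu kappa : R)
    d (T : measurableType d) (P : probability T R)
    (Delta : nat -> {RV P >-> R}) : Prop :=
  mutually_independent Delta /\
  (forall (k : nat) (t : R), 0 < t ->
     cdf (Delta k) t = (1 - mittag_leffler kappa (- nu * t `^ kappa))%:E).

Definition arrival_time {R : realType} {T : Type}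
    (Delta : nat -> T -> R) (n : nat) (w : T) : R :=
  \sum_(0 <= k < n) Delta k w.

(* The supremum is taken in \bar R, so that it is +oo on the (null) event that
   all the T_n stay below t. *)
Definition renewal_count {R : realType} {T : Type}
    (Delta : nat -> T -> R) (t : R) (w : T) : \bar R :=
  ereal_sup [set (n%:R)%:E | n in [set n : nat | arrival_time Delta n w <= t]].

(* N ~ FP(nu, kappa): N has the distribution of the renewal count at time 1. *)
Definition is_FP {R : realType} (nu kappa : R)
    d (T : measurableType d) (P : probability T R) (N : {RV P >-> nat}) : Prop :=
  exists (d0 : measure_display) (T0 : measurableType d0)
    (P0 : probability T0 R) (Delta : nat -> {RV P0 >-> R}),
    waiting_times nu kappa Delta /\
    forall n : nat,
      distribution P N [set n] =
      P0 [set w | renewal_count (fun k => Delta k : T0 -> R) 1 w = (n%:R)%:E].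

(* N | U ~ Poisson(nu U), i.e., P(N = n | U) = poisson_pmf (nu U) n almost
   surely for every n, written with the defining property of the conditional
   probability given the sigma-algebra generated by U.  [poisson_pmf] has a
   dummy value at rates <= 0, so this is meant for nu U > 0 almost surely. *)
Definition conditionally_Poisson {R : realType} (nu : R)
    d (T : measurableType d) (P : probability T R)
    (N : {RV P >-> nat}) (U : {RV P >-> R}) : Prop :=
  forall (n : nat) (B : set R), measurable B ->
    P ((N @^-1` [set n]) `&` (U @^-1` B)) =
    (\int[P]_(w in U @^-1` B) (poisson_pmf (nu * U w) n)%:E)%E.

Definition is_mixed_Poisson_ML {R : realType} (nu kappa : R)
    d (T : measurableType d) (P : probability T R) (N : {RV P >-> nat})
    (U : {RV P >-> R}) : Prop :=
  is_ML kappa U /\ conditionally_Poisson nu N U.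

(* Main.v *)
(* Two families of functions of the time t are compared through their Laplace
   transforms. For U ~ ML(k), the weight pi_n(t) = E[poisson_pmf (nu t^k U) n] has
   transform s^(k-1) nu^n / (nu + s^k)^(n+1). By independence, P(T_n <= t) has
   transform s^-1 (nu / (nu + s^k))^n, so that P(T_n <= t) - P(T_(n+1) <= t) has the
   same transform as pi_n. All these functions are right-continuous, hence they
   agree, and t = 1 is the statement.

   The transform of pi_n needs the Mittag-Leffler density f to be a nonnegative
   function for which v |-> t^-k f (v t^-k) has transform s^(k-1) exp (-v s^k) in t.
   Integrating the series of f term by term gives t^-k f (v t^-k) = t g_v(t) / (k v),
   where g_v is the k-stable density written as an integral over the negative real
   axis. Rotating this ray towards the positive axis, where the integrand of the
   transform concentrates like a Poisson kernel at r = s, shows that g_v has transform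
   exp (-v s^k). Finally g_v >= 0 because this transform is completely monotone: the
   kernels e^(-p N t) (1 - e^-t)^(q N) concentrate near a prescribed point as N grows,
   so their integrals against g_v would detect a negative value. The same argument
   gives the uniqueness of Laplace transforms used above. *)

(* The time t is introduced because nothing is explicit at t = 1: the law of T_n is a convolution of
   distribution functions known only as series, and the density of U is a power series with changing
   signs. By self-similarity t^k U is the mixing variable at time t, and a transform in t makes both
   sides rational in s^k up to a power of s.

   Complex integration is replaced by real calculus: a ray integral is kept as the imaginary part of
   its integrand in polar coordinates, and a rotation is a differentiation in the angle under the
   integral sign. On the negative axis exp (- v z^k) grows when k > 1/2, so the integrals in t and r
   are exchanged on an intermediate ray where all factors decay. Hence two rotations, one before and
   one after the exchange.

   The transform of the Mittag-Leffler function is computed only for large s, where its series can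
   be integrated term by term. Positivity and uniqueness are therefore arranged to look at a
   transform only at the points s0 + j with j a natural number, and s0 may be large.

   For k = 1, U is constant and the transform of pi_n is immediate. *)
Require Import Defs.
From HB Require Import structures.
From mathcomp Require Import all_boot all_order all_algebra.
From mathcomp Require Import all_classical all_reals all_analysis.
From mathcomp Require Import measurable_realfun ring lra.

Set Implicit Arguments.
Unset Strict Implicit.
Unset Printing Implicit Defensive.

Import Order.TTheory GRing.Theory Num.Theory.
Import numFieldNormedType.Exports.

Local Open Scope classical_set_scope.
Local Open Scope ring_scope.

(** * Derivatives, continuity and dominated convergence *)

(* Eta-expanded, so that [der] can chain these rules by unification. *)
Section der.
Context {R : realType}.
Implicit Types (f g : R -> R) (x a b : R).
Lemma der_cst c x : is_derive x (1 : R) (fun _ : R => c : R) (0 : R). Proof. exact: is_derive_cst. Qed.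
Lemma der_id x : is_derive x 1 (fun y : R => y) 1. Proof. exact: is_derive_id. Qed.
Lemma der_add f g x a b : is_derive x 1 f a -> is_derive x 1 g b ->
  is_derive x 1 (fun y => f y + g y) (a + b).
Proof. by move=> ? ?; exact: is_deriveD. Qed.
Lemma der_sub f g x a b : is_derive x 1 f a -> is_derive x 1 g b ->
  is_derive x 1 (fun y => f y - g y) (a - b).
Proof. by move=> ? ?; exact: is_deriveB. Qed.
Lemma der_opp f x a : is_derive x 1 f a -> is_derive x 1 (fun y => - f y) (- a).
Proof. by move=> ?; exact: is_deriveN. Qed.
Lemma der_mul f g x a b : is_derive x 1 f a -> is_derive x 1 g b ->
  is_derive x 1 (fun y => f y * g y) (a * g x + f x * b).
Proof.
move=> fa gb; have h := @is_deriveM R R f g x 1 a b fa gb.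
rewrite (_ : (fun y => _) = f * g); last by apply/funext => y; rewrite fctE.
by apply: is_derive_eq h _; rewrite /GRing.scale/= addrC [g x * _]mulrC.
Qed.

Lemma der_exp f x a : is_derive x 1 f a -> is_derive x 1 (fun y => expR (f y)) (expR (f x) * a).
Proof. by move=> ?; apply: (@is_derive1_comp _ expR f). Qed.
Lemma der_cos f x a : is_derive x 1 f a -> is_derive x 1 (fun y => cos (f y)) (- sin (f x) * a).
Proof. by move=> ?; apply: (@is_derive1_comp _ cos f). Qed.
Lemma der_sin f x a : is_derive x 1 f a -> is_derive x 1 (fun y => sin (f y)) (cos (f x) * a).
Proof. by move=> ?; apply: (@is_derive1_comp _ sin f). Qed.
Lemma der_inv f x a : f x != 0 -> is_derive x 1 f a ->
  is_derive x 1 (fun y => (f y)^-1) (- a / (f x * f x)).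
Proof.
move=> fx0 fa; have h := @is_deriveV R f x a 1 fx0 fa.
by apply: is_derive_eq h _; rewrite /GRing.scale/= expr2 !mulNr mulrC.
Qed.

Lemma der_pow p x : 0 < x -> is_derive x 1 (fun y => y `^ p) (p * (x `^ p / x)).
Proof.
move=> x0; apply: is_derive_eq; first exact: is_derive1_powR.
have -> : x `^ p = x `^ (p - 1) * x.
  rewrite -[in LHS](subrK 1 p) (@powRD _ x (p - 1) 1) ?powRr1// ?ltW//.
  by apply/implyP => _; rewrite gt_eqF.
by rewrite mulfK// gt_eqF.
Qed.

Lemma der_expn f x a n : is_derive x 1 f a -> is_derive x 1 (fun y => f y ^+ n) (n%:R * f x ^+ n.-1 * a).
Proof.
move=> fa; have h := @is_deriveX R R f n x 1 a fa.
rewrite (_ : (fun y => _) = f ^+ n); last by apply/funext => y; rewrite exprfctE.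
exact: h.
Qed.

Lemma der_continuous f x a : is_derive x 1 f a -> {for x, continuous f}.
Proof. by move=> [/derivable1_diffP/differentiable_continuous]. Qed.
End der.
Ltac der1 := first
  [ eapply der_cst | eapply der_id | eapply der_add | eapply der_opp | eapply der_mul
  | eapply der_exp | eapply der_cos | eapply der_sin | eapply der_expn
  | eapply der_inv | eapply der_pow ].
Ltac der := eapply is_derive_eq; [repeat der1 | cbv beta].

(* An inductive wrapper keeps unification from unfolding continuity. *)
Variant cont_at {R : realType} (f : R -> R) (x : R) : Prop :=
  ContAt of {for x, continuous f}.

Section continuity.
Context {R : realType}.
Implicit Types (f g : R -> R) (x : R).
Lemma cont_atP f x : cont_at f x -> {for x, continuous f}.
Proof. by case. Qed.
Lemma ct_cst (c : R) x : cont_at (fun _ : R => c) x.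
Proof. by split; exact: cst_continuous. Qed.
Lemma ct_id x : cont_at (fun y : R => y) x.
Proof. by split; exact: cvg_id. Qed.
Lemma ct_add f g x : cont_at f x -> cont_at g x -> cont_at (fun y => f y + g y) x.
Proof. by move=> [cf] [cg]; split; apply: cvgD. Qed.
Lemma ct_opp f x : cont_at f x -> cont_at (fun y => - f y) x.
Proof. by move=> [cf]; split; apply: cvgN. Qed.
Lemma ct_mul f g x : cont_at f x -> cont_at g x -> cont_at (fun y => f y * g y) x.
Proof. by move=> [cf] [cg]; split; apply: cvgM. Qed.
Lemma ct_inv f x : f x != 0 -> cont_at f x -> cont_at (fun y => (f y)^-1) x.
Proof. by move=> fx [cf]; split; apply: cvgV. Qed.
Lemma ct_exp f x : cont_at f x -> cont_at (fun y => expR (f y)) x.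
Proof. by move=> [cf]; split; apply: (continuous_comp cf); exact: continuous_expR. Qed.
Lemma ct_cos f x : cont_at f x -> cont_at (fun y => cos (f y)) x.
Proof. by move=> [cf]; split; apply: (continuous_comp cf); exact: continuous_cos. Qed.
Lemma ct_sin f x : cont_at f x -> cont_at (fun y => sin (f y)) x.
Proof. by move=> [cf]; split; apply: (continuous_comp cf); exact: continuous_sin. Qed.
Lemma ct_pow p f x : 0 < f x -> cont_at f x -> cont_at (fun y => f y `^ p) x.
Proof.
move=> x0 [cf]; split; apply: (@continuous_comp _ _ _ f (fun y => y `^ p)) => //.
exact: der_continuous (der_pow p x0).
Qed.

Lemma ct_expn n f x : cont_at f x -> cont_at (fun y => f y ^+ n) x.
Proof.
move=> cf; elim: n => [|n ih]; first exact: ct_cst.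
have -> : (fun y => f y ^+ n.+1) = (fun y => f y * f y ^+ n) by apply/funext => y; rewrite exprS.
exact: ct_mul.
Qed.
End continuity.
Ltac ct1 := first
  [ eapply ct_cst | eapply ct_id | eapply ct_add | eapply ct_opp | eapply ct_mul
  | eapply ct_inv | eapply ct_exp | eapply ct_cos | eapply ct_sin | eapply ct_pow | eapply ct_expn ].
Ltac ct := apply: cont_atP; repeat ct1.

Lemma cvg_seqr_unique {R : realType} (u : nat -> R) (l l' : R) :
  u n @[n --> \oo] --> l -> u n @[n --> \oo] --> l' -> l = l'.
Proof.
by move=> h h'; rewrite -(cvg_lim (@Rhausdorff R) h) -(cvg_lim (@Rhausdorff R) h').
Qed.

Section dct.
Context d (T : measurableType d) {R : realType} (mu : {measure set T -> \bar R}).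

Lemma Rintegral_dominated_cvg (D : set T) (f_ : nat -> T -> R) (f g : T -> R) :
  measurable D -> (forall n, measurable_fun D (f_ n)) -> measurable_fun D f ->
  (forall n x, D x -> `|f_ n x| <= g x) -> mu.-integrable D (EFin \o g) ->
  {ae mu, forall x, D x -> f_ n x @[n --> \oo] --> f x} ->
  mu.-integrable D (EFin \o f) /\
  (\int[mu]_(x in D) f_ n x @[n --> \oo] --> \int[mu]_(x in D) f x).
Proof.
move=> mD mf_ mf fg ig cf.
have [|||//||h1 _ h3] := @dominated_convergence _ _ _ mu D mD (fun n => EFin \o f_ n) (EFin \o f) (EFin \o g).
- by move=> n; apply/measurable_EFinP.
- exact/measurable_EFinP.
- apply: filterS cf => x h Dx; apply: cvg_EFin; first exact: nearW.
  exact: h.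
- by apply: aeW => x n Dx /=; rewrite lee_fin fg.
split => //; apply: fine_cvg; rewrite fineK//.
exact: integrable_fin_num.
Qed.

Lemma dominated_integrable (D : set T) (f g : T -> R) : measurable D ->
  measurable_fun D f -> mu.-integrable D (EFin \o g) ->
  (forall x, D x -> `|f x| <= g x) -> mu.-integrable D (EFin \o f).
Proof.
move=> mD mf ig fg; apply: le_integrable ig => //; first exact/measurable_EFinP.
by move=> x Dx /=; rewrite lee_fin (le_trans (fg x Dx))// ler_norm.
Qed.

Lemma integrable_patch (D : set T) (f : T -> R) : measurable D ->
  mu.-integrable D (EFin \o f) -> mu.-integrable setT (EFin \o (f \_ D)).
Proof.
by move=> mD fi; rewrite -restrict_EFin; apply/integrable_restrict => //; rewrite setTI.
Qed.

Lemma integrable_scale (D : set T) (c : R) (f : T -> R) : measurable D ->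
  mu.-integrable D (EFin \o f) -> mu.-integrable D (EFin \o (fun x => c * f x)).
Proof.
move=> mD fi; rewrite (_ : _ \o _ = (fun x => c%:E * (EFin \o f) x)%E); last first.
  by apply/funext => x /=; rewrite EFinM.
exact: integrableZl.
Qed.

Lemma integrable_sub (D : set T) (f g : T -> R) : measurable D ->
  mu.-integrable D (EFin \o f) -> mu.-integrable D (EFin \o g) ->
  mu.-integrable D (EFin \o (fun x => f x - g x)).
Proof.
move=> mD fi gi; rewrite (_ : _ \o _ = ((EFin \o f) \- (EFin \o g))%E); last first.
  by apply/funext => x /=; rewrite EFinB.
exact: integrableB.
Qed.

Lemma integrable_add (D : set T) (f g : T -> R) : measurable D ->
  mu.-integrable D (EFin \o f) -> mu.-integrable D (EFin \o g) ->
  mu.-integrable D (EFin \o (fun x => f x + g x)).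
Proof.
move=> mD fi gi; rewrite (_ : _ \o _ = ((EFin \o f) \+ (EFin \o g))%E).
  exact: integrableD.
by apply/funext => x /=; rewrite EFinD.
Qed.
End dct.

(** * Rotating the ray of integration *)

Section rot.
Context {R : realType}.
Local Notation mu := (@lebesgue_measure R).
Local Notation D := (`]0, +oo[%classic : set R).

Lemma FTC2_pos (f F : R -> R) (a b : R) : 0 < a -> a < b ->
  (forall x : R, 0 < x -> is_derive x 1 F (f x)) ->
  (forall x : R, 0 < x -> {for x, continuous f}) ->
  \int[mu]_(x in `[a, b]) f x = F b - F a.
Proof.
move=> a0 ab dF cf.
have cF x : 0 < x -> {for x, continuous F} by move=> /dF/der_continuous.
have pos x : x \in `[a, b]%classic -> 0 < x.
  by rewrite inE/= in_itv/= => /andP[ax _]; exact: lt_le_trans ax.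
rewrite /Rintegral (continuous_FTC2 ab (F := F))//.
- apply: continuous_in_subspaceT => x /pos; exact: cf.
- split.
  + by move=> x /andP[ax xb]; have [] := dF x (lt_trans a0 ax).
  + by apply: cvg_at_right_filter; exact: cF.
  + by apply: cvg_at_left_filter; apply: cF; exact: lt_trans ab.
- by move=> x; rewrite in_itv/= => /andP[ax xb]; rewrite derive1E; have [_ ->] := dF x (lt_trans a0 ax).
Qed.

(** The intervals [[1/(n+1), n+2]] increase to the half-line and are nondegenerate already at n = 0,
    as [FTC2_pos] and [rotation_compact] require. *)
Lemma Rintegral_exhaust (f : R -> R) : mu.-integrable D (EFin \o f) ->
  \int[mu]_(x in `[n.+1%:R^-1, n.+2%:R]) f x @[n --> \oo] --> \int[mu]_(x in D) f x.
Proof.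
move=> fi; have mf : measurable_fun D f by apply/measurable_EFinP; exact: measurable_int fi.
have sub n : D `&` `[n.+1%:R^-1, n.+2%:R]%classic = `[n.+1%:R^-1, n.+2%:R]%classic.
  apply/setIidr => x; rewrite /= !in_itv/= andbT => /andP[nx _].
  by rewrite (lt_le_trans _ nx)// invr_gt0.
under eq_fun do rewrite -sub Rintegral_mkcondr.
have [] := @Rintegral_dominated_cvg _ _ _ mu D (fun n => f \_ (`[n.+1%:R^-1, n.+2%:R]%classic)) f (fun x => `|f x|).
- by [].
- move=> n; apply/measurable_restrict => //.
  by apply: measurable_funS mf => //; rewrite setIC sub.
- by [].
- by move=> n x Dx; rewrite patchE; case: ifP => // _; rewrite normr0.
- exact: integrable_norm.
- apply: aeW => x /=; rewrite in_itv/= andbT => x0.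
  apply: cvg_near_cst; near=> n.
  rewrite patchE mem_set//= in_itv/=; apply/andP; split.
    rewrite invf_ple ?posrE// (@le_trans _ _ n%:R) ?ler_nat//.
    near: n; exact: nbhs_infty_ger.
  rewrite (@le_trans _ _ n%:R) ?ler_nat//; last by rewrite ltnW.
  near: n; exact: nbhs_infty_ger.
- by [].
Unshelve. all: end_near. Qed.

Lemma rotation_compact (H K G : R -> R -> R) (a b a' b' e M : R) :
  a' < a -> a < b -> b < b' -> 0 < e -> e < M ->
  (forall r th : R, 0 < r -> a' < th < b' -> is_derive th 1 (H r) (G r th)) ->
  (forall r th : R, 0 < r -> a' < th < b' -> is_derive r 1 (K ^~ th) (G r th)) ->
  (forall r th : R, 0 < r -> a' < th < b' -> {for r, continuous (H ^~ th)}) ->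
  (forall r th : R, 0 < r -> a' < th < b' -> {for r, continuous (G ^~ th)}) ->
  (exists B : R, forall r th : R, e <= r <= M -> a' < th < b' -> `|G r th| <= B) ->
  exists2 th, a <= th <= b & \int[mu]_(r in `[e, M]) H r b - \int[mu]_(r in `[e, M]) H r a =
     (K M th - K e th) * (b - a).
Proof.
move=> a'a ab bb' e0 eM dH dK cH cG [B bG].
pose F th := \int[mu]_(r in `[e, M]) H r th.
have pos r : `[e, M]%classic r -> 0 < r.
  by rewrite /= in_itv/= => /andP[ax _]; exact: lt_le_trans ax.
have cint (f : R -> R) : (forall r : R, 0 < r -> {for r, continuous f}) ->
    mu.-integrable `[e, M] (EFin \o f).
  move=> cf; apply: continuous_compact_integrable; first exact: segment_compact.
  by apply: continuous_in_subspaceT => x; rewrite inE => /pos/cf.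
have dF th : a' < th < b' -> is_derive th 1 F (K M th - K e th).
  move=> thI.
  have p1 x y : `]a', b'[%classic x -> `[e, M]%classic y -> is_derive x 1 ((fun th r => H r th) ^~ y) (G y x).
    by rewrite /= in_itv/= => xI /pos y0; exact: dH.
  have p12 x y : `]a', b'[%classic x -> `[e, M]%classic y -> partial1of2 (fun th r => H r th) x y = G y x.
    by move=> xI yI; rewrite partial1of2E; have [_ ->] := p1 x y xI yI.
  have thI' : `]a', b'[%classic th by rewrite /= in_itv.
  have h1 x : `]a', b'[%classic x -> mu.-integrable `[e, M] (EFin \o (fun r => H r x)).
    by rewrite /= in_itv/= => xI; apply: cint => r r0; exact: cH.
  have h2 x y : `]a', b'[%classic x -> `[e, M]%classic y -> derivable ((fun th r => H r th) ^~ y) x 1.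
    by move=> xI yI; have [] := p1 x y xI yI.
  have B0 (y : R) : 0 <= `|B| by [].
  have iB : mu.-integrable `[e, M] (EFin \o (cst `|B|)).
    by apply: cint => r _; exact: cst_continuous.
  have h3 x y : `]a', b'[%classic x -> `[e, M]%classic y -> `|partial1of2 (fun th r => H r th) x y| <= cst `|B| y.
    move=> xI yI; rewrite p12//= (le_trans _ (ler_norm B))// bG//; by move: xI yI; rewrite /= !in_itv.
  have mI : measurable `[e, M]%classic by [].
  have dble := @derivable_under_integral R _ _ mu (fun th r => H r th) _ mI th a' b' thI' h1 h2 _ B0 iB h3.
  have dE := @differentiation_under_integral R _ _ mu (fun th r => H r th) _ mI th a' b' thI' h1 h2 _ B0 iB h3.
  split; first exact: dble.
  rewrite -derive1E -/F in dE *; rewrite dE.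
  transitivity (\int[mu]_(y in `[e, M]) G y th).
    by apply: eq_Rintegral => y /set_mem yI; exact: p12.
  exact: (@FTC2_pos (G ^~ th) (K ^~ th) e M e0 eM
    (fun r r0 => dK r th r0 thI) (fun r r0 => cG r th r0 thI)).
have sub th : a <= th <= b -> a' < th < b'.
  by move=> /andP[h1 h2]; rewrite (lt_le_trans a'a h1) (le_lt_trans h2 bb').
have [||th thI ->] := @MVT _ F (fun th => K M th - K e th) a b ab.
- by move=> th; rewrite in_itv/= => /andP[h1 h2]; apply: dF; apply: sub; rewrite !ltW.
- apply: continuous_in_subspaceT => th; rewrite inE/= in_itv/= => /sub/dF/der_continuous; exact.
- by exists th => //; move: thI; rewrite in_itv/= => /andP[/ltW-> /ltW->].
Qed.

(** The angle produced by [rotation_compact] depends on the interval, so [K] has to vanish at both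
    ends uniformly in the angle. *)
Lemma rotation (H K G : R -> R -> R) (a b a' b' : R) :
  a' < a -> a < b -> b < b' ->
  (forall r th : R, 0 < r -> a' < th < b' -> is_derive th 1 (H r) (G r th)) ->
  (forall r th : R, 0 < r -> a' < th < b' -> is_derive r 1 (K ^~ th) (G r th)) ->
  (forall r th : R, 0 < r -> a' < th < b' -> {for r, continuous (H ^~ th)}) ->
  (forall r th : R, 0 < r -> a' < th < b' -> {for r, continuous (G ^~ th)}) ->
  (forall e M : R, 0 < e -> exists B : R, forall r th : R, e <= r <= M -> a' < th < b' -> `|G r th| <= B) ->
  mu.-integrable D (EFin \o (H ^~ a)) -> mu.-integrable D (EFin \o (H ^~ b)) ->
  (forall dl : R, 0 < dl -> \forall n \near \oo, forall th : R, a <= th <= b ->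
     `|K (n%:R^-1) th| <= dl /\ `|K n%:R th| <= dl) ->
  \int[mu]_(r in D) H r b = \int[mu]_(r in D) H r a.
Proof.
move=> a'a ab bb' dH dK cH cG bG iHa iHb K0.
have ca := Rintegral_exhaust iHa; have cb := Rintegral_exhaust iHb.
apply/eqP; rewrite -subr_eq0; apply/eqP; apply: (@cvg_seqr_unique _
  (fun n => \int[mu]_(r in `[n.+1%:R^-1, n.+2%:R]) H r b - \int[mu]_(r in `[n.+1%:R^-1, n.+2%:R]) H r a)).
  exact: cvgB.
apply/cvgrPdist_le => dl dl0.
have dl0' : 0 < dl / (2 * (b - a)) by rewrite divr_gt0// mulr_gt0// subr_gt0.
have := K0 _ dl0' => -[N _ KN].
near=> n; rewrite sub0r normrN.
have n0 : (n.+1%:R^-1 : R) < n.+2%:R by rewrite (@le_lt_trans _ _ 1) ?ltr1n// invf_le1 ?ler1n.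
have n1 : (0 : R) < n.+1%:R^-1 by rewrite invr_gt0.
have [th thab ->] := @rotation_compact H K G a b a' b' n.+1%:R^-1 n.+2%:R a'a ab bb' n1 n0 dH dK cH cG (bG _ _ n1).
have Nn : (N <= n)%N by near: n; exact: nbhs_infty_ge.
have [k1 _] := KN n.+1 (leq_trans Nn (leqnSn _)) th thab.
have [_ k2] := KN n.+2 (leq_trans Nn (leqW (leqnSn _))) th thab.
have ba0 : 0 < b - a by rewrite subr_gt0.
rewrite normrM (gtr0_norm ba0) -ler_pdivlMr// (le_trans (ler_normB _ _))//.
rewrite (le_trans (lerD k2 k1))// le_eqVlt; apply/orP; left; apply/eqP.
by field; rewrite gt_eqF.
Unshelve. all: end_near. Qed.
End rot.

(** * Exponential bounds by multiples of 1 / (1 + r^2) *)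

Section dominating.
Context {R : realType}.
Local Notation mu := (@lebesgue_measure R).
Local Notation D := (`]0, +oo[%classic : set R).
Implicit Types r k c a v t : R.

Lemma oneDsqr_gt0 r : 0 < oneDsqr r.
Proof. exact: lt_le_trans (oneDsqr_ge1 r). Qed.

Lemma integrable_pos_oneDsqrV : mu.-integrable D (fun r => ((oneDsqr r)^-1)%:E).
Proof.
have mf (A : set R) : measurable_fun A (fun r => ((oneDsqr r)^-1)%:E).
  apply/measurable_EFinP/measurable_funTS.
  exact: (continuous_measurable_fun (@continuous_oneDsqrV R)).
have ge0 (r : R) : (0 <= ((oneDsqr r)^-1)%:E)%E by rewrite lee_fin invr_ge0 ltW// oneDsqr_gt0.
have : mu.-integrable `[0%R, +oo[ (fun r => ((oneDsqr r)^-1)%:E).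
  apply/integrableP; split; first exact: mf.
  under eq_integral do rewrite gee0_abs//.
  by rewrite integral0y_oneDsqr ltry.
by apply: integrableS => //; apply: subset_itvr; rewrite bnd_simp.
Qed.

Lemma expn_fact_le_expR (y : R) (n : nat) : 0 <= y -> y ^+ n / n`!%:R <= expR y.
Proof.
move=> y0; case: n => [|n]; first by rewrite expr0 fact0 invr1 mulr1 -expR0 ler_expR.
by apply: le_trans (expR_ge1Dxn n y0); rewrite lerDr.
Qed.

(** For r > 1 a single term of the exponential series, of an order n with k n >= 2, dominates r^2.
    For r <= 1 one has 1 + r^2 <= 2, whence the summand 1 + 1 in the constant. *)
Lemma expRN_powR_bound k c : 0 < k -> 0 < c ->
  exists2 C, 0 <= C & forall r, 0 < r -> expR (- (c * r `^ k)) <= C / oneDsqr r.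
Proof.
move=> k0 c0; pose n := Num.bound (2 / k).
have nk : 2 <= k * n%:R.
  by rewrite -ler_pdivrMl// mulrC ltW// archi_boundP// divr_ge0// ltW.
exists (1 + 1 + n`!%:R / c ^+ n) => [|r r0].
  by rewrite !addr_ge0// divr_ge0// exprn_ge0// ltW.
have q0 : 0 < oneDsqr r by exact: oneDsqr_gt0.
have [r1|r1] := leP r 1.
  rewrite ler_pdivlMr// (@le_trans _ _ (1 * 2))//.
    apply: ler_pM; [exact: expR_ge0|exact: ltW| |].
      by rewrite -expR0 ler_expR oppr_le0 mulr_ge0 ?powR_ge0// ltW.
    have : r ^+ 2 <= 1 by rewrite expr_le1// ltW.
    rewrite /oneDsqr; lra.
  have : 0 <= n`!%:R / c ^+ n by rewrite divr_ge0// exprn_ge0// ltW.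
  lra.
rewrite ler_pdivlMr// /oneDsqr mulrDr mulr1.
have y0 : 0 <= c * r `^ k by rewrite mulr_ge0 ?powR_ge0// ltW.
rewrite -addrA lerD//.
  by rewrite -expR0 ler_expR oppr_le0.
rewrite (@le_trans _ _ (n`!%:R / c ^+ n))//; last by rewrite lerDr.
rewrite expRN ler_pdivrMl ?expR_gt0//.
have := expn_fact_le_expR n y0.
rewrite ler_pdivrMr ?ltr0n ?fact_gt0// exprMn => h.
rewrite mulrA ler_pdivlMr ?exprn_gt0// mulrC (le_trans _ h)//.
rewrite ler_pM2l ?exprn_gt0// -(powR_mulrn n (powR_ge0 _ _)) -powRrM.
by rewrite -(powR_mulrn 2 (ltW r0)) ler_powR// ltW.
Qed.

Lemma powR_le_lin k a : 0 < k < 1 -> 0 < a ->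
  exists2 C, 0 <= C & forall r, 0 < r -> r `^ k <= C + a * r.
Proof.
move=> /andP[k0 k1] a0.
(* [M] solves M^k = a M; beyond it the linear term is the larger one. *)
pose M := a `^ (- (1 - k)^-1).
have M0 : 0 < M by exact: powR_gt0.
exists (M `^ k) => [|r r0]; first exact: powR_ge0.
have [rM|Mr] := leP r M.
  have h : r `^ k <= M `^ k by apply: ge0_ler_powR => //; rewrite ?nnegrE ltW.
  have : 0 <= a * r by rewrite mulr_ge0// ltW.
  lra.
rewrite (@le_trans _ _ (a * r))//; last by rewrite lerDr powR_ge0.
have h : r `^ k = r * (r `^ (1 - k))^-1.
  rewrite -powRN -{2}(powRr1 (ltW r0)) -powRD; last by apply/implyP => _; rewrite gt_eqF.
  by congr (_ `^ _); ring.
rewrite h mulrC ler_pM2r// -[leRHS]invrK lef_pV2 ?posrE ?invr_gt0 ?powR_gt0//.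
have -> : a^-1 = M `^ (1 - k).
  rewrite /M -powRrM mulNr mulVf ?gt_eqF ?subr_gt0//.
  by rewrite -powR_inv1// ltW.
by apply: ge0_ler_powR; rewrite ?nnegrE ?subr_ge0 ltW.
Qed.

Lemma expR_lin_powR_bound k a v : 0 < k < 1 -> 0 < a -> 0 <= v ->
  exists2 C, 0 <= C & forall r, 0 < r -> expR (- (a * r) + v * r `^ k) <= C / oneDsqr r.
Proof.
move=> kI a0 v0.
(* With this slope v r^k costs at most half of a r, up to a constant; v + 1 instead of v covers v =
   0. *)
have b0 : 0 < a / 2 / (v + 1) by rewrite !divr_gt0// ltr_wpDl.
have [C1 C10 h1] := powR_le_lin kI b0.
have [C2 C20 h2] := expRN_powR_bound (ltr01 : 0 < (1:R)) (divr_gt0 a0 (ltr0Sn R 1)).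
exists (expR (v * C1) * C2) => [|r r0]; first by rewrite mulr_ge0// expR_ge0.
have := h2 r r0; rewrite (powRr1 (ltW r0)) => {}h2.
rewrite -mulrA (le_trans _ (ler_wpM2l (expR_ge0 _) h2))// -expRD ler_expR.
have h3 : v * r `^ k <= v * (C1 + a / 2 / (v + 1) * r) by rewrite ler_wpM2l// h1.
have h4 : v * (a / 2 / (v + 1) * r) <= a / 2 * r.
  have v1 : 0 < v + 1 by rewrite ltr_wpDl.
  have -> : v * (a / 2 / (v + 1) * r) = v / (v + 1) * (a / 2 * r) by field; rewrite gt_eqF.
  rewrite ler_piMl ?mulr_ge0 ?(ltW r0) ?divr_ge0 ?(ltW a0)//.
  by rewrite ler_pdivrMr// mul1r lerDl.
lra.
Qed.
End dominating.

Section bounded.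
Context {R : realType} (S : R -> R -> Prop).
Implicit Types f g : R -> R -> R.
(** Differentiation under the integral sign asks only for some bound on the angular derivative over
    a compact range of radii, so boundedness is propagated along the syntax of the formula. *)
Variant bounded_on f : Prop :=
  BoundedOn (B : R) of forall x y, S x y -> `|f x y| <= B.
Lemma bounded_on_cst (c : R) : bounded_on (fun _ _ => c).
Proof. by exists `|c|. Qed.
Lemma bounded_on_add f g : bounded_on f -> bounded_on g -> bounded_on (fun x y => f x y + g x y).
Proof.
move=> [A hA] [B hB]; exists (A + B) => x y Sxy.
by rewrite (le_trans (ler_normD _ _))// lerD// ?hA ?hB.
Qed.

Lemma bounded_on_opp f : bounded_on f -> bounded_on (fun x y => - f x y).
Proof. by move=> [A hA]; exists A => x y Sxy; rewrite normrN hA. Qed.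
Lemma bounded_on_mul f g : bounded_on f -> bounded_on g -> bounded_on (fun x y => f x y * g x y).
Proof.
move=> [A hA] [B hB]; exists (A * B) => x y Sxy.
by rewrite normrM ler_pM// ?hA ?hB.
Qed.

Lemma bounded_on_expR f : bounded_on f -> bounded_on (fun x y => expR (f x y)).
Proof.
move=> [A hA]; exists (expR A) => x y Sxy.
by rewrite ger0_norm ?expR_ge0// ler_expR (le_trans (ler_norm _))// hA.
Qed.

Lemma bounded_on_cos f : bounded_on (fun x y => cos (f x y)).
Proof. by exists 1 => x y _; rewrite ler_norml cos_geN1 cos_le1. Qed.
Lemma bounded_on_sin f : bounded_on (fun x y => sin (f x y)).
Proof. by exists 1 => x y _; rewrite ler_norml sin_geN1 sin_le1. Qed.
End bounded.
Ltac bnd := repeat first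
  [ assumption | eapply bounded_on_cst | eapply bounded_on_add | eapply bounded_on_opp
  | eapply bounded_on_mul | eapply bounded_on_expR | eapply bounded_on_cos
  | eapply bounded_on_sin ].

Section positive_axis.
Context {R : realType}.
Local Notation mu := (@lebesgue_measure R).
Local Notation D := (`]0, +oo[%classic : set R).

Lemma measurable_pos_continuous (f : R -> R) :
  (forall r : R, 0 < r -> {for r, continuous f}) -> measurable_fun D f.
Proof.
move=> cf; apply: open_continuous_measurable_fun; first exact: interval_open.
by move=> r; rewrite inE/= in_itv/= andbT; exact: cf.
Qed.

Lemma integrable_pos_oneDsqr_le (f : R -> R) (C : R) :
  (forall r : R, 0 < r -> {for r, continuous f}) ->
  (forall r : R, 0 < r -> `|f r| <= C / oneDsqr r) -> mu.-integrable D (EFin \o f).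
Proof.
move=> cf hf; apply: (@dominated_integrable _ (measurableTypeR R) R mu D f (fun r => C * (oneDsqr r)^-1)) => //.
- exact: measurable_pos_continuous.
- by have := @integrableZl _ (measurableTypeR R) R mu D _ C _ integrable_pos_oneDsqrV; apply.
- by move=> r /=; rewrite in_itv/= andbT; exact: hf.
Qed.

(** A bound C r / (1 + r^2) on [K] is at most C / n both at r = 1/n and at r = n, which gives the
    uniform decay at the two ends. *)
Lemma rotation_oneDsqr (H K G : R -> R -> R) (a b a' b' : R) :
  a' < a -> a < b -> b < b' ->
  (forall r th : R, 0 < r -> a' < th < b' -> is_derive th 1 (H r) (G r th)) ->
  (forall r th : R, 0 < r -> a' < th < b' -> is_derive r 1 (K ^~ th) (G r th)) ->
  (forall r th : R, 0 < r -> a' < th < b' -> {for r, continuous (H ^~ th)}) ->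
  (forall r th : R, 0 < r -> a' < th < b' -> {for r, continuous (G ^~ th)}) ->
  (forall e M : R, 0 < e -> exists B : R, forall r th : R, e <= r <= M -> a' < th < b' -> `|G r th| <= B) ->
  mu.-integrable D (EFin \o (H ^~ a)) -> mu.-integrable D (EFin \o (H ^~ b)) ->
  (exists C : R, forall r th : R, 0 < r -> a <= th <= b -> `|K r th| <= r * (C / oneDsqr r)) ->
  \int[mu]_(r in D) H r b = \int[mu]_(r in D) H r a.
Proof.
move=> a'a ab bb' dH dK cH cG bG iHa iHb [C hC].
refine (rotation a'a ab bb' dH dK cH cG bG iHa iHb _) => dl dl0; near=> n => x xI.
have C0 : 0 <= C.
  have := hC 1 x ltr01 xI; rewrite mul1r => h.
  by have := le_trans (normr_ge0 _) h; rewrite pmulr_lge0 ?invr_gt0 ?oneDsqr_gt0.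
have n0 : (0 : R) < n%:R by rewrite ltr0n; near: n; exact: nbhs_infty_gt.
have Cn : C / n%:R <= dl.
  rewrite ler_pdivrMr// mulrC -ler_pdivrMr//; near: n; exact: nbhs_infty_ger.
have n0' : (0 : R) < n%:R^-1 by rewrite invr_gt0.
split.
  apply: le_trans (hC _ _ n0' xI) _; apply: le_trans Cn.
  rewrite mulrC ler_pM2r// ler_piMr// invf_le1 ?oneDsqr_gt0//; exact: oneDsqr_ge1.
apply: le_trans (hC _ _ n0 xI) _; apply: le_trans Cn.
rewrite mulrCA ler_wpM2l// ler_pdivrMr ?oneDsqr_gt0// /oneDsqr.
by rewrite mulrDr mulr1 expr2 mulrA mulVf ?gt_eqF// mul1r lerDr ltW.
Unshelve. all: end_near. Qed.
End positive_axis.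

(** * Rotation of the ray for exp (t z - v z^k) *)

Section first_rotation.
Context {R : realType} (k v t : R) (kI : 0 < k < 1) (v0 : 0 < v) (t0 : 0 < t).
Local Notation mu := (@lebesgue_measure R).
Local Notation D := (`]0, +oo[%classic : set R).

(** With z = r e^(i th), [ray_mod] and [ray_arg] are the modulus and the argument of e^(i th) exp (t
    z - v z^k). Then [ray_im] is its imaginary part, [ray_re] is r times its real part, and
    [ray_der] is their common derivative. *)
Definition ray_mod r th := expR (t * r * cos th - v * r `^ k * cos (k * th)).
Definition ray_arg r th := th + t * r * sin th - v * r `^ k * sin (k * th).
Definition ray_im r th := ray_mod r th * sin (ray_arg r th).
Definition ray_re r th := r * (ray_mod r th * cos (ray_arg r th)).
Definition ray_der r th := ray_mod r th * (sin (ray_arg r th) *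
  (- (t * r * sin th) + v * k * r `^ k * sin (k * th)) + cos (ray_arg r th) *
  (1 + t * r * cos th - v * k * r `^ k * cos (k * th))).

Lemma is_derive_ray_im (r th : R) : is_derive th 1 (ray_im r) (ray_der r th).
Proof. rewrite /ray_im /ray_der /ray_mod /ray_arg; der; ring. Qed.

Lemma is_derive_ray_re (r th : R) : 0 < r -> is_derive r 1 (ray_re ^~ th) (ray_der r th).
Proof.
move=> r0; rewrite /ray_re /ray_der /ray_mod /ray_arg; der => //.
by field; rewrite gt_eqF.
Qed.

Lemma continuous_ray_im (r th : R) : 0 < r -> {for r, continuous (ray_im ^~ th)}.
Proof. by move=> r0; rewrite /ray_im /ray_mod /ray_arg; ct. Qed.

Lemma continuous_ray_der (r th : R) : 0 < r -> {for r, continuous (ray_der ^~ th)}.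
Proof. by move=> r0; rewrite /ray_der /ray_mod /ray_arg; ct. Qed.

Lemma bounded_ray_der (e M : R) : 0 < e ->
  exists B : R, forall r th : R, e <= r <= M -> `|ray_der r th| <= B.
Proof.
move=> e0; suff [B hB] : bounded_on (fun r th => e <= r <= M) ray_der by exists B.
have hr : bounded_on (fun r th : R => e <= r <= M) (fun r _ => r).
  by exists M => r _ /andP[er rM]; rewrite ger0_norm// (le_trans (ltW e0)).
have hk : bounded_on (fun r th : R => e <= r <= M) (fun r _ => r `^ k).
  exists (M `^ k) => r _ /andP[er rM]; rewrite ger0_norm ?powR_ge0//.
  have r0 := le_trans (ltW e0) er.
  by apply: ge0_ler_powR; rewrite ?nnegrE ?(le_trans r0 rM)//; case/andP: kI => /ltW.
by rewrite /ray_der /ray_mod /ray_arg; bnd.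
Qed.

Lemma ray_mod_le (c r th : R) : 0 < r -> cos th <= - c ->
  ray_mod r th <= expR (- (t * c * r) + v * r `^ k).
Proof.
move=> r0 c0; rewrite /ray_mod ler_expR lerD//.
  by rewrite -mulrA [r * _]mulrC mulrA -mulNr -mulrN ler_pM2r// ler_pM2l.
by rewrite -mulrN ler_piMr ?mulr_ge0 ?powR_ge0 ?(ltW v0)// lerNl cos_geN1.
Qed.

Lemma norm_ray_im (r th : R) : `|ray_im r th| <= ray_mod r th.
Proof.
rewrite normrM (ger0_norm (expR_ge0 _)) ler_piMr ?expR_ge0//.
by rewrite ler_norml sin_geN1 sin_le1.
Qed.

Lemma norm_ray_re (r th : R) : 0 < r -> `|ray_re r th| <= r * ray_mod r th.
Proof.
move=> r0; rewrite !normrM (gtr0_norm r0) ler_pM2l// (ger0_norm (expR_ge0 _)) ler_piMr ?expR_ge0//.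
by rewrite ler_norml cos_geN1 cos_le1.
Qed.

Lemma integrable_ray_im (th : R) : cos th < 0 -> mu.-integrable D (EFin \o (ray_im ^~ th)).
Proof.
move=> c0; have tc : 0 < t * - cos th by rewrite mulr_gt0// oppr_gt0.
have [C C0 hC] := expR_lin_powR_bound kI tc (ltW v0).
apply: (@integrable_pos_oneDsqr_le _ _ C) => r r0; first exact: continuous_ray_im.
apply: (le_trans (norm_ray_im _ _)); apply: le_trans (hC r r0).
by apply: ray_mod_le; rewrite ?opprK.
Qed.

(** Between th and pi the cosine stays below cos th < 0, so exp (t z) decays exponentially in r at a
    uniform rate. This beats exp (v r^k) whatever the sign of cos (k x), because k < 1. *)
Lemma ray_rotation (th : R) : 0 <= th < pi -> cos th < 0 ->
  \int[mu]_(r in D) ray_im r pi = \int[mu]_(r in D) ray_im r th.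
Proof.
move=> /andP[th0 thpi] c0.
have tc : 0 < t * - cos th by rewrite mulr_gt0// oppr_gt0.
have [C C0 hC] := expR_lin_powR_bound kI tc (ltW v0).
have pp : (pi : R) < pi + 1 by rewrite ltrDl.
have tt : th - 1 < th by rewrite ltrBlDl ltrDr.
refine (@rotation_oneDsqr R ray_im ray_re ray_der th pi (th - 1) (pi + 1) tt thpi pp _ _ _ _ _ _ _ _).
- by move=> r x _ _; exact: is_derive_ray_im.
- by move=> r x r0 _; exact: is_derive_ray_re.
- by move=> r x r0 _; exact: continuous_ray_im.
- by move=> r x r0 _; exact: continuous_ray_der.
- by move=> e M e0; have [B hB] := @bounded_ray_der e M e0; exists B => r x rI _; exact: hB.
- exact: integrable_ray_im.
- by apply: integrable_ray_im; rewrite cospi oppr_lt0.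
- exists C => r x r0 /andP[thx xpi].
  have cx : cos x <= - - cos th.
    rewrite opprK leNgt ltr_cos ?in_itv/= ?th0 ?(ltW thpi) ?(le_trans th0 thx)//.
    by rewrite -leNgt.
  rewrite (le_trans (norm_ray_re _ r0))// ler_pM2l//.
  exact: le_trans (ray_mod_le r0 cx) (hC r r0).
Qed.
End first_rotation.

(** * Rotation of the ray for exp (- v z^k) / (s - z) *)

Section second_rotation.
Context {R : realType} (k v s : R) (kI : 0 < k < 1) (v0 : 0 < v) (s0 : 0 < s).
Local Notation mu := (@lebesgue_measure R).
Local Notation D := (`]0, +oo[%classic : set R).

(** With z = r e^(i th), [pole_dist] is |s - z|^2, and exp (- v z^k) has modulus [pole_mod] and
    argument - [pole_arg]. Since e^(i th) / (s - z) = (s e^(i th) - r) / |s - z|^2, [pole_im] and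
    [pole_re] are the imaginary part and r times the real part of e^(i th) exp (- v z^k) / (s -
    z). *)
Definition pole_dist r th := (s * cos th - r) * (s * cos th - r) + s * sin th * (s * sin th).
Definition pole_mod r th := expR (- (v * r `^ k * cos (k * th))).
Definition pole_arg r th := v * r `^ k * sin (k * th).
Definition pole_im r th := pole_mod r th *
  ((cos (pole_arg r th) * (s * sin th) - sin (pole_arg r th) * (s * cos th - r)) / pole_dist r th).
Definition pole_re r th := r * (pole_mod r th *
  ((cos (pole_arg r th) * (s * cos th - r) + sin (pole_arg r th) * (s * sin th)) / pole_dist r th)).
Definition pole_der r th := pole_mod r th *
  (v * k * r `^ k * sin (k * th) *
    ((cos (pole_arg r th) * (s * sin th) - sin (pole_arg r th) * (s * cos th - r)) / pole_dist r th) +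
   (- sin (pole_arg r th) * (v * k * r `^ k * cos (k * th)) * (s * sin th)
     + cos (pole_arg r th) * (s * cos th)
     - cos (pole_arg r th) * (v * k * r `^ k * cos (k * th)) * (s * cos th - r)
     + sin (pole_arg r th) * (s * sin th)) / pole_dist r th -
   (cos (pole_arg r th) * (s * sin th) - sin (pole_arg r th) * (s * cos th - r)) *
    ((2 * s * r * sin th) / (pole_dist r th * pole_dist r th))).

Lemma pole_dist_ge (r th : R) : 0 < th < pi -> (s * sin th) ^+ 2 <= pole_dist r th.
Proof. by move=> thI; rewrite /pole_dist -!expr2 lerDr sqr_ge0. Qed.

Lemma pole_dist_gt0 (r th : R) : 0 < th < pi -> 0 < pole_dist r th.
Proof.
move=> thI; apply: lt_le_trans (pole_dist_ge r thI).
by rewrite exprn_gt0// mulr_gt0// sin_gt0_pi.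
Qed.

Lemma is_derive_pole_im (r th : R) : 0 < th < pi -> is_derive th 1 (pole_im r) (pole_der r th).
Proof.
move=> /(pole_dist_gt0 r); rewrite lt0r => /andP[q0 _].
rewrite /pole_im /pole_der /pole_mod /pole_arg; rewrite /pole_dist in q0 *.
der => //; field; exact: q0.
Qed.

Lemma is_derive_pole_re (r th : R) : 0 < r -> 0 < th < pi -> is_derive r 1 (pole_re ^~ th) (pole_der r th).
Proof.
move=> r0 /(pole_dist_gt0 r); rewrite lt0r => /andP[q0 _].
rewrite /pole_re /pole_der /pole_mod /pole_arg; rewrite /pole_dist in q0 *; der => //.
by field; rewrite q0 gt_eqF.
Qed.

Lemma continuous_pole_im (r th : R) : 0 < r -> 0 < th < pi -> {for r, continuous (pole_im ^~ th)}.
Proof.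
move=> r0 /(pole_dist_gt0 r); rewrite lt0r => /andP[q0 _].
rewrite /pole_im /pole_mod /pole_arg; rewrite /pole_dist in q0 *.
by ct.
Qed.

Lemma continuous_pole_der (r th : R) : 0 < r -> 0 < th < pi -> {for r, continuous (pole_der ^~ th)}.
Proof.
move=> r0 /(pole_dist_gt0 r); rewrite lt0r => /andP[q0 _].
rewrite /pole_der /pole_mod /pole_arg; rewrite /pole_dist in q0 *.
by ct => //; rewrite mulf_neq0.
Qed.

(** A lower bound m on the sine keeps the rays at distance at least s m from the pole s. *)
Lemma bounded_pole_der (e M m a b : R) : 0 < e -> 0 < m -> 0 < a -> b < pi ->
  (forall th, a < th < b -> m <= sin th) ->
  exists B : R, forall r th : R, e <= r <= M -> a < th < b -> `|pole_der r th| <= B.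
Proof.
move=> e0 m0 a0 bpi hm.
suff [B hB] : bounded_on (fun r th => e <= r <= M /\ a < th < b) pole_der.
  by exists B => r th h1 h2; apply: hB.
have hr : bounded_on (fun r th : R => e <= r <= M /\ a < th < b) (fun r _ => r).
  by exists M => r _ [/andP[er rM] _]; rewrite ger0_norm// (le_trans (ltW e0)).
have hk : bounded_on (fun r th : R => e <= r <= M /\ a < th < b) (fun r _ => r `^ k).
  exists (M `^ k) => r _ [/andP[er rM] _]; rewrite ger0_norm ?powR_ge0//.
  have r0 := le_trans (ltW e0) er.
  by apply: ge0_ler_powR; rewrite ?nnegrE ?(le_trans r0 rM)//; case/andP: kI => /ltW.
have hq : bounded_on (fun r th : R => e <= r <= M /\ a < th < b) (fun r th => (pole_dist r th)^-1).
  exists ((s * m) ^+ 2)^-1 => r th [_ /andP[ath thb]].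
  have thI : 0 < th < pi by rewrite (lt_trans a0 ath) (lt_trans thb bpi).
  have q0 := pole_dist_gt0 r thI.
  rewrite gtr0_norm ?invr_gt0// lef_pV2 ?posrE ?exprn_gt0 ?mulr_gt0//.
  apply: le_trans (pole_dist_ge r thI).
  have sm : s * m <= s * sin th by rewrite ler_pM2l// hm// ath.
  by rewrite ler_pXn2r ?nnegrE// ?(le_trans _ sm)// mulr_ge0// ltW.
have hqq : bounded_on (fun r th : R => e <= r <= M /\ a < th < b)
    (fun r th => (pole_dist r th * pole_dist r th)^-1).
  have [B hB] := bounded_on_mul hq hq; exists B => r th rI.
  by rewrite invfM hB.
by rewrite /pole_der /pole_mod /pole_arg; bnd.
Qed.

(** With b = s sin th and a = s cos th - r, this is (b + |a|) b <= 2 (a^2 + b^2). *)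
Lemma pole_quotient_le (x y r th : R) : 0 < th < pi -> `|x| <= 1 -> `|y| <= 1 ->
  `|(x * (s * sin th) + y * (s * cos th - r)) / pole_dist r th| <= 2 / (s * sin th).
Proof.
move=> thI x1 y1; have q0 := pole_dist_gt0 r thI.
have b0 : 0 < s * sin th by rewrite mulr_gt0// sin_gt0_pi.
rewrite normrM (gtr0_norm (_ : 0 < (pole_dist r th)^-1)) ?invr_gt0//.
rewrite ler_pdivrMr// mulrAC ler_pdivlMr//.
rewrite /pole_dist; move: (s * sin th) (s * cos th - r) b0 => b a b0.
have h : `|x * b + y * a| <= b + `|a|.
  rewrite (le_trans (ler_normD _ _))// !normrM (gtr0_norm b0) lerD//.
    by rewrite ler_piMl// ltW.
  by rewrite ler_piMl.
apply: (@le_trans _ _ ((b + `|a|) * b)); first by rewrite ler_pM2r.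
have -> : a * a = `|a| * `|a| by rewrite -!expr2 real_normK ?num_real.
have := sqr_ge0 (`|a| - b / 2); have := sqr_ge0 `|a|; have := sqr_ge0 b; rewrite !expr2.
nra.
Qed.

Lemma pole_mod_le (th1 r th : R) : 0 < th1 -> k * th1 < pi / 2 -> 0 < r -> 0 < th <= th1 ->
  pole_mod r th <= expR (- (v * cos (k * th1) * r `^ k)).
Proof.
move=> th10 kth1 r0 /andP[th0 thth1]; have /andP[k0 k1] := kI.
have pp : (0 : R) < pi by exact: pi_gt0.
rewrite ler_expR lerN2 -[leRHS]mulrA -[leLHS]mulrA ler_pM2l// mulrC ler_pM2l ?powR_gt0//.
have h : k * th <= k * th1 by rewrite ler_pM2l.
have h0 : 0 <= k * th by rewrite mulr_ge0 ?ltW.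
by rewrite leNgt ltr_cos -?leNgt// in_itv/=; lra.
Qed.

(** As long as k th < pi / 2, exp (- v z^k) decays, uniformly for th up to th1. The factor 2 / (s
    sin th) blows up at th = 0, so a rotation can approach the positive axis but not reach it. *)
Lemma pole_bounds (th1 : R) : 0 < th1 -> k * th1 < pi / 2 ->
  exists2 C : R, 0 <= C & forall r th, 0 < r -> 0 < th <= th1 -> th < pi ->
   `|pole_im r th| <= 2 / (s * sin th) * (C / oneDsqr r) /\
   `|pole_re r th| <= r * (2 / (s * sin th) * (C / oneDsqr r)).
Proof.
move=> th10 kth1; have /andP[k0 k1] := kI.
have c0 : 0 < v * cos (k * th1).
  rewrite mulr_gt0// cos_gt0_pihalf// kth1 andbT (@lt_trans _ _ 0) ?mulr_gt0//.
  by rewrite oppr_lt0 divr_gt0// pi_gt0.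
have [C C0 hC] := expRN_powR_bound k0 c0; exists C => // r th r0 thI thpi.
have thI' : 0 < th < pi by move: thI => /andP[-> _].
have hm : `|pole_mod r th| <= C / oneDsqr r.
  rewrite ger0_norm ?expR_ge0//; apply: le_trans (hC r r0).
  exact: pole_mod_le.
have cb x : `|cos x| <= 1 :> R by rewrite ler_norml cos_geN1 cos_le1.
have sb x : `|sin x| <= 1 :> R by rewrite ler_norml sin_geN1 sin_le1.
split.
  rewrite normrM mulrC ler_pM// -mulNr.
  by apply: pole_quotient_le; rewrite ?normrN.
rewrite normrM (gtr0_norm r0) ler_pM2l// normrM mulrC ler_pM//.
by rewrite addrC; apply: pole_quotient_le.
Qed.

Lemma integrable_pole_im (th : R) : 0 < th < pi -> k * th < pi / 2 ->
  mu.-integrable D (EFin \o (pole_im ^~ th)).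
Proof.
move=> thI kth; have /andP[th0 thpi] := thI.
have [C C0 hC] := pole_bounds th0 kth.
apply: (@integrable_pos_oneDsqr_le _ _ (2 / (s * sin th) * C)) => r r0; first exact: continuous_pole_im.
by rewrite -[leRHS]mulrA; have [] := hC r th r0; rewrite ?th0 ?lexx.
Qed.

Lemma pole_rotation (a b : R) : 0 < a -> a < b -> b < pi -> k * b < pi / 2 ->
  \int[mu]_(r in D) pole_im r b = \int[mu]_(r in D) pole_im r a.
Proof.
move=> a0 ab bpi kb; have /andP[k0 k1] := kI.
have b0 := lt_trans a0 ab.
have [a' a'0 a'a] : exists2 a', 0 < a' & a' < a by exists (a / 2); lra.
have [b' bb' b'pi] : exists2 b', b < b' & b' < pi by exists ((b + pi) / 2); lra.
have [m m0 hm] : exists2 m, 0 < m & forall th, a' <= th <= b' -> m <= sin th.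
  have a'b' : a' <= b' by rewrite ltW// (lt_trans a'a)// (lt_trans ab).
  have [|c cI hc] := @EVT_min _ (@sin R) a' b' a'b'.
    by apply: continuous_subspaceT; exact: continuous_sin.
  exists (sin c) => [|th thI]; last by apply: hc; rewrite in_itv.
  apply: sin_gt0_pi; move: cI; rewrite in_itv/= => /andP[h1 h2].
  by rewrite (lt_le_trans a'0 h1) (le_lt_trans h2 b'pi).
have sub th : a' < th < b' -> 0 < th < pi.
  by move=> /andP[h1 h2]; rewrite (lt_trans a'0 h1) (lt_trans h2 b'pi).
refine (@rotation_oneDsqr R pole_im pole_re pole_der a b a' b' a'a ab bb' _ _ _ _ _ _ _ _).
- by move=> r th _ /sub; exact: is_derive_pole_im.
- by move=> r th r0 /sub; exact: is_derive_pole_re.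
- by move=> r th r0 /sub; exact: continuous_pole_im.
- by move=> r th r0 /sub; exact: continuous_pole_der.
- move=> e M e0; apply: (bounded_pole_der _ e0 m0 a'0 b'pi) => th /andP[h1 h2].
  by apply: hm; rewrite !ltW.
- apply: integrable_pole_im; first by rewrite a0 (lt_trans ab).
  by apply: lt_trans kb; rewrite ltr_pM2l.
- by apply: integrable_pole_im; first by rewrite b0.
have [C C0 hC] := pole_bounds b0 kb.
exists (2 / (s * m) * C) => r th r0 /andP[ath thb].
have th0 := lt_le_trans a0 ath.
have [|_ h] := hC r th r0 _ (le_lt_trans thb bpi); first by rewrite th0.
apply: le_trans h _; rewrite ler_pM2l// -[leRHS]mulrA ler_wpM2r//.
  by rewrite divr_ge0// ltW// oneDsqr_gt0.
have hth : m <= sin th by apply: hm; rewrite !ltW// ?(lt_le_trans a'a)// (le_lt_trans thb).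
have ss : 0 < sin th by exact: lt_le_trans hth.
by rewrite ler_pM2l// lef_pV2 ?posrE ?mulr_gt0// ler_pM2l.
Qed.
End second_rotation.

(** * The Laplace transform of the stable density *)

Section affine.
Context {R : realType} (a b : R) (a0 : 0 < a).
Local Notation mu := (@lebesgue_measure R).
Local Notation phi := (fun w : measurableTypeR R => (a * w + b : measurableTypeR R)).

Lemma measurable_affine : measurable_fun setT phi.
Proof. by apply: measurable_funD => //; exact: measurable_funM. Qed.

Let affine_push : {measure set (measurableTypeR R) -> \bar R} :=
  measure_function_pushforward__canonical__measure_function_Measure mu measurable_affine.

(** Lebesgue measure is determined by its values on the intervals ]x, y], where the scaled
    pushforward is computed directly. *)
Lemma lebesgue_measure_affine (A : set R) : measurable A ->
  mscale (NngNum (ltW a0)) affine_push A = mu A.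
Proof.
move=> mA; apply/esym/lebesgue_measure_unique => //= _ [[x y]] _ <-.
rewrite /mscale /affine_push /= /pushforward.
have -> : phi @^-1` `]x, y]%classic = `](x - b) / a, (y - b) / a]%classic.
  apply/seteqP; split => w /=; rewrite !in_itv/= ltr_pdivrMr// ler_pdivlMr//.
    by move=> /andP[h1 h2]; rewrite ltrBlDr lerBrDr mulrC h1 h2.
  by rewrite ltrBlDr lerBrDr mulrC.
rewrite !lebesgue_measure_itv/= !lte_fin ltr_pM2r ?invr_gt0// ltrD2r.
case: ifPn => _; last by rewrite mule0.
by rewrite -!EFinB -EFinM; congr EFin; field; rewrite gt_eqF.
Qed.

Lemma ge0_integral_affine (f : R -> \bar R) : measurable_fun setT f -> (forall x, 0 <= f x)%E ->
  (\int[mu]_x f x = a%:E * \int[mu]_w f (a * w + b)%R)%E.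
Proof.
move=> mf f0.
transitivity (\int[mscale (NngNum (ltW a0)) affine_push]_x f x)%E.
  apply: eq_measure_integral => A mA _. exact: esym (lebesgue_measure_affine mA).
rewrite ge0_integral_mscale//= ge0_integral_pushforward//; exact: measurable_affine.
Qed.

Lemma integrable_affine (f : R -> R) : mu.-integrable setT (EFin \o f) ->
  mu.-integrable setT (EFin \o (fun w => f (a * w + b))).
Proof.
move=> fi; have mf := measurable_int _ fi; apply/integrableP; split.
  by apply: (measurableT_comp mf); exact: measurable_affine.
have /integrableP[_] := fi; rewrite (@ge0_integral_affine (fun x => `|(f x)%:E|)%E)//; last exact: measurableT_comp.
by apply: contraTT => /=; rewrite -!leNgt !leye_eq => /eqP ->; rewrite gt0_muley.
Qed.

Lemma Rintegral_affine (f : R -> R) : mu.-integrable setT (EFin \o f) ->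
  \int[mu]_x f x = a * \int[mu]_w f (a * w + b).
Proof.
move=> fi; have fi' := integrable_affine fi.
have mf := measurable_int _ fi.
rewrite /Rintegral integralE [in RHS]integralE.
have -> := ge0_integral_affine (measurable_funepos mf) (fun x => funepos_ge0 _ x).
have -> := ge0_integral_affine (measurable_funeneg mf) (fun x => funeneg_ge0 _ x).
have := integrable_pos_fin_num measurableT fi'.
have := integrable_neg_fin_num measurableT fi'.
set Y := (Y in Y \is a fin_num -> _) => Yfin; set X := (X in X \is a fin_num -> _) => Xfin.
have eX : (\int[mu]_w (EFin \o f)^\+ (a * w + b)%R = X)%E.
  by apply: eq_integral => w _; rewrite !funeposE.
have eY : (\int[mu]_w (EFin \o f)^\- (a * w + b)%R = Y)%E.
  by apply: eq_integral => w _; rewrite !funenegE.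
rewrite eX eY -/X -/Y.
by rewrite -(fineK Xfin) -(fineK Yfin) -!EFinM -!EFinB /= -mulrBr.
Qed.
End affine.

Section oneDsqr_full.
Context {R : realType}.
Local Notation mu := (@lebesgue_measure R).
(** This is the total mass of the rescaled Poisson kernel, and the source of the factor pi in
    [pole_im_cvg]. *)
Lemma integralT_oneDsqrV : (\int[mu]_x ((oneDsqr x)^-1)%:E = pi%:E)%E.
Proof.
rewrite (@ge0_symfun_integralT _ (fun x => (oneDsqr x)^-1)).
- rewrite (_ : [set x | (0 <= x)%R] = `[0%R, +oo[%classic); last first.
    by apply/seteqP; split => x /=; rewrite in_itv/= andbT.
  by rewrite integral0y_oneDsqr -EFinM; congr EFin; field.
- by move=> x; rewrite invr_ge0 ltW// oneDsqr_gt0.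
- exact: continuous_oneDsqrV.
- by move=> x /=; rewrite /oneDsqr sqrrN.
Qed.

Lemma integrableT_oneDsqrV : mu.-integrable setT (fun x => ((oneDsqr x)^-1)%:E).
Proof.
apply/integrableP; split.
  by apply/measurable_EFinP; exact: (continuous_measurable_fun (@continuous_oneDsqrV R)).
under eq_integral do rewrite gee0_abs ?lee_fin ?invr_ge0 ?(ltW (oneDsqr_gt0 _))//.
by rewrite integralT_oneDsqrV ltry.
Qed.
End oneDsqr_full.

Section sin_bounds.
Context {R : realType}.
Implicit Types x : R.
Lemma sin_MVT x : 0 < x -> exists2 c, 0 < c < x & sin x = cos c * x.
Proof.
move=> x0; have [|c cI] := @MVT _ (@sin R) cos 0 x x0.
  by apply: continuous_subspaceT; exact: continuous_sin.
by rewrite sin0 !subr0 => ->; exists c => //; move: cI; rewrite in_itv.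
Qed.

Lemma norm_sin_le x : `|sin x| <= `|x|.
Proof.
have h (y : R) : 0 < y -> `|sin y| <= `|y|.
  move=> y0; have [c _ ->] := sin_MVT y0.
  by rewrite normrM ler_piMl// ler_norml cos_geN1 cos_le1.
have [x0|x0|->] := ltgtP x 0; last by rewrite sin0.
  by rewrite -[`|sin x|]normrN -sinN -[`|x|]normrN h // oppr_gt0.
by apply: h.
Qed.

Lemma sin_ge_linear x : 0 < x <= 1 -> cos 1 * x <= sin x.
Proof.
move=> /andP[x0 x1]; have [c /andP[c0 cx] ->] := sin_MVT x0.
have h : (1 : R) < pi by have := @pihalf_ge1 R; have := @pi_gt0 R; lra.
by rewrite ler_pM2r// leNgt ltr_cos -?leNgt ?in_itv/=; lra.
Qed.
End sin_bounds.

(** * The limit of the ray integral at the positive axis *)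

Section pole_limit.
Context {R : realType} (k v s : R) (kI : 0 < k < 1) (v0 : 0 < v) (s0 : 0 < s).
Local Notation mu := (@lebesgue_measure R).
Local Notation D := (`]0, +oo[%classic : set R).

(** [P1] contains the Poisson kernel of centre s cos th and width s sin th, which concentrates at r
    = s. [P2] contains the conjugate kernel, whose singularity is compensated by the sine of
    [pole_arg], small with th. *)
Let P0 r th := pole_mod k v r th * cos (pole_arg k v r th).
Let P1 r th := P0 r th * (s * sin th / pole_dist s r th).
Let P2 r th := pole_mod k v r th * sin (pole_arg k v r th) * ((s * cos th - r) / pole_dist s r th).

Let pole_imE r th : pole_im k v s r th = P1 r th - P2 r th.
Proof. by rewrite /pole_im /P1 /P2 /P0; ring. Qed.

Let cP1 (r th : R) : 0 < r -> 0 < th < pi -> {for r, continuous (P1 ^~ th)}.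
Proof.
move=> r0 /(pole_dist_gt0 s0 r); rewrite lt0r => /andP[q0 _].
rewrite /P1 /P0 /pole_mod /pole_arg; rewrite /pole_dist in q0 *; by ct.
Qed.

Let cP2 (r th : R) : 0 < r -> 0 < th < pi -> {for r, continuous (P2 ^~ th)}.
Proof.
move=> r0 /(pole_dist_gt0 s0 r); rewrite lt0r => /andP[q0 _].
rewrite /P2 /pole_mod /pole_arg; rewrite /pole_dist in q0 *; by ct.
Qed.

Let cP0 (r th : R) : 0 < r -> {for r, continuous (P0 ^~ th)}.
Proof. by move=> r0; rewrite /P0 /pole_mod /pole_arg; ct. Qed.

Context (u : nat -> R) (u0 : forall n, 0 < u n <= 1) (ucvg : u n @[n --> \oo] --> 0).

Let upi n : 0 < u n < pi.
Proof. have := u0 n; have := @pihalf_ge1 R; have := @pi_gt0 R; lra. Qed.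
Let ku n : 0 < k * u n <= 1.
Proof.
have /andP[h1 h2] := u0 n; have /andP[k0 k1] := kI.
by rewrite mulr_gt0//= -[leRHS]mulr1 ler_pM// ltW.
Qed.

Let kupi n : k * u n < pi / 2.
Proof.
have /andP[h1 h2] := u0 n; have /andP[k0 k1] := kI; have := @pihalf_ge1 R.
have : k * u n <= k by rewrite ler_piMr// ltW.
lra.
Qed.

(** The sine is O(th) and the conjugate kernel is O(1/th), so the integrands are dominated; they
    tend to 0 at every r except r = s, where the kernel is singular at th = 0. That point is removed
    from the domain. *)
Let P2_to_0 : \int[mu]_(r in D) P2 r (u n) @[n --> \oo] --> 0.
Proof.
have /andP[k0 k1] := kI.
pose c := cos 1 : R.
have c0 : 0 < c by exact: cos1_gt0.
have vc0 : 0 < v * c / 2 by rewrite divr_gt0// mulr_gt0.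
have [C C0 hC] := expRN_powR_bound k0 vc0.
pose g r := (2 / (v * c) * (v * k / (s * c)) * C) * (oneDsqr r)^-1.
have mDs : measurable (D `\ s) by exact: measurableD.
have -> : (fun n => \int[mu]_(r in D) P2 r (u n)) = (fun n => \int[mu]_(r in D `\ s) P2 r (u n)).
  apply/funext => n; rewrite /Rintegral integral_setD1//.
  apply/measurable_EFinP; apply: (@measurable_funS _ _ _ _ D) => //.
  by apply: measurable_pos_continuous => r r0; exact: cP2.
rewrite [X in _ --> X](_ : 0 = \int[mu]_(r in D `\ s) 0); last first.
  by rewrite /Rintegral integral0.
have [||||||//] := @Rintegral_dominated_cvg _ (measurableTypeR R) R mu (D `\ s) (fun n r => P2 r (u n)) (cst 0) g.
- exact: mDs.
- move=> n; apply: (@measurable_funS _ _ _ _ D) => //.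
  by apply: measurable_pos_continuous => r r0; exact: cP2.
- by [].
- move=> n r [/=]; rewrite in_itv/= andbT => r0 _.
  have /andP[un0 un1] := u0 n.
  have ss0 : 0 < sin (u n) by rewrite sin_gt0_pi.
  have q0 := pole_dist_gt0 s0 r (upi n).
  have hm : pole_mod k v r (u n) <= expR (- (v * c * r `^ k)).
    rewrite /pole_mod ler_expR lerN2 -[leRHS]mulrA -[leLHS]mulrA ler_pM2l// mulrC ler_pM2l ?powR_gt0//.
    have := ku n; have h : (1 : R) < pi by have := @pihalf_ge1 R; have := @pi_gt0 R; lra.
    by move=> kun; rewrite /c leNgt ltr_cos -?leNgt ?in_itv/=; lra.
  have hs : `|sin (pole_arg k v r (u n))| <= v * r `^ k * (k * u n).
    apply: le_trans (norm_sin_le _) _; rewrite /pole_arg !normrM (gtr0_norm v0) (gtr0_norm (powR_gt0 _ r0)).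
    rewrite ler_pM2l ?mulr_gt0 ?powR_gt0//; apply: le_trans (norm_sin_le _) _.
    by rewrite gtr0_norm//; case/andP: (ku n).
  have hq : `|(s * cos (u n) - r) / pole_dist s r (u n)| <= (s * c * u n)^-1.
    rewrite normrM (gtr0_norm (_ : 0 < (pole_dist s r (u n))^-1)) ?invr_gt0//.
    rewrite ler_pdivrMr// -ler_pdivrMl ?invr_gt0 ?mulr_gt0// invrK.
    have b0 : 0 < s * sin (u n) by rewrite mulr_gt0.
    apply: (@le_trans _ _ (s * sin (u n) * `|s * cos (u n) - r|)).
      by rewrite ler_wpM2r// -mulrA ler_pM2l// sin_ge_linear.
    rewrite /pole_dist; move: (s * sin (u n)) (s * cos (u n) - r) b0 => b a b0.
    have -> : a * a = `|a| * `|a| by rewrite -!expr2 real_normK ?num_real.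
    by have := sqr_ge0 (`|a| - b); have := sqr_ge0 (`|a| + b); rewrite !expr2; nra.
  rewrite 2!normrM (ger0_norm (expR_ge0 _)).
  apply: (@le_trans _ _ (expR (- (v * c * r `^ k)) * (v * r `^ k * (k * u n)) * (s * c * u n)^-1)).
    by do 2![apply: ler_pM => //; rewrite ?mulr_ge0 ?expR_ge0//].
  have -> : expR (- (v * c * r `^ k)) * (v * r `^ k * (k * u n)) / (s * c * u n) =
     (2 / (v * c) * (v * k / (s * c))) * (expR (- (v * c * r `^ k)) * (v * c / 2 * r `^ k)).
    by field; rewrite !gt_eqF.
  rewrite /g -[leRHS]mulrA ler_wpM2l//.
    by rewrite mulr_ge0// divr_ge0// ?mulr_ge0// ltW// ?mulr_gt0.
  apply: le_trans (hC r r0).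
  (* One half of the exponent absorbs the factor r^k through x <= e^x; the other half is the
     dominating function. *)
  have -> : - (v * c * r `^ k) = - (v * c / 2 * r `^ k) - (v * c / 2 * r `^ k) by field.
  rewrite expRD -mulrA ler_piMr ?expR_ge0// expRN mulrC ler_pdivrMr ?expR_gt0// mul1r.
  by rewrite (le_trans _ (expR_ge1Dx _))// lerDr.
- apply: (@integrableS _ (measurableTypeR R) R mu D) => //.
  by have := @integrableZl _ (measurableTypeR R) R mu D _ (2 / (v * c) * (v * k / (s * c)) * C) _ integrable_pos_oneDsqrV; apply.
- apply: aeW => r [/=]; rewrite in_itv/= andbT => r0 rs.
  have -> : 0 = P2 r 0.
    by rewrite /P2 /pole_arg mulr0 sin0 mulr0 sin0 mulr0 mul0r.
  apply: (@continuous_cvg _ _ _ _ _ u (P2 r)) => //.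
  rewrite /P2 /pole_mod /pole_arg /pole_dist; ct.
  rewrite sin0 cos0 mulr0 mul0r addr0 mulr1 mulf_neq0// subr_eq0; exact/eqP/nesym.
Qed.

Let dominated_pole n (f : R -> R) : (forall r : R, 0 < r -> {for r, continuous f}) ->
  (forall r : R, 0 < r -> `|f r| <= pole_mod k v r (u n) * (2 / (s * sin (u n)))) ->
  mu.-integrable D (EFin \o f).
Proof.
move=> cf hf; have /andP[k0 k1] := kI; have /andP[un0 un1] := u0 n.
have c0 : 0 < v * cos (k * u n).
  rewrite mulr_gt0// cos_gt0_pihalf// kupi andbT (@lt_trans _ _ 0) ?mulr_gt0//.
  by rewrite oppr_lt0 divr_gt0// pi_gt0.
have [C C0 hC] := expRN_powR_bound k0 c0.
apply: (@integrable_pos_oneDsqr_le _ _ (C * (2 / (s * sin (u n))))) => // r r0.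
apply: le_trans (hf r r0) _; rewrite mulrAC ler_pM2r; last first.
  by rewrite divr_gt0// mulr_gt0// sin_gt0_pi.
apply: le_trans (hC r r0); apply: (pole_mod_le kI v0 un0 (kupi n) r0).
by rewrite un0 lexx.
Qed.

Let iP1 n : mu.-integrable D (EFin \o (P1 ^~ (u n))).
Proof.
apply: (@dominated_pole n) => r r0; first exact: cP1.
rewrite /P1 /P0 -mulrA normrM (ger0_norm (expR_ge0 _)) ler_wpM2l ?expR_ge0//.
have := @pole_quotient_le R s s0 (cos (pole_arg k v r (u n))) 0 r (u n) (upi n).
by rewrite mul0r addr0 -mulrA normr0; apply => //; rewrite ler_norml cos_geN1 cos_le1.
Qed.

Let iP2 n : mu.-integrable D (EFin \o (P2 ^~ (u n))).
Proof.
apply: (@dominated_pole n) => r r0; first exact: cP2.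
rewrite /P2 -mulrA normrM (ger0_norm (expR_ge0 _)) ler_wpM2l ?expR_ge0//.
have := @pole_quotient_le R s s0 0 (sin (pole_arg k v r (u n))) r (u n) (upi n).
by rewrite mul0r add0r -mulrA normr0; apply => //; rewrite ler_norml sin_geN1 sin_le1.
Qed.

(** The substitution r = s sin th w + s cos th turns the Poisson kernel into the fixed function 1 /
    (1 + w^2). The remaining factor is at most 1 in absolute value and tends to its value at r = s,
    th = 0. *)
Let P1_to_pi : \int[mu]_(r in D) P1 r (u n) @[n --> \oo] --> pi * expR (- (v * s `^ k)).
Proof.
have /andP[k0 k1] := kI.
pose a n := s * sin (u n); pose b n := s * cos (u n).
have a0 n : 0 < a n by rewrite mulr_gt0// sin_gt0_pi.
pose F n w := ((P0 ^~ (u n)) \_ D) (a n * w + b n) * (oneDsqr w)^-1.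
have mP0 n : measurable_fun setT ((P0 ^~ (u n)) \_ D).
  apply: (measurable_restrictT _ _).1 => //.
  exact: (@measurable_pos_continuous R (P0 ^~ (u n)) (fun r r0 => @cP0 r (u n) r0)).
have hP0 n r : `|((P0 ^~ (u n)) \_ D) r| <= 1.
  rewrite patchE; case: ifPn => [|_]; last by rewrite normr0.
  rewrite inE/= in_itv/= andbT => r0; rewrite normrM -[leRHS]mulr1 ler_pM//.
    rewrite ger0_norm ?expR_ge0// -expR0 ler_expR oppr_le0 !mulr_ge0// ?powR_ge0// ?ltW//.
    apply: cos_gt0_pihalf; have := ku n; have := kupi n; have := @pi_gt0 R; lra.
  by rewrite ler_norml cos_geN1 cos_le1.
have ie (n : nat) : mu.-integrable setT (EFin \o ((P1 ^~ (u n)) \_ D)).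
  exact: integrable_patch (iP1 n).
have -> : (fun n => \int[mu]_(r in D) P1 r (u n)) = (fun n => \int[mu]_w F n w).
  apply/funext => n; rewrite Rintegral_mkcond (Rintegral_affine (b n) (a0 n) (ie n)).
  rewrite -RintegralZl//; last exact: integrable_affine.
  apply: eq_Rintegral => w _; rewrite /F !patchE; case: ifPn => _; last by rewrite mulr0 mul0r.
  rewrite /P1 mulrCA; congr (_ * _); rewrite -/(a n) /pole_dist -/(a n) -/(b n) /oneDsqr.
  have q0 : 1 + w * w != 0 by rewrite gt_eqF// ltr_pwDl// -expr2 sqr_ge0.
  have an0 : a n != 0 by rewrite gt_eqF.
  have -> : (b n - (a n * w + b n)) * (b n - (a n * w + b n)) + a n * a n = a n * a n * (1 + w * w) by ring.
  by rewrite expr2; field; rewrite q0 an0.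
have -> : pi * expR (- (v * s `^ k)) = \int[mu]_w (expR (- (v * s `^ k)) * (oneDsqr w)^-1).
  rewrite RintegralZl//; last exact: integrableT_oneDsqrV.
  by rewrite /Rintegral integralT_oneDsqrV/= mulrC.
have mq : measurable_fun setT (fun w : R => (oneDsqr w)^-1).
  exact: (continuous_measurable_fun (@continuous_oneDsqrV R)).
have [||||||//] := @Rintegral_dominated_cvg _ (measurableTypeR R) R mu setT F
   (fun w => expR (- (v * s `^ k)) * (oneDsqr w)^-1) (fun w => (oneDsqr w)^-1).
- by [].
- move=> n; apply: measurable_funM => //.
  apply: (measurableT_comp (mP0 n)); exact: measurable_affine.
- by apply: measurable_funM => //.
- move=> n w _; rewrite /F normrM (gtr0_norm (_ : 0 < (oneDsqr w)^-1)) ?invr_gt0 ?oneDsqr_gt0//.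
  by rewrite ler_piMl// invr_ge0 ltW// oneDsqr_gt0.
- exact: integrableT_oneDsqrV.
- apply: aeW => w _; apply: cvgM; last exact: cvg_cst.
  pose r th := s * sin th * w + s * cos th.
  have r0 : r 0 = s by rewrite /r sin0 cos0 mulr0 mul0r add0r mulr1.
  have cr : r (u n) @[n --> \oo] --> s.
    rewrite -[X in _ --> X]r0; apply: (@continuous_cvg _ _ _ _ _ u r) => //.
    by rewrite /r; ct.
  have cP : P0 (r (u n)) (u n) @[n --> \oo] --> expR (- (v * s `^ k)).
    have -> : expR (- (v * s `^ k)) = P0 (r 0) 0.
      by rewrite r0 /P0 /pole_mod /pole_arg mulr0 sin0 cos0 mulr0 cos0 !mulr1.
    apply: (@continuous_cvg _ _ _ _ _ u (fun th => P0 (r th) th)) => //.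
    have r00 : 0 < r 0 by rewrite r0.
    by rewrite /P0 /pole_mod /pole_arg /r; ct.
  (* The substituted radius may be negative, where the integrand is extended by 0; for fixed w it
     tends to s > 0 and is eventually positive. *)
  apply: cvg_trans cP; apply: near_eq_cvg; near=> n.
  rewrite patchE mem_set//= in_itv/= andbT.
  by near: n; exact: (cvgr_gt s cr).
Unshelve. all: end_near. Qed.

Lemma pole_im_cvg : \int[mu]_(r in D) pole_im k v s r (u n) @[n --> \oo] --> pi * expR (- (v * s `^ k)).
Proof.
have -> : (fun n => \int[mu]_(r in D) pole_im k v s r (u n)) =
   (fun n => \int[mu]_(r in D) P1 r (u n) - \int[mu]_(r in D) P2 r (u n)).
  apply/funext => n; rewrite -(RintegralB _ (iP1 n) (iP2 n))//.
  by apply: eq_Rintegral => r _; rewrite pole_imE.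
by rewrite -[X in _ --> X]subr0; apply: cvgB; [exact: P1_to_pi|exact: P2_to_0].
Qed.
End pole_limit.

(** The integral does not depend on the angle, so it equals its limit along angles decreasing to
    0. *)
Lemma pole_integral {R : realType} (k v s th : R) : 0 < k < 1 -> 0 < v -> 0 < s ->
  0 < th < pi -> k * th < pi / 2 ->
  \int[lebesgue_measure]_(r in `]0, +oo[) pole_im k v s r th = pi * expR (- (v * s `^ k)).
Proof.
move=> kI v0 s0 /andP[th0 thpi] kth.
(* The shifted harmonic sequence stays strictly below 1, hence [u n < th], as [pole_rotation]
   requires; the minimum with 1 serves the linear bound on the sine. *)
pose u (n : nat) := Num.min th 1 * harmonic n.+1.
have m0 : 0 < Num.min th 1 by rewrite lt_min th0 ltr01.
have h1 (n : nat) : (harmonic n.+1 : R) < 1 by rewrite /= invf_lt1// ltr1n.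
have u0 n : 0 < u n <= 1.
  rewrite mulr_gt0//=; apply: (@le_trans _ _ (1 * 1)); last by rewrite mulr1.
  apply: ler_pM; [exact: ltW|exact: harmonic_ge0| |exact: ltW].
  by rewrite ge_min lexx orbT.
have ucvg : u n @[n --> \oo] --> 0.
  rewrite -[X in _ --> X](mulr0 (Num.min th 1)); apply: cvgM; first exact: cvg_cst.
  rewrite (cvg_shiftS (harmonic : nat -> R)); exact: cvg_harmonic.
have := pole_im_cvg kI v0 s0 u0 ucvg; apply: cvg_seqr_unique.
have -> : (fun n => \int[lebesgue_measure]_(r in `]0, +oo[) pole_im k v s r (u n)) =
  (fun=> \int[lebesgue_measure]_(r in `]0, +oo[) pole_im k v s r th).
  apply/funext => n; apply/esym/pole_rotation => //; first by case/andP: (u0 n).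
  apply: (@lt_le_trans _ _ (Num.min th 1 * 1)); first by rewrite ltr_pM2l.
  by rewrite mulr1 ge_min lexx.
exact: cvg_cst.
Qed.

(* An inductive wrapper keeps unification from unfolding measurability. *)
Variant meas_fun {d} {T : measurableType d} {R : realType} (f : T -> R) : Prop :=
  MeasFun of measurable_fun setT f.

Section meas.
Context d {T : measurableType d} {R : realType}.
Implicit Types f g : T -> R.
Lemma meas_funP f : meas_fun f -> measurable_fun setT f. Proof. by case. Qed.
Lemma me_cst (c : R) : meas_fun (fun _ : T => c).
Proof. by split; exact: measurable_cst. Qed.
Lemma me_add f g : meas_fun f -> meas_fun g -> meas_fun (fun x => f x + g x).
Proof. by move=> [mf] [mg]; split; exact: measurable_funD. Qed.
Lemma me_mul f g : meas_fun f -> meas_fun g -> meas_fun (fun x => f x * g x).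
Proof. by move=> [mf] [mg]; split; exact: measurable_funM. Qed.
Lemma me_opp f : meas_fun f -> meas_fun (fun x => - f x).
Proof. by move=> [mf]; split; exact: measurable_funN. Qed.
Lemma me_exp f : meas_fun f -> meas_fun (fun x => expR (f x)).
Proof. by move=> [mf]; split; apply: (measurableT_comp (@measurable_expR R) mf). Qed.
Lemma me_sin f : meas_fun f -> meas_fun (fun x => sin (f x)).
Proof.
by move=> [mf]; split; apply: (measurableT_comp (continuous_measurable_fun (@continuous_sin R)) mf).
Qed.

Lemma me_cos f : meas_fun f -> meas_fun (fun x => cos (f x)).
Proof.
by move=> [mf]; split; apply: (measurableT_comp (continuous_measurable_fun (@continuous_cos R)) mf).
Qed.

Lemma me_pow p f : meas_fun f -> meas_fun (fun x => f x `^ p).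
Proof. by move=> [mf]; split; apply: (measurableT_comp (measurable_powR p) mf). Qed.
Lemma me_expn n f : meas_fun f -> meas_fun (fun x => f x ^+ n).
Proof. by move=> [mf]; split; exact: measurable_funX. Qed.
End meas.
Lemma me_comp {R : realType} d (T : measurableType d) (g : R -> R) (f : T -> R) :
  measurable_fun setT g -> meas_fun f -> meas_fun (fun x => g (f x)).
Proof. by move=> mg [mf]; split; exact: measurableT_comp mg mf. Qed.
Lemma me_id {R : realType} : meas_fun (fun x : measurableTypeR R => x : R).
Proof. by split. Qed.
Lemma me_idR {R : realType} : meas_fun (fun x : R => x).
Proof. by split. Qed.
Lemma me_fst {R : realType} : meas_fun (fun z : measurableTypeR R * measurableTypeR R => z.1 : R).
Proof. by split; exact: measurable_fst. Qed.
Lemma me_snd {R : realType} : meas_fun (fun z : measurableTypeR R * measurableTypeR R => z.2 : R).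
Proof. by split; exact: measurable_snd. Qed.
Ltac me := apply: meas_funP; repeat first
  [ assumption | eapply me_cst | eapply me_id | eapply me_idR | eapply me_fst | eapply me_snd | eapply me_add | eapply me_opp | eapply me_mul
  | eapply me_exp | eapply me_cos | eapply me_sin | eapply me_pow | eapply me_expn ].

Section fubini_positive.
Context {R : realType}.
Local Notation mu := (@lebesgue_measure R).
Local Notation D := (`]0, +oo[%classic : set R).

(** A bound by a product reduces every integrability condition of Fubini's theorem to the
    one-variable functions [a] and [b]. *)
Lemma Rintegral_Fubini_dominated (h : R -> R -> R) (a b : R -> R) :
  measurable_fun setT (fun z : measurableTypeR R * measurableTypeR R => h z.1 z.2) ->
  mu.-integrable D (EFin \o a) -> mu.-integrable D (EFin \o b) ->
  (forall x y : R, 0 < x -> 0 < y -> `|h x y| <= a x * b y) ->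
  \int[mu]_(x in D) \int[mu]_(y in D) h x y = \int[mu]_(y in D) \int[mu]_(x in D) h x y.
Proof.
move=> mh ia ib hab.
pose f := fun z : measurableTypeR R * measurableTypeR R =>
  (((fun z => h z.1 z.2) \_ (D `*` D)) z)%:E.
have mD : measurable (D : set (measurableTypeR R)) by [].
have mf : measurable_fun setT f.
  apply/measurable_EFinP; apply: (measurable_restrictT _ _).1; first exact: measurableX.
  exact: measurable_funTS mh.
have mhx x : measurable_fun setT (h x).
  exact: (measurableT_comp mh (measurable_fun_pair (measurable_cst x) (@measurable_id _ _ _))).
have mhy y : measurable_fun setT (h ^~ y).
  exact: (measurableT_comp mh (measurable_fun_pair (@measurable_id _ _ _) (measurable_cst y))).
have D0 x : D x -> 0 < x by rewrite /= in_itv/= andbT.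
have ihx x : D x -> mu.-integrable D (EFin \o h x).
  move=> /D0 x0; apply: (@dominated_integrable _ (measurableTypeR R) R mu D (h x) (fun y => a x * b y)) => //.
  - exact: (measurable_funTS (mhx x)).
  - exact: integrable_scale.
  - by move=> y /D0 y0; exact: hab.
have ihy y : D y -> mu.-integrable D (EFin \o h ^~ y).
  move=> /D0 y0; apply: (@dominated_integrable _ (measurableTypeR R) R mu D (h ^~ y) (fun x => b y * a x)) => //.
  - exact: (measurable_funTS (mhy y)).
  - exact: integrable_scale.
  - by move=> x /D0 x0; rewrite mulrC; exact: hab.
have fE x y : f (x, y) = ((if x \in D then h x \_ D else cst 0) y)%:E.
  rewrite /f !patchE in_setX/=; case: (x \in D) => //=.
have fE' x y : f (x, y) = ((if y \in D then (h ^~ y) \_ D else cst 0) x)%:E.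
  rewrite /f !patchE in_setX/= andbC; case: (y \in D) => //=.
have fx x : (\int[mu]_y f (x, y) = (((fun x => \int[mu]_(y in D) h x y) \_ D) x)%:E)%E.
  under eq_integral do rewrite fE; rewrite patchE; case: ifPn => [/set_mem xD|_]; last exact: integral0.
  rewrite Rintegral_mkcond /Rintegral fineK//; apply: integrable_fin_num => //.
  by have := integrable_patch mD (ihx _ xD); apply.
have fy y : (\int[mu]_x f (x, y) = (((fun y => \int[mu]_(x in D) h x y) \_ D) y)%:E)%E.
  under eq_integral do rewrite fE'; rewrite patchE; case: ifPn => [/set_mem xD|_]; last exact: integral0.
  rewrite Rintegral_mkcond /Rintegral fineK//; apply: integrable_fin_num => //.
  by have := integrable_patch mD (ihy _ xD); apply.
have fi : (mu \x mu)%E.-integrable setT f.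
  apply/integrable12ltyP => //.
  have iab := integrable_scale (\int[mu]_(y in D) b y) mD ia.
  apply: (@le_lt_trans _ _ (\int[mu]_(x in D) ((\int[mu]_(y in D) b y) * a x)%:E)%E); last first.
    exact: integrable_lty.
  rewrite [leRHS]integral_mkcond.
  have mf' : measurable_fun setT (abse \o f) by exact: measurableT_comp.
  apply: ge0_le_integral => //.
  - by move=> x _; exact: integral_ge0.
  - exact: (@measurable_fun_fubini_tonelli_F _ _ _ _ R mu (abse \o f) mf' (fun z => abse_ge0 _)).
  - by apply: (measurable_restrictT _ _).1 => //; exact: measurable_int iab.
  move=> x _; rewrite patchE; case: ifPn => [/set_mem xD|xD]; last first.
    by rewrite integral0_eq// => y _; rewrite fE (negbTE xD) abse0.
  have iaxb := integrable_scale (a x) mD ib.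
  rewrite mulrC -RintegralZl// /Rintegral fineK; last exact: integrable_fin_num.
  rewrite (_ : (\int[mu]_y _ = \int[mu]_(y in D) `|(h x y)%:E|)%E); last first.
    rewrite [RHS]integral_mkcond; apply: eq_integral => y _.
    by rewrite fE (mem_set xD) !patchE; case: ifPn => //= _; rewrite normr0.
  apply: ge0_le_integral => //.
  - apply/measurable_EFinP; apply: measurableT_comp => //; exact: measurable_funTS (mhx x).
  - exact: measurable_int iaxb.
  - by move=> y /D0 y0 /=; rewrite lee_fin hab// D0.
rewrite Rintegral_mkcond [RHS]Rintegral_mkcond; congr fine.
under eq_integral do rewrite -fx; under [RHS]eq_integral do rewrite -fy.
exact: Fubini.
Qed.
End fubini_positive.

Section improper_FTC.
Context {R : realType}.
Local Notation mu := (@lebesgue_measure R).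
Local Notation D := (`]0, +oo[%classic : set R).

Lemma FTC2_0y (f F : R -> R) (l0 ly : R) : mu.-integrable D (EFin \o f) ->
  (forall x : R, 0 < x -> is_derive x 1 F (f x)) ->
  (forall x : R, 0 < x -> {for x, continuous f}) ->
  F n.+1%:R^-1 @[n --> \oo] --> l0 -> F n.+2%:R @[n --> \oo] --> ly ->
  \int[mu]_(x in D) f x = ly - l0.
Proof.
move=> fi dF cf F0 Fy; apply: cvg_seqr_unique (Rintegral_exhaust fi) _.
rewrite (_ : (fun n => _) = (fun n => F n.+2%:R - F n.+1%:R^-1)); first exact: cvgB.
apply/funext => n.
have n1 : (0 : R) < n.+1%:R^-1 by rewrite invr_gt0.
have n0 : (n.+1%:R^-1 : R) < n.+2%:R by rewrite (@le_lt_trans _ _ 1) ?ltr1n// invf_le1 ?ler1n.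
exact: (FTC2_pos n1 n0 dF cf).
Qed.

Lemma integrable_expRN (a : R) : 0 < a -> mu.-integrable D (EFin \o (fun t => expR (- (a * t)))).
Proof.
move=> a0; have [C C0 hC] := expRN_powR_bound (ltr01 : 0 < (1:R)) a0.
apply: (@integrable_pos_oneDsqr_le _ _ C) => t t0; first by ct.
by rewrite ger0_norm ?expR_ge0//; have := hC t t0; rewrite powRr1 // ltW.
Qed.

Lemma cvg_expRN_mulrn (a : R) : 0 < a -> expR (- (a * n.+2%:R)) @[n --> \oo] --> 0.
Proof.
move=> a0; apply: (@squeeze_cvgr _ _ _ _ (fun=> 0) (fun n => a^-1 * harmonic n.+1)).
- apply: nearW => n; rewrite expR_ge0/= expRN -invfM lef_pV2 ?posrE ?expR_gt0 ?mulr_gt0//.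
  by rewrite (le_trans _ (expR_ge1Dx _))// lerDr.
- exact: cvg_cst.
- rewrite -[X in _ --> X](mulr0 a^-1); apply: cvgM; first exact: cvg_cst.
  rewrite (cvg_shiftS (harmonic : nat -> R)); exact: cvg_harmonic.
Qed.

Lemma cvg_comp_harmonic (F : R -> R) : {for 0, continuous F} -> F n.+1%:R^-1 @[n --> \oo] --> F 0.
Proof.
by move=> cF; apply: (@continuous_cvg _ _ _ _ _ (harmonic : nat -> R) F) => //; exact: cvg_harmonic.
Qed.

Lemma integrable_expRN_sin (a b phi : R) : 0 < a ->
  mu.-integrable D (EFin \o (fun t => expR (- (a * t)) * sin (phi + b * t))).
Proof.
move=> a0; apply: (@dominated_integrable _ (measurableTypeR R) R mu D _ (fun t => expR (- (a * t)))) => //.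
- by apply: measurable_pos_continuous => t t0; ct.
- exact: integrable_expRN.
- move=> t _; rewrite normrM (ger0_norm (expR_ge0 _)) ler_piMr ?expR_ge0//.
  by rewrite ler_norml sin_geN1 sin_le1.
Qed.

(** This is the imaginary part of e^(i phi) / (a - i b), the integral of e^(i phi) e^(- (a - i b)
    t); [F] below is the imaginary part of the complex antiderivative. *)
Lemma integral_expRN_sin (a b phi : R) : 0 < a ->
  \int[mu]_(t in D) (expR (- (a * t)) * sin (phi + b * t)) =
  (a * sin phi + b * cos phi) / (a * a + b * b).
Proof.
move=> a0; have q0 : a * a + b * b != 0 by rewrite gt_eqF// ltr_pwDl ?mulr_gt0// -expr2 sqr_ge0.
pose G t := a * sin (phi + b * t) + b * cos (phi + b * t).
pose F t := - (expR (- (a * t)) * G t) / (a * a + b * b).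
have -> : (a * sin phi + b * cos phi) / (a * a + b * b) = 0 - F 0.
  by rewrite /F /G !mulr0 addr0 oppr0 expR0; field.
apply: (@FTC2_0y _ F).
- exact: integrable_expRN_sin.
- move=> t _; rewrite /F /G; der => //; field; exact: q0.
- by move=> t _; ct.
- by apply: cvg_comp_harmonic; rewrite /F /G; ct.
- apply/norm_cvg0P.
  apply: (@squeeze_cvgr _ _ _ _ (fun=> 0) (fun n => expR (- (a * n.+2%:R)) * ((`|a| + `|b|) / (a * a + b * b)))).
  + apply: nearW => n; rewrite normr_ge0/= normrM normrN normrM (ger0_norm (expR_ge0 _)) -mulrA ler_pM2l ?expR_gt0//.
    have q1 : 0 < (a * a + b * b)^-1 by rewrite invr_gt0 lt0r q0 addr_ge0// -expr2 sqr_ge0.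
    rewrite (gtr0_norm q1) ler_pM2r//.
    rewrite (le_trans (ler_normD _ _))// !normrM lerD// ler_piMr// ler_norml.
      by rewrite sin_geN1 sin_le1.
    by rewrite cos_geN1 cos_le1.
  + exact: cvg_cst.
  + rewrite -[X in _ --> X](mul0r ((`|a| + `|b|) / (a * a + b * b))); apply: cvgM; last exact: cvg_cst.
    exact: cvg_expRN_mulrn.
Qed.
End improper_FTC.

(** * Exchange of the two integrals on an intermediate ray *)

Section laplace_ray.
Context {R : realType} (k : R) (kI : 0 < k < 1).
Local Notation mu := (@lebesgue_measure R).
Local Notation D := (`]0, +oo[%classic : set R).

(* For k < 1, [stable_density k v] is the density on ]0, +oo[ of the positive
   k-stable law with Laplace transform [s |-> expR (- (v * s `^ k))]. *)
Definition stable_density v t := pi^-1 * \int[mu]_(r in D) ray_im k v t r pi.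

(** The angle pi / (1 + k) satisfies k th = pi - th, so both k th < pi / 2 and cos th < 0 amount to
    th > pi / 2. On this ray exp (t z) and exp (- v z^k) both decay. *)
Lemma rotation_angle : exists th, [/\ 0 < th < pi, k * th < pi / 2 & cos th < 0 :> R].
Proof.
have /andP[k0 k1] := kI; have pp := @pi_gt0 R.
have k1' : 0 < 1 + k by lra.
have thI : 0 < pi / (1 + k) < pi by rewrite divr_gt0//= ltr_pdivrMr//; nra.
exists (pi / (1 + k)); split => //.
- by rewrite mulrA ltr_pdivrMr// mulrC; nra.
- rewrite -(@cos_pihalf R) ltr_cos ?in_itv/=; [by rewrite ltr_pdivlMr// mulrC; nra|lra|lra].
Qed.

Section angle.
Context (th : R) (thI : 0 < th < pi) (kth : k * th < pi / 2) (costh : cos th < 0).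

Lemma stable_densityE v t : 0 < v -> 0 < t ->
  stable_density v t = pi^-1 * \int[mu]_(r in D) ray_im k v t r th.
Proof.
move=> v0 t0; rewrite /stable_density (ray_rotation kI v0 t0 _ costh)//.
by case/andP: thI => /ltW-> ->.
Qed.

(** On the chosen ray exp (t z) has modulus at most 1, so e^(-s t) [pole_mod] dominates up to a
    constant and the integrals may be exchanged. The inner integral of e^(-s t) exp (t z) is 1 / (s
    - z), which turns the integrand of the first rotation into that of the second. *)
Lemma laplace_stable_density_angle v s : 0 < v -> 0 < s ->
  \int[mu]_(t in D) (expR (- (s * t)) * stable_density v t) = expR (- (v * s `^ k)).
Proof.
move=> v0 s0; have /andP[k0 k1] := kI; have /andP[th0 thpi] := thI.
have -> : expR (- (v * s `^ k)) = pi^-1 * \int[mu]_(r in D) pole_im k v s r th.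
  by rewrite pole_integral// mulrA mulVf ?mul1r// gt_eqF// pi_gt0.
have c0 : 0 < v * cos (k * th).
  rewrite mulr_gt0// cos_gt0_pihalf// kth andbT (@lt_trans _ _ 0)// ?mulr_gt0//.
  by rewrite oppr_lt0 divr_gt0// pi_gt0.
have [C C0 hC] := expRN_powR_bound k0 c0.
pose h t r := expR (- (s * t)) * (pi^-1 * ray_im k v t r th).
have hle t r : 0 < t -> 0 < r -> `|h t r| <= expR (- (s * t)) * (pi^-1 * C / oneDsqr r).
  move=> t0 r0; rewrite normrM (ger0_norm (expR_ge0 _)) ler_pM2l ?expR_gt0//.
  rewrite normrM gtr0_norm ?invr_gt0 ?pi_gt0// -mulrA ler_pM2l ?invr_gt0 ?pi_gt0//.
  apply: (le_trans (norm_ray_im _ _ _ _ _)); apply: le_trans (hC r r0).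
  have thth : 0 < th <= th by rewrite th0 lexx.
  apply: le_trans (pole_mod_le kI v0 th0 kth r0 thth).
  by rewrite ler_expR gerDr pmulr_rle0 ?mulr_gt0// ltW.
transitivity (\int[mu]_(t in D) \int[mu]_(r in D) h t r).
  apply: eq_Rintegral => t; rewrite inE/= in_itv/= andbT => t0.
  have ii := integrable_ray_im kI v0 t0 costh.
  by rewrite stable_densityE// -RintegralZl// -RintegralZl// ; apply: integrable_scale.
rewrite (Rintegral_Fubini_dominated (a := fun t => expR (- (s * t)))
   (b := fun r => pi^-1 * C / oneDsqr r)) //; first last.
- exact: integrable_scale integrable_pos_oneDsqrV.
- exact: integrable_expRN.
- by rewrite /h /ray_im /ray_mod /ray_arg; me.
rewrite -RintegralZl//; last exact: integrable_pole_im.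
apply: eq_Rintegral => r; rewrite inE/= in_itv/= andbT => r0.
pose a := s - r * cos th; have a0 : 0 < a by rewrite subr_gt0 (lt_trans _ s0)// pmulr_rlt0.
transitivity (\int[mu]_(t in D) (pi^-1 * pole_mod k v r th *
   (expR (- (a * t)) * sin (th - pole_arg k v r th + r * sin th * t)))).
  apply: eq_Rintegral => t _; rewrite /h /ray_im /ray_mod /ray_arg /pole_mod /pole_arg /a.
  rewrite [expR (t * r * cos th - _)]expRD.
  have -> : - ((s - r * cos th) * t) = - (s * t) + t * r * cos th by ring.
  rewrite [expR (- (s * t) + _)]expRD.
  have -> : th + t * r * sin th - v * r `^ k * sin (k * th) =
    th - v * r `^ k * sin (k * th) + r * sin th * t by ring.
  by ring.
rewrite RintegralZl//; last exact: integrable_expRN_sin.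
rewrite integral_expRN_sin// /pole_im -[LHS]mulrA; congr (_ * _); congr (_ * _).
rewrite sinB cosB /pole_dist /a; move: (pole_arg k v r th) => be.
have := cos2Dsin2 th; rewrite !expr2; move: (cos th) (sin th) => c S cS.
have -> : (s - r * c) * (s - r * c) + r * S * (r * S) = s * s - 2 * s * r * c + r * r * (c * c + S * S) by ring.
have -> : (s * c - r) * (s * c - r) + s * S * (s * S) = s * s * (c * c + S * S) - 2 * s * r * c + r * r by ring.
rewrite cS !mulr1; congr (_ / _).
transitivity (cos be * (s * S) - sin be * (s * c - r * (c * c + S * S))); first by ring.
by rewrite cS mulr1.
Qed.
End angle.

Lemma laplace_stable_density v s : 0 < v -> 0 < s ->
  \int[mu]_(t in D) (expR (- (s * t)) * stable_density v t) = expR (- (v * s `^ k)).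
Proof. by have [th [? ? ?]] := rotation_angle; apply: (@laplace_stable_density_angle th). Qed.
End laplace_ray.

(** * Functions with a completely monotone Laplace transform *)

Section peak.
Context {R : realType}.
Local Notation W p q := (fun y : R => y ^+ p * (1 - y) ^+ q).

(** The weight y^P (1 - y)^Q peaks at P / (P + Q). Its exponents have to be natural numbers, since
    the kernels available are polynomials in e^(-t). *)
Lemma rational_between (A B : R) : 0 < A -> A < B -> B < 1 ->
  exists p q : nat, A < p.+1%:R / (p.+1 + q.+1)%:R < B.
Proof.
move=> A0 AB B1; have d0 : 0 < B - A by rewrite subr_gt0.
(* The mesh 1/n is finer than B - A, and p + 1 is the least integer above A n. *)
pose n := (Num.truncn (B - A)^-1).+1; pose p := Num.truncn (A * n%:R).
have n0 : (0 : R) < n%:R by rewrite ltr0n.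
have hn : 1 < (B - A) * n%:R by rewrite -ltr_pdivrMl// mulr1 truncnS_gt.
have /andP[p1 p2] := truncn_itv (ltW (mulr_gt0 A0 n0)).
have pB : p.+1%:R < B * n%:R by rewrite -natr1; lra.
have pn : (p.+1 < n)%N.
  by rewrite -(ltr_nat R) (lt_trans pB)// gtr_pMl.
exists p, (n - p.+1).-1; rewrite prednK ?subn_gt0// subnKC; last exact: ltnW.
by rewrite ltr_pdivlMr// ltr_pdivrMr// p2 pB.
Qed.

Section peak_pq.
Context (p q : nat).
Let P := p.+1.
Let Q := q.+1.
Let rho : R := P%:R / (P + Q)%:R.

Let dW (y : R) : is_derive y 1 (W P Q) (y ^+ p * (1 - y) ^+ q * (P%:R - (P + Q)%:R * y)).
Proof.
der; rewrite /P /Q /= natrD !exprS; ring.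
Qed.

Let cW : continuous (W P Q).
Proof. by move=> y; exact: der_continuous (dW y). Qed.

Let PQ0 : (0 : R) < (P + Q)%:R.
Proof. by rewrite ltr0n. Qed.

Let incW (x y : R) : 0 <= x -> x < y -> y <= rho -> W P Q x < W P Q y.
Proof.
move=> x0 xy yr.
have [|c] := @MVT _ (W P Q) _ x y xy (fun z _ => dW z).
  exact: continuous_subspaceT.
rewrite in_itv/= => /andP[xc cy] h; rewrite -subr_gt0 h mulr_gt0 ?subr_gt0//.
have cr : c < rho by exact: lt_le_trans yr.
have c0 : 0 < c by exact: le_lt_trans xc.
have c1 : c < 1.
  by rewrite (lt_trans cr)// /rho ltr_pdivrMr// mul1r ltr_nat -[ltnLHS]addn0 ltn_add2l.
rewrite !mulr_gt0 ?exprn_gt0 ?subr_gt0//.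
by rewrite mulrC -ltr_pdivlMr.
Qed.

Let decW (x y : R) : rho <= x -> x < y -> y <= 1 -> W P Q y < W P Q x.
Proof.
move=> rx xy y1.
have [|c] := @MVT _ (W P Q) _ x y xy (fun z _ => dW z).
  exact: continuous_subspaceT.
rewrite in_itv/= => /andP[xc cy] h; rewrite -subr_lt0 h pmulr_llt0 ?subr_gt0//.
have cr : rho < c by exact: le_lt_trans xc.
have c0 : 0 < c by rewrite (lt_trans _ cr)// divr_gt0.
have c1 : c < 1 by exact: lt_le_trans y1.
rewrite pmulr_rlt0 ?mulr_gt0 ?exprn_gt0 ?subr_gt0// subr_lt0.
by rewrite mulrC -ltr_pdivrMr.
Qed.

(** The weight is strictly monotone on either side of its peak, so its values outside ]A, B[ stay
    below M1, which lies below the peak value. [M2] is halfway between the two and is exceeded near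
    the peak by continuity. Taking powers amplifies the gap between M1 and M2. *)
Lemma peak_at_ratio (A B : R) : 0 < A -> A < rho -> rho < B -> B < 1 ->
  exists M1 M2 A' B' : R, [/\ 0 <= M1 < M2, [/\ A < A', A' < B' & B' < B],
    (forall y, 0 <= y <= 1 -> y <= A \/ B <= y -> W P Q y <= M1) &
    (forall y, A' <= y <= B' -> M2 <= W P Q y)].
Proof.
move=> A0 Ar rB B1.
pose M1 := Num.max (W P Q A) (W P Q B); pose M2 := (M1 + W P Q rho) / 2.
have hA : W P Q A < W P Q rho by apply: incW => //; exact: ltW.
have hB : W P Q B < W P Q rho by apply: decW => //; exact: ltW.
have M1r : M1 < W P Q rho by rewrite gt_max hA hB.
have e0 : 0 < (W P Q rho - M1) / 2 by rewrite divr_gt0// subr_gt0.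
have /cvgrPdist_lt/(_ _ e0)[d /= d0 hd] := @cW rho.
pose A' := Num.max ((A + rho) / 2) (rho - d / 2).
pose B' := Num.min ((B + rho) / 2) (rho + d / 2).
have A'r : A' < rho by rewrite gt_max; apply/andP; split; lra.
have rB' : rho < B' by rewrite lt_min; apply/andP; split; lra.
exists M1, M2, A', B'; split.
- apply/andP; split; last by rewrite /M2; lra.
  by rewrite le_max mulr_ge0// exprn_ge0// ?subr_ge0 ltW// (lt_trans _ B1)// (lt_trans Ar).
- split; [|exact: lt_trans rB'|].
  + by rewrite lt_max; apply/orP; left; lra.
  + by rewrite gt_min; apply/orP; left; lra.
- move=> y /andP[y0 y1] [yA|By]; rewrite le_max; apply/orP; [left|right].
  + move: yA; rewrite le_eqVlt => /predU1P[->//|yA].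
    by apply/ltW/incW => //; exact: ltW.
  + move: By; rewrite le_eqVlt => /predU1P[->//|By].
    by apply/ltW/decW => //; exact: ltW.
- move=> y /andP[A'y yB'].
  have h1 : rho - d / 2 <= y by rewrite (le_trans _ A'y)// le_max lexx orbT.
  have h2 : y <= rho + d / 2 by rewrite (le_trans yB')// ge_min lexx orbT.
  have : `|rho - y| < d by rewrite ltr_norml; apply/andP; split; lra.
  move=> /hd; rewrite ltr_norml => /andP[_]; rewrite /M2; lra.
Qed.
End peak_pq.

Lemma expn_dominated (M1 M2 C c : R) : 0 <= M1 < M2 -> 0 < c ->
  exists N, M1 ^+ N * C < M2 ^+ N * c.
Proof.
move=> /andP[M10 M12] c0; have M20 : 0 < M2 by exact: le_lt_trans M12.
have z1 : `|M1 / M2| < 1.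
  by rewrite ger0_norm ?divr_ge0// ?ltr_pdivrMr ?mul1r// ltW.
have h : (M1 / M2) ^+ n * C @[n --> \oo] --> 0.
  by rewrite -[X in _ --> X](mul0r C); apply: cvgM; [exact: cvg_expr|exact: cvg_cst].
have [N _ /(_ N (leqnn _)) /=] := cvgr_lt 0 h c c0.
rewrite expr_div_n mulrAC ltr_pdivrMr ?exprn_gt0// [c * _]mulrC => hN.
by exists N.
Qed.
End peak.

Lemma Rintegral_pos_indic_itv {R : realType} (a b : R) : 0 < a -> a <= b ->
  \int[@lebesgue_measure R]_(t in `]0, +oo[) (\1_(`[a, b]%classic) t : R) = b - a.
Proof.
move=> a0 ab; rewrite /Rintegral integral_indic//=.
have -> : (`[a, b]%classic : set R) `&` `]0, +oo[ = `[a, b]%classic.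
  apply/seteqP; split => [x []//|x h]; split => //.
  by move: h; rewrite /= !in_itv/= andbT => /andP[h _]; exact: lt_le_trans h.
rewrite lebesgue_measure_itv/= lte_fin; case: ltP => //= ba.
have -> : b = a by apply/eqP; rewrite eq_le ab ba.
by rewrite subrr.
Qed.

Section hausdorff.
Context {R : realType}.
Local Notation mu := (@lebesgue_measure R).
Local Notation D := (`]0, +oo[%classic : set R).

(* If c were negative to the right of t0, the kernel [e^(-t p N) (1 - e^-t)^(q N)],
   which for large N concentrates on a small interval to the right of t0, would
   have a negative integral against [e^(-s0 t) c]. *)
Lemma hausdorff_ge0 (c : R -> R) (s0 : R) : 0 < s0 ->
  mu.-integrable D (EFin \o (fun t => expR (- (s0 * t)) * c t)) ->
  (forall t e : R, 0 < t -> 0 < e -> exists2 d : R, 0 < d & forall x, t <= x <= t + d -> `|c x - c t| <= e) ->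
  (forall m n : nat, 0 <= \int[mu]_(t in D) (expR (- ((s0 + n%:R) * t)) * (1 - expR (- t)) ^+ m * c t)) ->
  forall t, 0 < t -> 0 <= c t.
Proof.
move=> s00 ci rc hc t0 t00; rewrite leNgt; apply/negP => ct0.
pose e := - c t0 / 2; have e0 : 0 < e by rewrite /e; lra.
have [d d0 hd] := rc t0 e t00 e0.
have cneg x : t0 <= x <= t0 + d -> c x <= - e.
  by move=> /hd; rewrite ler_norml /e => /andP[_]; lra.
(* Under y = e^(-t) the interval [t0, t0 + d], where c <= - e, becomes the interval between these
   two exponentials, and the kernel is the N-th power of the weight [w]. *)
have [||| p [q /andP[Ar rB]]] := @rational_between R (expR (- (t0 + d))) (expR (- t0)).
- exact: expR_gt0.
- by rewrite ltr_expR; lra.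
- by rewrite -expR0 ltr_expR; lra.
have B1 : expR (- t0) < 1 by rewrite -expR0 ltr_expR; lra.
have [M1 [M2 [A' [B' [M12 [AA' A'B' B'B] W1 W2]]]]] := @peak_at_ratio R p q _ _ (expR_gt0 _) Ar rB B1.
have A'0 : 0 < A' := lt_trans (expR_gt0 _) AA'.
have B'0 : 0 < B' by exact: lt_trans A'B'.
have t1E : t0 < - ln B' by rewrite ltrNr -(expRK (- t0)) ltr_ln ?posrE ?expR_gt0.
have t2E : - ln A' < t0 + d by rewrite ltrNl -(expRK (- (t0 + d))) ltr_ln ?posrE ?expR_gt0.
have t12 : - ln B' < - ln A' by rewrite ltrN2 ltr_ln ?posrE.
pose J := `[- ln B', - ln A']%classic : set R.
pose eta := e * expR (- (s0 * (t0 + d))).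
have eta0 : 0 < eta by rewrite mulr_gt0// expR_gt0.
pose C := \int[mu]_(t in D) `|expR (- (s0 * t)) * c t|.
have k0 : 0 < eta * (- ln A' - - ln B') by rewrite mulr_gt0// subr_gt0.
have [N hN] := expn_dominated C M12 k0.
have := hc (q.+1 * N)%N (p.+1 * N)%N; apply/negP; rewrite -ltNge.
pose w (t : R) : R := expR (- t) ^+ p.+1 * (1 - expR (- t)) ^+ q.+1.
have -> : \int[mu]_(t in D) (expR (- ((s0 + (p.+1 * N)%:R) * t)) * (1 - expR (- t)) ^+ (q.+1 * N) * c t)
  = \int[mu]_(t in D) (expR (- (s0 * t)) * w t ^+ N * c t).
  apply: eq_Rintegral => t _; rewrite /w exprMn -!exprM.
  rewrite mulrDl opprD expRD -expRM_natl; congr (_ * _); rewrite -mulrA; congr (_ * (_ * _)).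
  by rewrite mulrN.
(* [g] majorizes the integrand: on [J] the integrand is at most - M2^N eta, elsewhere on ]t0, t0 +
   d[ it is nonpositive, and for all other t the weight is at most M1. [N] makes the integral of [g]
   negative. *)
pose g (t : R) : R := M1 ^+ N * `|expR (- (s0 * t)) * c t| - M2 ^+ N * eta * \1_J t.
have iJ : mu.-integrable D (EFin \o (\1_J : R -> R)).
  apply: (@integrableS _ (measurableTypeR R) R mu setT) => //.
  exact: integrable_indic_itv.
have inrm : mu.-integrable D (EFin \o (fun t => `|expR (- (s0 * t)) * c t|)).
  exact: integrable_norm ci.
have ig : mu.-integrable D (EFin \o g).
  by apply: integrable_sub => //; apply: integrable_scale.
have wle (t : R) : 0 < t -> 0 <= w t <= 1.
  move=> tt; have h1 : expR (- t) <= 1 by rewrite -expR0 ler_expR; lra.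
  have h0 := expR_ge0 (- t).
  rewrite /w mulr_ge0 ?exprn_ge0 ?subr_ge0//= mulr_ile1 ?exprn_ge0 ?exprn_ile1 ?subr_ge0//; lra.
have mec : measurable_fun D (fun t => expR (- (s0 * t)) * c t).
  by apply/measurable_EFinP; exact: measurable_int ci.
have iw : mu.-integrable D (EFin \o (fun t => expR (- (s0 * t)) * w t ^+ N * c t)).
  apply: (@dominated_integrable _ (measurableTypeR R) R mu D _ _ _ _ inrm) => //.
    rewrite (_ : (fun t => _) = (fun t => w t ^+ N * (expR (- (s0 * t)) * c t))); last first.
      by apply/funext => t; ring.
    apply: measurable_funM => //; apply: measurable_funTS; rewrite /w; me.
  move=> t; rewrite /= in_itv/= andbT => tt.
  have /andP[w0 w1] := wle t tt.
  rewrite mulrAC normrM [X in _ * X]ger0_norm ?exprn_ge0// ler_piMr// exprn_ile1//.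
have key (t : R) : 0 < t -> expR (- (s0 * t)) * w t ^+ N * c t <= g t.
  move=> tt.
  have /andP[w0 w1] := wle t tt; have E0 := expR_gt0 (- (s0 * t)).
  have M10 : 0 <= M1 by case/andP: M12.
  have nrm0 : 0 <= M1 ^+ N * `|expR (- (s0 * t)) * c t| by rewrite mulr_ge0// exprn_ge0.
  rewrite /g indicE; have [tJ|tJ] := boolP (t \in J).
    have /andP[h1 h2] : - ln B' <= t <= - ln A' by move: tJ; rewrite in_setE /J /= in_itv.
    have yI : A' <= expR (- t) <= B'.
      have y1 : A' <= expR (- t) by rewrite -[A'](lnK _) ?posrE// ler_expR lerNr.
      have y2 : expR (- t) <= B' by rewrite -[B'](lnK _) ?posrE// ler_expR lerNl.
      by rewrite y1 y2.
    have wM2 : M2 <= w t by exact: W2.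
    have ce : c t <= - e by apply: cneg; rewrite (le_trans (ltW t1E) h1) (le_trans h2 (ltW t2E)).
    have M20 : 0 <= M2 by case/andP: M12 => h3 /ltW; exact: le_trans.
    have h3 : M2 ^+ N <= w t ^+ N by rewrite lerXn2r// nnegrE.
    have h4 : expR (- (s0 * (t0 + d))) <= expR (- (s0 * t)).
      by rewrite ler_expR lerN2 ler_pM2l// (le_trans h2 (ltW t2E)).
    have h5 : expR (- (s0 * (t0 + d))) * M2 ^+ N <= expR (- (s0 * t)) * w t ^+ N.
      by apply: ler_pM => //; exact: exprn_ge0.
    have h6 : expR (- (s0 * t)) * w t ^+ N * c t <= expR (- (s0 * t)) * w t ^+ N * - e.
      by rewrite ler_wpM2l// mulr_ge0 ?expR_ge0// exprn_ge0.
    have h7 := ler_wpM2r (ltW e0) h5.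
    rewrite mulr1 /eta; move: h6 h7 nrm0; set x1 := _ * c t; set x2 := M1 ^+ N * _; lra.
  rewrite mulr0 subr0; have [/andP[tI1 tI2]|tI] := boolP (t0 < t < t0 + d).
    have ce : c t <= - e by apply: cneg; rewrite !ltW.
    have {}ce : c t <= 0 by rewrite (le_trans ce)// oppr_le0 ltW.
    apply: le_trans nrm0; rewrite mulr_ge0_le0// mulr_ge0 ?expR_ge0// exprn_ge0//.
  have wM1 : w t <= M1.
    apply: W1.
      by rewrite expR_ge0 -[leRHS]expR0 ler_expR oppr_le0 ltW.
    move: tI; rewrite negb_and -!leNgt !ler_expR => /orP[h|h]; [right|left]; rewrite ?ler_expR lerN2//.
  apply: (le_trans (ler_norm _)); rewrite mulrAC normrM mulrC.
  rewrite [`|w t ^+ N|]ger0_norm ?exprn_ge0// ler_wpM2r// lerXn2r// nnegrE.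
apply: (@le_lt_trans _ _ (\int[mu]_(t in D) g t)).
  by apply: le_Rintegral => // t; rewrite /= in_itv/= andbT; exact: key.
rewrite RintegralB//; [|exact: integrable_scale|exact: integrable_scale].
rewrite !RintegralZl// -/C.
rewrite Rintegral_pos_indic_itv ?(ltW t12)//; last by lra.
by rewrite subr_lt0 -mulrA.
Qed.
End hausdorff.

Lemma mulr_powR {R : realType} (p x : R) : 0 < x -> x `^ p * x = x `^ (p + 1).
Proof.
by move=> x0; rewrite powRD; [rewrite powRr1 ?ltW|rewrite (gt_eqF x0) implybT].
Qed.

(** * Complete monotonicity by finite differences *)

Section complete_monotonicity.
Context {R : realType}.
Implicit Types (phi psi : R -> R) (s : R) (m : nat).

(** This is (-1)^m times the m-th forward difference of step 1; on a Laplace transform it inserts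
    the factor (1 - e^(-t))^m under the integral. *)
Fixpoint hdiff m phi s : R :=
  if m is m'.+1 then hdiff m' phi s - hdiff m' phi (s + 1) else phi s.

(* Complete monotonicity through finite differences of step 1: weaker than the
   usual condition for a single [s], but all that [hausdorff_ge0] needs. *)
Definition cmon m phi : Prop :=
  forall j, (j <= m)%N -> forall s, 0 < s -> 0 <= hdiff j phi s.

Lemma eq_hdiff m phi psi s : (forall x, s <= x -> phi x = psi x) ->
  hdiff m phi s = hdiff m psi s.
Proof.
elim: m s => [|m ih] s h /=; first exact: h.
have s1 : s <= s + 1 by rewrite lerDl.
by rewrite !ih// => x /(le_trans s1); exact: h.
Qed.

Lemma hdiffSr m phi s :
  hdiff m.+1 phi s = hdiff m (fun x => phi x - phi (x + 1)) s.
Proof. by elim: m s => [//|m ih] s; rewrite [RHS]/= -!ih. Qed.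

Lemma hdiff_shift m phi s : hdiff m (fun x => phi (x + 1)) s = hdiff m phi (s + 1).
Proof. by elim: m s => [//|m ih] s /=; rewrite !ih. Qed.

Lemma hdiffD m phi psi s :
  hdiff m (fun x => phi x + psi x) s = hdiff m phi s + hdiff m psi s.
Proof. by elim: m s => [//|m ih] s /=; rewrite !ih; ring. Qed.

Lemma hdiffZ m (a : R) phi s : hdiff m (fun x => a * phi x) s = a * hdiff m phi s.
Proof. by elim: m s => [//|m ih] s /=; rewrite !ih; ring. Qed.

(** The discrete Leibniz rule writes one difference of phi psi as (phi - phi(.+1)) psi + phi(.+1)
    (psi - psi(.+1)), a sum of two products to which the induction hypothesis applies. *)
Lemma cmonM m phi psi : cmon m phi -> cmon m psi ->
  forall s, 0 < s -> 0 <= hdiff m (fun x => phi x * psi x) s.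
Proof.
elim: m phi psi => [|m ih] phi psi cphi cpsi s s0.
  by rewrite /= mulr_ge0//; [exact: (cphi 0)|exact: (cpsi 0)].
rewrite hdiffSr.
pose f1 x := (phi x - phi (x + 1)) * psi x.
pose f2 x := phi (x + 1) * (psi x - psi (x + 1)).
have -> : (fun x => phi x * psi x - phi (x + 1) * psi (x + 1)) = (fun x => f1 x + f2 x).
  by apply/funext => x; rewrite /f1 /f2; ring.
rewrite hdiffD addr_ge0//; apply: ih => // j jm x x0.
- by rewrite -hdiffSr; apply: cphi.
- by apply: cpsi => //; exact: leqW.
- by rewrite hdiff_shift; apply: cphi; [exact: leqW|rewrite addr_gt0].
- by rewrite -hdiffSr; apply: cpsi.
Qed.

Lemma der_hdiff m phi (dphi : R -> R) :
  (forall x : R, 0 < x -> is_derive x 1 phi (dphi x)) ->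
  forall s : R, 0 < s -> is_derive s 1 (hdiff m phi) (hdiff m dphi s).
Proof.
move=> h; elim: m => [|m ih] s s0 /=; first exact: h.
apply: der_sub; first exact: ih.
apply: is_derive_eq.
  apply: (@is_derive1_comp _ (hdiff m phi) (fun x => x + 1)).
    apply: (ih (s + 1)); by rewrite addr_gt0.
by rewrite addr0 mulr1.
Qed.

(** The mean value theorem on [s, s + 1] trades one difference for the opposite of a derivative. *)
Lemma hdiffS_ge0 m phi (dphi : R -> R) :
  (forall x : R, 0 < x -> is_derive x 1 phi (- dphi x)) ->
  (forall s, 0 < s -> 0 <= hdiff m dphi s) ->
  forall s, 0 < s -> 0 <= hdiff m.+1 phi s.
Proof.
move=> h h0 s s0 /=.
have dm := @der_hdiff m phi (fun x => - dphi x) h.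
have [|c||c cI] := @MVT _ (hdiff m phi) (hdiff m (fun x => - dphi x)) s (s + 1).
- by lra.
- by rewrite in_itv/= => /andP[sc _]; apply: dm; exact: lt_trans sc.
- apply: continuous_in_subspaceT => x; rewrite inE/= in_itv/= => /andP[sx _].
  by apply: der_continuous; apply: dm; exact: lt_le_trans sx.
move: cI; rewrite in_itv/= => /andP[sc _]; have c0 : 0 < c by exact: lt_trans sc.
have -> : (fun x => - dphi x) = (fun x => -1 * dphi x).
  by apply/funext => x; rewrite mulN1r.
by rewrite hdiffZ => e; have := h0 c c0; lra.
Qed.

Lemma hdiff_powRN_ge0 m (a : R) s : 0 < a -> 0 < s ->
  0 <= hdiff m (fun x => x `^ (- a)) s.
Proof.
elim: m a s => [|m ih] a s a0 s0; first exact: powR_ge0.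
apply: (@hdiffS_ge0 m _ (fun x => a * x `^ (- (a + 1)))) => //.
  move=> x x0; apply: is_derive_eq; first exact: der_pow.
  have -> : x `^ (- a) = x `^ (- (a + 1)) * x.
    by rewrite mulr_powR//; congr (_ `^ _); ring.
  rewrite mulfK ?gt_eqF//; ring.
by move=> x x0; rewrite hdiffZ mulr_ge0 ?(ltW a0)//; apply: ih => //; lra.
Qed.

(** [beta] is the opposite of the logarithmic derivative of phi. Since - phi' = beta phi, the
    difference of order m + 1 of phi is controlled by that of order m of a product, hence by the
    orders up to m of phi itself; this is why [cmon] carries a bound on the order. *)
Lemma hdiff_logarithmic_ge0 phi (beta : R -> R) :
  (forall x : R, 0 < x -> 0 <= phi x) ->
  (forall x : R, 0 < x -> is_derive x 1 phi (- (beta x * phi x))) ->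
  (forall m s, 0 < s -> 0 <= hdiff m beta s) ->
  forall m s, 0 < s -> 0 <= hdiff m phi s.
Proof.
move=> h0 hd hb m.
suff: cmon m phi by move=> h s s0; exact: h.
elim: m => [|m ih] j jm s s0.
  by move: jm; rewrite leqn0 => /eqP ->; exact: h0.
move: jm; rewrite leq_eqVlt => /predU1P[->|]; last by move=> /ih/(_ s s0).
apply: (@hdiffS_ge0 m phi (fun x => beta x * phi x) hd _ s s0).
by apply: cmonM => // i _; exact: hb.
Qed.

(** The exponent v x^k is a Bernstein function: its derivative v k x^(k - 1) is a negative power of
    x because k < 1. *)
Lemma hdiff_stable_ge0 (k v : R) m s : 0 < k < 1 -> 0 < v -> 0 < s ->
  0 <= hdiff m (fun x => expR (- (v * x `^ k))) s.
Proof.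
move=> /andP[k0 k1] v0.
apply: (@hdiff_logarithmic_ge0 _ (fun x => (v * k) * x `^ (- (1 - k)))).
- by move=> x x0; exact: expR_ge0.
- move=> x x0; apply: is_derive_eq.
    apply: der_exp; apply: der_opp; apply: der_mul; exact: der_pow.
  have -> : x `^ k = x `^ (- (1 - k)) * x.
    by rewrite mulr_powR//; congr (_ `^ _); ring.
  rewrite mulfK ?gt_eqF//; ring.
- move=> {}m {}s s0; rewrite hdiffZ; apply: mulr_ge0; first by rewrite mulr_ge0 ?(ltW v0) ?(ltW k0).
  by apply: hdiff_powRN_ge0 => //; lra.
Qed.

Local Notation mu := (@lebesgue_measure R).
Local Notation D := (`]0, +oo[%classic : set R).

Lemma hdiff_laplace (c : R -> R) m s : 0 < s ->
  (forall s', 0 < s' -> mu.-integrable D (EFin \o (fun t => expR (- (s' * t)) * c t))) ->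
  \int[mu]_(t in D) (expR (- (s * t)) * (1 - expR (- t)) ^+ m * c t) =
  hdiff m (fun x => \int[mu]_(t in D) (expR (- (x * t)) * c t)) s.
Proof.
move=> + ci; elim: m s => [|m ih] s s0.
  by apply: eq_Rintegral => t _; rewrite expr0 mulr1.
have i s' : 0 < s' -> mu.-integrable D (EFin \o
    (fun t => expR (- (s' * t)) * (1 - expR (- t)) ^+ m * c t)).
  move=> s'0; have := ci s' s'0 => i0; have := integrable_norm i0 => i1.
  apply: (@dominated_integrable _ (measurableTypeR R) R mu D _ _ _ _ i1) => //.
    rewrite (_ : (fun t => _) = (fun t => (1 - expR (- t)) ^+ m * (expR (- (s' * t)) * c t))); last first.
      by apply/funext => t; ring.
    apply: measurable_funM; first by apply: measurable_funTS; me.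
    by apply/measurable_EFinP; exact: measurable_int i0.
  move=> t; rewrite /= in_itv/= andbT => tt.
  have t1 : expR (- t) <= 1 by rewrite -expR0 ler_expR oppr_le0 ltW.
  have t2 := expR_ge0 (- t).
  rewrite mulrAC normrM [X in _ * X]ger0_norm ?exprn_ge0 ?subr_ge0//.
  by rewrite ler_piMr// exprn_ile1 ?subr_ge0// gerBl.
rewrite /= -!ih ?addr_gt0// -RintegralB//; [|exact: i|by apply: i; rewrite addr_gt0].
apply: eq_Rintegral => t _; rewrite exprS [(s + 1) * t]mulrDl opprD expRD mul1r; ring.
Qed.
End complete_monotonicity.

(** * The stable density is nonnegative *)

Section laplace_tools.
Context {R : realType}.
Local Notation mu := (@lebesgue_measure R).
Local Notation D := (`]0, +oo[%classic : set R).

(** Domination is asked only for t > t0 / 2, because the bounds to which this is applied degenerate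
    as t tends to 0. *)
Lemma continuous_Rintegral_pos (f : R -> R -> R) (g : R -> R) (t0 : R) : 0 < t0 ->
  (forall t, 0 < t -> measurable_fun D (f t)) ->
  (forall t r, 0 < t -> 0 < r -> {for t, continuous (f ^~ r)}) ->
  mu.-integrable D (EFin \o g) ->
  (forall t r, t0 / 2 < t -> 0 < r -> `|f t r| <= g r) ->
  {for t0, continuous (fun t => \int[mu]_(r in D) f t r)}.
Proof.
move=> t00 mf cf gi fg.
have I0 x : x \in (`]t0 / 2, 2 * t0[%classic : set R) -> t0 / 2 < x /\ 0 < x.
  by rewrite inE/= in_itv/= => /andP[h _]; split => //; lra.
have h := @continuity_under_integral R _ (measurableTypeR R) mu f D _ (t0 / 2) (2 * t0) _ _ g gi _.
apply: h => //.
- move=> x /mem_set/I0 [h1 h2].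
  apply: (@dominated_integrable _ (measurableTypeR R) R mu D _ _ _ (mf _ h2) gi) => //.
  by move=> r; rewrite /= in_itv/= andbT; exact: fg.
- by apply: aeW => r /=; rewrite in_itv/= andbT => r0 x /I0[_ x0]; exact: cf.
- move=> x /mem_set/I0 [h1 h2]; apply: aeW => r /=; rewrite in_itv/= andbT; exact: fg.
- by rewrite inE/= in_itv/=; apply/andP; split; lra.
Qed.

Lemma continuous_right_le (c : R -> R) (t e : R) : {for t, continuous c} -> 0 < e ->
  exists2 d : R, 0 < d & forall x, t <= x <= t + d -> `|c x - c t| <= e.
Proof.
move=> /cvgrPdist_le h /h [d /= d0 hd]; exists (d / 2); first by rewrite divr_gt0.
move=> x /andP[tx xt]; rewrite distrC; apply: hd.
by rewrite /= distrC ger0_norm ?subr_ge0//; lra.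
Qed.

Lemma integrable_expRN_bounded (c : R -> R) (B s : R) : 0 < s ->
  measurable_fun D c -> (forall t, 0 < t -> `|c t| <= B) ->
  mu.-integrable D (EFin \o (fun t => expR (- (s * t)) * c t)).
Proof.
move=> s0 mc cB; have iB : mu.-integrable D (EFin \o (fun t => B * expR (- (s * t)))).
  by apply: integrable_scale => //; exact: integrable_expRN.
have mE : measurable_fun setT (fun t : R => expR (- (s * t))) by me.
apply: (@dominated_integrable _ (measurableTypeR R) R mu D _ _ _ _ iB) => //.
  by apply: measurable_funM => //; exact: measurable_funTS mE.
move=> t; rewrite /= in_itv/= andbT => t0.
by rewrite normrM (ger0_norm (expR_ge0 _)) mulrC ler_wpM2r ?expR_ge0// cB.
Qed.
End laplace_tools.

Section stable_density_ge0.
Context {R : realType} (k : R) (kI : 0 < k < 1).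
Local Notation mu := (@lebesgue_measure R).
Local Notation D := (`]0, +oo[%classic : set R).

Lemma continuous_stable_density (v t : R) : 0 < v -> 0 < t ->
  {for t, continuous (stable_density k v)}.
Proof.
move=> v0 t0; have t20 : 0 < t / 2 by rewrite divr_gt0.
have [C C0 hC] := expR_lin_powR_bound kI t20 (ltW v0).
apply: (@cvgM _ _ _ _ (fun=> _) (fun t => \int[mu]_(r in D) ray_im k v t r pi)).
  exact: cvg_cst.
apply: (@continuous_Rintegral_pos _ _ (fun r => C / oneDsqr r)) => //.
- move=> u u0; apply: measurable_pos_continuous => r r0.
  exact: continuous_ray_im.
- by move=> u r u0 r0; rewrite /ray_im /ray_mod /ray_arg; ct.
- exact: integrable_scale integrable_pos_oneDsqrV.
- move=> u r ut r0; apply: le_trans (hC r r0).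
  apply: (le_trans (norm_ray_im _ _ _ _ _)).
  apply: (@le_trans _ _ (expR (- (u * 1 * r) + v * r `^ k))).
    by apply: ray_mod_le; rewrite ?cospi//; lra.
  by rewrite ler_expR mulr1 lerD2r lerN2 ler_pM2r// ltW.
Qed.

(** On the intermediate ray the factor exp (t z) is at most 1 in modulus, and what remains is
    integrable and free of t. *)
Lemma bounded_stable_density (v : R) : 0 < v ->
  exists B : R, forall t, 0 < t -> `|stable_density k v t| <= B.
Proof.
move=> v0; have [th [/andP[th0 thpi] kth costh]] := rotation_angle kI.
have /andP[k0 k1] := kI.
have c0 : 0 < v * cos (k * th).
  rewrite mulr_gt0// cos_gt0_pihalf// kth andbT (@lt_trans _ _ 0)// ?mulr_gt0//.
  by rewrite oppr_lt0 divr_gt0// pi_gt0.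
have [C C0 hC] := expRN_powR_bound k0 c0.
exists (pi^-1 * \int[mu]_(r in D) (C * (oneDsqr r)^-1)) => t t0.
have iC : mu.-integrable D (EFin \o (fun r => C * (oneDsqr r)^-1)).
  exact: integrable_scale integrable_pos_oneDsqrV.
have ii := integrable_ray_im kI v0 t0 costh.
rewrite (stable_densityE kI _ costh)//; last by rewrite th0.
rewrite normrM gtr0_norm ?invr_gt0 ?pi_gt0// ler_pM2l ?invr_gt0 ?pi_gt0//.
apply: (le_trans (le_normr_Rintegral _ ii)) => //.
apply: le_Rintegral => //; first exact: integrable_norm.
move=> r; rewrite /= in_itv/= andbT => r0.
apply: (le_trans (norm_ray_im _ _ _ _ _)); apply: le_trans (hC r r0).
have thth : 0 < th <= th by rewrite th0 lexx.
apply: le_trans (pole_mod_le kI v0 th0 kth r0 thth).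
rewrite /ray_mod /pole_mod ler_expR gerDr pmulr_rle0 ?mulr_gt0// ltW//.
Qed.

Lemma measurable_stable_density (v : R) : 0 < v -> measurable_fun D (stable_density k v).
Proof.
by move=> v0; apply: measurable_pos_continuous => t; exact: continuous_stable_density.
Qed.

Lemma integrable_expRN_stable_density (v s : R) : 0 < v -> 0 < s ->
  mu.-integrable D (EFin \o (fun t => expR (- (s * t)) * stable_density k v t)).
Proof.
move=> v0 s0; have [B hB] := bounded_stable_density v0.
exact: (integrable_expRN_bounded s0 (measurable_stable_density v0) hB).
Qed.

Lemma stable_density_ge0 (v t : R) : 0 < v -> 0 < t -> 0 <= stable_density k v t.
Proof.
move=> v0; apply: (@hausdorff_ge0 _ _ 1) => //.
- exact: integrable_expRN_stable_density.
- move=> u e u0; apply: continuous_right_le; exact: continuous_stable_density.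
- move=> m n; have s0 : (0 : R) < 1 + n%:R by rewrite ltr_pwDl.
  rewrite hdiff_laplace//; last by move=> s'; exact: integrable_expRN_stable_density.
  rewrite (@eq_hdiff _ _ _ (fun x => expR (- (v * x `^ k))))//; last first.
    by move=> x /(lt_le_trans s0); exact: laplace_stable_density.
  exact: hdiff_stable_ge0.
Qed.
End stable_density_ge0.

(** * The transform of t times the stable density *)

Section laplace_derivative.
Context {R : realType}.
Local Notation mu := (@lebesgue_measure R).
Local Notation D := (`]0, +oo[%classic : set R).

Lemma mul_expRN_le (a t : R) : 0 < a ->
  t * expR (- (a * t)) <= 2 / a * expR (- (a / 2 * t)).
Proof.
move=> a0; have -> : - (a * t) = - (a / 2 * t) + - (a / 2 * t) by field.
rewrite expRD mulrA ler_pM2r ?expR_gt0// expRN ler_pdivrMr ?expR_gt0//.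
have := expR_ge1Dx (a / 2 * t) => h.
rewrite -ler_pdivrMl ?divr_gt0// invf_div; lra.
Qed.

(** For x > s / 2 the factor t produced by differentiation is absorbed by half of the exponent,
    uniformly in x. *)
Lemma laplace_derivative (c phi : R -> R) (B s dphi : R) : 0 < s ->
  measurable_fun D c -> (forall t, 0 < t -> `|c t| <= B) ->
  (forall x, 0 < x -> \int[mu]_(t in D) (expR (- (x * t)) * c t) = phi x) ->
  is_derive s 1 phi dphi ->
  mu.-integrable D (EFin \o (fun t => t * (expR (- (s * t)) * c t))) /\
  \int[mu]_(t in D) (t * (expR (- (s * t)) * c t)) = - dphi.
Proof.
move=> s0 mc cB lc dp.
have B0 : 0 <= B by apply: le_trans (cB 1 ltr01).
have i x : 0 < x -> mu.-integrable D (EFin \o (fun t => expR (- (x * t)) * c t)).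
  by move=> x0; exact: integrable_expRN_bounded x0 mc cB.
pose a := s / 2; have a0 : 0 < a by rewrite divr_gt0.
pose G (t : R) := B * (2 / a) * expR (- (a / 2 * t)).
have iG : mu.-integrable D (EFin \o G).
  by apply: integrable_scale => //; apply: integrable_expRN; rewrite divr_gt0.
have G0 t : 0 <= G t by rewrite !mulr_ge0 ?expR_ge0// invr_ge0 ltW.
have dG x t : a < x -> 0 < t -> `|t * (expR (- (x * t)) * c t)| <= G t.
  move=> ax t0; rewrite mulrA normrM ger0_norm ?mulr_ge0 ?expR_ge0 ?(ltW t0)// mulrC /G -mulrA.
  apply: ler_pM => //; [by rewrite mulr_ge0 ?expR_ge0 ?ltW|exact: cB|].
  apply: le_trans (mul_expRN_le _ a0); rewrite ler_pM2l// ler_expR lerN2 ler_pM2r//.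
  exact: ltW.
pose f (x t : R) := expR (- (x * t)) * c t.
have df (x t : R) : is_derive x 1 (f ^~ t) (- (t * f x t)).
  by rewrite /f; der; ring.
have I0 (x : R) : (`]a, 2 * s[%classic : set R) x -> a < x /\ 0 < x.
  by rewrite /= in_itv/= => /andP[ax _]; split => //; exact: lt_trans ax.
have hI : (`]a, 2 * s[%classic : set R) s by rewrite /= in_itv/= /a; apply/andP; split; lra.
have p1E x t : partial1of2 f x t = - (t * f x t).
  by rewrite partial1of2E; apply: derive_val.
have iS : mu.-integrable D (EFin \o (fun t => t * (expR (- (s * t)) * c t))).
  apply: (@dominated_integrable _ (measurableTypeR R) R mu D _ _ _ _ iG) => //.
    apply: measurable_funM; first exact: measurable_id.
    by apply: measurable_funM => //; apply: measurable_funTS; me.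
  by move=> t; rewrite /= in_itv/= andbT => t0; apply: dG => //; case: (I0 s hI).
split => //.
have mD : measurable D by [].
have h := @differentiation_under_integral R _ (measurableTypeR R) mu f D mD s a (2 * s) hI _ _ G G0 iG _.
rewrite /= derive1E in h.
rewrite -[LHS]opprK; congr (- _).
transitivity (\int[mu]_(t in D) partial1of2 f s t).
  rewrite -mulN1r -RintegralZl//; apply: eq_Rintegral => t _.
  by rewrite p1E mulN1r.
rewrite -h; first last.
- by move=> x t /I0[ax _]; rewrite /= in_itv/= andbT => t0; rewrite p1E normrN; exact: dG.
- by move=> x t _ _; have [] := df x t.
- by move=> x /I0[_]; exact: i.
apply: derive_val; apply: near_eq_is_derive dp.
by near=> x; rewrite lc//; near: x; exact: lt_nbhsr.
Unshelve. all: end_near. Qed.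
End laplace_derivative.

Section stable_density_mean.
Context {R : realType} (k : R) (kI : 0 < k < 1).
Local Notation mu := (@lebesgue_measure R).
Local Notation D := (`]0, +oo[%classic : set R).

(** The factor t is that of t g_v(t) / (k v), the form in which the Mittag-Leffler density enters
    through [ml_density_kernel]. *)
Lemma laplace_mul_stable_density (v s : R) : 0 < v -> 0 < s ->
  mu.-integrable D (EFin \o (fun t => t * (expR (- (s * t)) * stable_density k v t))) /\
  \int[mu]_(t in D) (t * (expR (- (s * t)) * stable_density k v t)) =
  k * v * s `^ (k - 1) * expR (- (v * s `^ k)).
Proof.
move=> v0 s0; have [B hB] := bounded_stable_density kI v0.
have [|i ->] := @laplace_derivative R _ (fun x => expR (- (v * x `^ k))) B s
  (- (k * v * s `^ (k - 1) * expR (- (v * s `^ k)))) s0 (measurable_stable_density kI v0) hB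
  (fun x x0 => laplace_stable_density kI v0 x0) _; last by rewrite opprK.
apply: is_derive_eq.
  apply: der_exp; apply: der_opp; apply: der_mul; exact: der_pow.
have -> : s `^ k = s `^ (k - 1) * s by rewrite mulr_powR// subrK.
rewrite mulfK ?gt_eqF//; ring.
Qed.
End stable_density_mean.

(** * The Mittag-Leffler density *)

Section sine_series.
Context {R : realType} (a : R).

(** [spiral b x] is the imaginary part of e^(i b) exp (- x e^(- i a)), and [spiral_coef] gives its
    Taylor coefficients in x. Differentiation changes the sign and lowers the phase b by a. *)
Definition spiral_coef (b : R) (j : nat) : R := (-1) ^+ j * sin (b - a *+ j) / j`!%:R.
Definition spiral_poly (b : R) (n : nat) (x : R) := \sum_(0 <= j < n) spiral_coef b j * x ^+ j.
Definition spiral (b x : R) := expR (- (x * cos a)) * sin (b + x * sin a).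

Lemma der_spiral_poly (b : R) (n : nat) (x : R) :
  is_derive x 1 (spiral_poly b n.+1) (- spiral_poly (b - a) n x).
Proof.
elim: n => [|n ih].
  rewrite /spiral_poly big_geq// oppr0.
  rewrite (_ : (fun x => _) = (fun=> spiral_coef b 0)); first exact: der_cst.
  by apply/funext => y; rewrite big_nat1 expr0 mulr1.
rewrite (_ : spiral_poly b n.+2 = (fun x => spiral_poly b n.+1 x + spiral_coef b n.+1 * x ^+ n.+1)); last first.
  by apply/funext => y; rewrite /spiral_poly big_nat_recr.
apply: (is_derive_eq (der_add ih (der_mul (der_cst (spiral_coef b n.+1) x) (der_expn n.+1 (der_id x))))).
rewrite mul0r add0r /spiral_poly big_nat_recr//= opprD; congr (_ + _).
rewrite /spiral_coef exprS factS natrM mulrS opprD addrA.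
have f0 : (n`!%:R : R) != 0 by rewrite pnatr_eq0 -lt0n fact_gt0.
have n0 : (n.+1%:R : R) != 0 by rewrite pnatr_eq0.
by move: (n.+1%:R : R) (n`!%:R : R) n0 f0 => N F N0 F0; field; rewrite N0 F0.
Qed.

Lemma der_spiral (b x : R) : is_derive x 1 (spiral b) (- spiral (b - a) x).
Proof.
rewrite /spiral; der.
rewrite addrAC sinB; ring.
Qed.

Lemma ge0_of_derive (G g : R -> R) : G 0 = 0 ->
  (forall x : R, is_derive x 1 G (g x)) -> (forall x, 0 <= x -> 0 <= g x) ->
  forall x, 0 <= x -> 0 <= G x.
Proof.
move=> G0 dG g0 x; rewrite le_eqVlt => /predU1P[<-|x0]; first by rewrite G0.
have cG : {within `[0, x], continuous G}.
  by apply: continuous_subspaceT => y; exact: der_continuous (dG y).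
have [c] := MVT x0 (fun y _ => dG y) cG.
rewrite in_itv/= G0 !subr0 => /andP[c0 _] ->.
by rewrite mulr_ge0// ?g0// ltW.
Qed.

Lemma norm_spiral_le (b x : R) : 0 <= x -> `|spiral b x| <= expR x.
Proof.
move=> x0; rewrite normrM (ger0_norm (expR_ge0 _)).
apply: (@le_trans _ _ (expR (- (x * cos a)))).
  by rewrite ler_piMr ?expR_ge0// ler_norml sin_geN1 sin_le1.
by rewrite ler_expR -mulrN ler_piMr// lerNl cos_geN1.
Qed.

(** By induction on n for all phases at once: the derivative of the remainder of order n + 1 at
    phase b is minus the remainder of order n at phase b - a. The bound [E] vanishes at 0 and grows
    at least as fast, so [E + S] and [E - S] are nonnegative. *)
Lemma spiral_remainder (b x : R) (n : nat) : 0 <= x ->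
  `|spiral b x - spiral_poly b n x| <= expR x * x ^+ n / n`!%:R.
Proof.
elim: n b x => [|n ih] b x x0.
  by rewrite /spiral_poly big_geq// subr0 expr0 fact0 mulr1 divr1 norm_spiral_le.
have f0 : (n`!%:R : R) != 0 by rewrite pnatr_eq0 -lt0n fact_gt0.
have n0 : (n.+1%:R : R) != 0 by rewrite pnatr_eq0.
pose E (y : R) := expR y * y ^+ n.+1 / n.+1`!%:R.
pose S (y : R) := spiral b y - spiral_poly b n.+1 y.
have S0 : S 0 = 0.
  rewrite /S /spiral /spiral_poly !mul0r oppr0 expR0 mul1r addr0 big_nat_recl//.
  rewrite big1_seq ?addr0; last by move=> j _; rewrite expr0n mulr0.
  by rewrite /spiral_coef !expr0 mulr0n subr0 fact0 divr1 mul1r mulr1 subrr.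
have E0 : E 0 = 0 by rewrite /E expr0n mulr0 mul0r.
have dS (y : R) : is_derive y 1 S (- (spiral (b - a) y - spiral_poly (b - a) n y)).
  apply: (is_derive_eq (der_sub (der_spiral b y) (der_spiral_poly b n y))).
  by rewrite opprB opprK addrC.
have dE (y : R) : is_derive y 1 E (E y + expR y * y ^+ n / n`!%:R).
  rewrite /E; der; rewrite /= factS natrM.
  by move: (n.+1%:R : R) (n`!%:R : R) n0 f0 => N F N0 F0; field; rewrite N0 F0.
have Ege y : 0 <= y -> 0 <= E y.
  by move=> y0; rewrite /E !mulr_ge0 ?expR_ge0 ?exprn_ge0.
rewrite ler_norml; apply/andP; split.
  rewrite -subr_ge0 opprK.
  apply: (@ge0_of_derive (fun y => S y + E y)
    (fun y => - (spiral (b - a) y - spiral_poly (b - a) n y) + (E y + expR y * y ^+ n / n`!%:R))) => //.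
  - by rewrite S0 E0 addr0.
  - move=> y y0; have := ih (b - a) y y0; rewrite ler_norml => /andP[_].
    have := Ege y y0; lra.
rewrite -subr_ge0.
apply: (@ge0_of_derive (fun y => E y - S y)
    (fun y => (E y + expR y * y ^+ n / n`!%:R) - - (spiral (b - a) y - spiral_poly (b - a) n y))) => //.
- by rewrite S0 E0 subr0.
- move=> y y0; have := ih (b - a) y y0; rewrite ler_norml => /andP[+ _].
  have := Ege y y0; lra.
Qed.

Lemma cvg_spiral_poly (b x : R) : 0 <= x -> spiral_poly b n x @[n --> \oo] --> spiral b x.
Proof.
move=> x0; apply/subr_cvg0; apply: norm_cvg0.
have h : expR x * (x ^+ n / n`!%:R) @[n --> \oo] --> 0.
  rewrite -[X in _ --> X](mulr0 (expR x)); apply: cvgM; first exact: cvg_cst.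
  exact: cvg_exp_coeff.
apply: (@squeeze_cvgr _ _ _ _ (cst 0) _ _ _ _ _ h); last exact: cvg_cst.
by apply: nearW => n /=; rewrite normr_ge0/= distrC mulrA spiral_remainder.
Qed.

Lemma norm_spiral_poly_le (b x : R) n : 0 <= x -> `|spiral_poly b n x| <= 2 * expR (2 * x).
Proof.
move=> x0; have h1 := spiral_remainder b n x0; have h2 := norm_spiral_le b x0.
have h3 : expR x * x ^+ n / n`!%:R <= expR (2 * x).
  rewrite -mulrA [2 * x]mulr_natl mulr2n expRD ler_pM2l ?expR_gt0//; exact: expn_fact_le_expR.
have h4 : expR x <= expR (2 * x) by rewrite ler_expR; lra.
have h5 : `|spiral_poly b n x| <= `|spiral b x| + `|spiral b x - spiral_poly b n x|.
  rewrite -[X in `|X| <= _](subKr (spiral b x)); exact: ler_normB.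
lra.
Qed.
End sine_series.

Section ml_density_stable.
Context {R : realType} (k : R) (kI : 0 < k < 1).
Local Notation mu := (@lebesgue_measure R).
Local Notation D := (`]0, +oo[%classic : set R).

Lemma integrable_expRN_powR_expn (j : nat) :
  mu.-integrable D (EFin \o (fun r => expR (- r) * (r `^ k) ^+ j)).
Proof.
have [C C0 hC] := expR_lin_powR_bound kI (@ltr01 R) (@ler01 R).
apply: (@dominated_integrable _ (measurableTypeR R) R mu D _ (fun r => (j`!%:R * C) * (oneDsqr r)^-1)) => //.
- by apply: measurable_funTS; me.
- exact: integrable_scale integrable_pos_oneDsqrV.
move=> r; rewrite /= in_itv/= andbT => r0.
rewrite ger0_norm ?mulr_ge0 ?expR_ge0 ?exprn_ge0 ?powR_ge0// -mulrA.
have f0 : (0 : R) < j`!%:R by rewrite ltr0n fact_gt0.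
rewrite mulrC -ler_pdivrMl// mulrA; apply: le_trans (hC r r0).
rewrite !mul1r addrC expRD ler_pM2r ?expR_gt0// mulrC; apply: expn_fact_le_expR.
exact: powR_ge0.
Qed.

Lemma Gamma_mulrn1 (j : nat) :
  Gamma (k * j%:R + 1) = \int[mu]_(r in D) (expR (- r) * (r `^ k) ^+ j).
Proof.
apply: eq_Rintegral => r _; rewrite addrK mulrC; congr (_ * _).
by rewrite -powR_mulrn ?powR_ge0// powRrM.
Qed.

Lemma Rintegral_spiral_poly (a b u : R) (n : nat) :
  mu.-integrable D (EFin \o (fun r => expR (- r) * spiral_poly a b n (u * r `^ k))) /\
  \int[mu]_(r in D) (expR (- r) * spiral_poly a b n (u * r `^ k)) =
  \sum_(0 <= j < n) spiral_coef a b j * u ^+ j * Gamma (k * j%:R + 1).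
Proof.
elim: n => [|n [ih1 ih2]].
  have e : (fun r : R => expR (- r) * spiral_poly a b 0 (u * r `^ k)) = (fun=> 0).
    by apply/funext => r; rewrite /spiral_poly big_geq// mulr0.
  rewrite e big_geq//; split; first exact: integrable0.
  by rewrite Rintegral_cst// mul0r.
pose c := spiral_coef a b n * u ^+ n.
have e : (fun r => expR (- r) * spiral_poly a b n.+1 (u * r `^ k)) =
  (fun r => expR (- r) * spiral_poly a b n (u * r `^ k) + c * (expR (- r) * (r `^ k) ^+ n)).
  by apply/funext => r; rewrite /spiral_poly big_nat_recr//= exprMn /c; ring.
have i2 : mu.-integrable D (EFin \o (fun r => c * (expR (- r) * (r `^ k) ^+ n))).
  by apply: integrable_scale => //; exact: integrable_expRN_powR_expn.
rewrite e; split.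
  exact: integrable_add.
rewrite RintegralD// ih2 big_nat_recr//= RintegralZl//; last exact: integrable_expRN_powR_expn.
by rewrite -Gamma_mulrn1.
Qed.

Lemma stable_density_spiral (u : R) :
  stable_density k u 1 =
  pi^-1 * \int[mu]_(r in D) (expR (- r) * spiral (pi * k) 0 (u * r `^ k)).
Proof.
congr (_ * _); apply: eq_Rintegral => r _.
rewrite /ray_im /ray_mod /ray_arg /spiral cospi sinpi mul1r mulrN1 mulr0 addr0 add0r.
rewrite expRD sinB sinpi cospi mul0r add0r mulN1r opprK mulrA.
by rewrite [k * pi]mulrC.
Qed.

(** On the negative axis at t = 1 the partial sums are dominated by a multiple of exp (- r + 2 u
    r^k), integrable because k < 1. The power of order j integrates to Gamma (k j + 1). *)
Lemma cvg_stable_density (u : R) : 0 < u ->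
  pi^-1 * \sum_(0 <= j < n.+1) spiral_coef (pi * k) 0 j * u ^+ j * Gamma (k * j%:R + 1)
  @[n --> \oo] --> stable_density k u 1.
Proof.
move=> u0; rewrite stable_density_spiral; apply: cvgM; first exact: cvg_cst.
pose a : R := pi * k.
have u20 : 0 <= 2 * u by rewrite mulr_ge0// ltW.
have [C C0 hC] := expR_lin_powR_bound kI (@ltr01 R) u20.
have E n := (Rintegral_spiral_poly a 0 u n).2; rewrite -/a.
under eq_fun do rewrite -E.
have iC : mu.-integrable D (EFin \o (fun r => (2 * C) * (oneDsqr r)^-1)).
  exact: integrable_scale integrable_pos_oneDsqrV.
have [|||//|//|//] := @Rintegral_dominated_cvg _ (measurableTypeR R) R mu D
  (fun n r => expR (- r) * spiral_poly a 0 n.+1 (u * r `^ k))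
  (fun r => expR (- r) * spiral a 0 (u * r `^ k)) _ _ _ _ _ iC _.
- by [].
- by move=> n; apply/measurable_EFinP; exact: measurable_int (Rintegral_spiral_poly a 0 u n.+1).1.
- by apply: measurable_funTS; rewrite /spiral; me.
- move=> n r; rewrite /= in_itv/= andbT => r0.
  have x0 : 0 <= u * r `^ k by rewrite mulr_ge0 ?powR_ge0// ltW.
  rewrite normrM (ger0_norm (expR_ge0 _)) mulrC -mulrA.
  apply: (@le_trans _ _ (2 * expR (2 * (u * r `^ k)) * expR (- r))).
    by rewrite ler_wpM2r ?expR_ge0// norm_spiral_poly_le.
  rewrite -mulrA ler_pM2l// -expRD; apply: le_trans (hC r r0).
  by rewrite ler_expR mul1r addrC mulrA.
- apply: aeW => r; rewrite /= in_itv/= andbT => r0; apply: cvgM; first exact: cvg_cst.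
  have x0 : 0 <= u * r `^ k by rewrite mulr_ge0 ?powR_ge0// ltW.
  by have := @cvg_spiral_poly _ a 0 _ x0; rewrite -cvg_shiftS.
Qed.

Lemma ml_densityE (u : R) : 0 < u -> ml_density k u = (k * u)^-1 * stable_density k u 1.
Proof.
move=> u0; have /andP[k0 k1] := kI.
have h := cvg_stable_density u0.
(* [c] cancels the factor 1/pi of the stable density and lowers u^j to u^(j-1). *)
pose c : R := pi * u^-1.
rewrite /ml_density; transitivity ((pi * k)^-1 * (c * stable_density k u 1)); last first.
  rewrite /c; move: (pi : R) (pi_gt0 R) => p p0.
  by field; rewrite (gt_eqF k0) (gt_eqF u0) (gt_eqF p0).
congr (_ * _).
apply: cvg_lim => //.
have {}h : c * (pi^-1 * \sum_(0 <= j < n.+1) spiral_coef (pi * k) 0 j * u ^+ j * Gamma (k * j%:R + 1))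
    @[n --> \oo] --> c * stable_density k u 1 by apply: cvgM h; exact: cvg_cst.
apply: cvg_trans h; apply: near_eq_cvg; apply: nearW => n /=.
have cp : c / pi = u^-1 by rewrite /c mulrAC mulfV ?mul1r// gt_eqF// pi_gt0.
rewrite mulrA cp big_nat_recl// big_add1/=.
(* The term of index 0 vanishes because its sine does, which matches a sum starting at j = 1. *)
rewrite /spiral_coef mulr0n subrr sin0 mulr0 !mul0r add0r mulr_sumr.
apply: eq_big_nat => j _; rewrite sub0r sinN exprS [_ ^+ j.+1]exprS -[pi * k *+ _]mulr_natr.
have f0 : (j.+1`!%:R : R) != 0 by rewrite pnatr_eq0 -lt0n fact_gt0.
move: (sin _) (Gamma _) => S G.
by move: (j.+1`!%:R) f0 => F f0; field; rewrite f0 (gt_eqF u0).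
Qed.
End ml_density_stable.

Section tonelli_subsets.
Context d1 d2 (T1 : measurableType d1) (T2 : measurableType d2) {R : realType}.
Context (m1 : {sigma_finite_measure set T1 -> \bar R}) (m2 : {sigma_finite_measure set T2 -> \bar R}).
Local Open Scope ereal_scope.

Lemma tonelli_subsets (A : set T1) (B : set T2) (f : T1 -> T2 -> \bar R) :
  measurable A -> measurable B ->
  measurable_fun (A `*` B) (fun z : T1 * T2 => f z.1 z.2) ->
  (forall x y, A x -> B y -> 0 <= f x y) ->
  \int[m1]_(x in A) \int[m2]_(y in B) f x y = \int[m2]_(y in B) \int[m1]_(x in A) f x y.
Proof.
move=> mA mB mf f0; pose F := (fun z : T1 * T2 => f z.1 z.2) \_ (A `*` B).
have FE x y : F (x, y) = if (x \in A) && (y \in B) then f x y else 0.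
  by rewrite /F patchE in_setX.
have F0 z : 0 <= F z.
  case: z => x y; rewrite FE; case: ifPn => // /andP[]; rewrite !inE; exact: f0.
have mF : measurable_fun setT F.
  by apply: (measurable_restrictT _ _).1 => //; exact: measurableX.
have h := @fubini_tonelli _ _ _ _ _ m1 m2 F mF F0.
rewrite integral_mkcond [RHS]integral_mkcond.
transitivity (\int[m1]_x \int[m2]_y F (x, y)).
  apply: eq_integral => x _; rewrite patchE; case: ifPn => xA; last first.
    by rewrite integral0_eq// => y _; rewrite FE (negbTE xA).
  rewrite integral_mkcond; apply: eq_integral => y _; rewrite patchE FE xA /=; by case: ifP.
rewrite h; apply: eq_integral => y _; rewrite patchE; case: ifPn => yB; last first.
  by rewrite integral0_eq// => x _; rewrite FE (negbTE yB) andbF.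
rewrite [RHS]integral_mkcond; apply: eq_integral => x _; rewrite patchE FE yB andbT; by case: ifP.
Qed.
End tonelli_subsets.

Section positive_scaling.
Context {R : realType} (a : R) (a0 : 0 < a).
Local Notation mu := (@lebesgue_measure R).
Local Notation D := (`]0, +oo[%classic : set R).

Lemma restrict_pos_scale (V : pointedType) (f : R -> V) (x : R) :
  (f \_ D) (a * x) = ((fun w => f (a * w)) \_ D) x.
Proof.
rewrite !patchE; have -> : (a * x \in D) = (x \in D) => //.
by apply/idP/idP; rewrite !inE/= !in_itv/= !andbT pmulr_rgt0.
Qed.

Lemma Rintegral_pos_scale (f : R -> R) : mu.-integrable D (EFin \o f) ->
  \int[mu]_(x in D) f x = a * \int[mu]_(x in D) f (a * x).
Proof.
move=> fi; rewrite Rintegral_mkcond [in RHS]Rintegral_mkcond.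
rewrite (@Rintegral_affine _ a 0)//; last exact: (@integrable_patch _ (measurableTypeR R) R mu).
by congr (_ * _); apply: eq_Rintegral => x _; rewrite addr0 restrict_pos_scale.
Qed.

Lemma ge0_integral_pos_scale (f : R -> \bar R) : measurable_fun D f ->
  (forall x, D x -> 0 <= f x)%E ->
  (\int[mu]_(x in D) f x = a%:E * \int[mu]_(x in D) f (a * x)%R)%E.
Proof.
move=> mf f0; rewrite integral_mkcond [in RHS]integral_mkcond.
rewrite (@ge0_integral_affine _ a 0)//.
- by congr (_ * _)%E; apply: eq_integral => x _; rewrite addr0 restrict_pos_scale.
- exact: (measurable_restrictT _ _).1.
- by move=> x; rewrite patchE; case: ifPn => //; rewrite inE; exact: f0.
Qed.
End positive_scaling.

Section ml_density_theory.
Context {R : realType} (k : R) (kI : 0 < k < 1).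
Local Notation mu := (@lebesgue_measure R).
Local Notation D := (`]0, +oo[%classic : set R).

Lemma powR_gt0N (t p : R) : 0 < t -> t `^ p * t `^ (- p) = 1.
Proof. by move=> t0; rewrite powRN mulfV// gt_eqF// powR_gt0. Qed.

Lemma stable_density_scale (v t : R) : 0 < v -> 0 < t ->
  stable_density k v t = t^-1 * stable_density k (v * t `^ (- k)) 1.
Proof.
move=> v0 t0; rewrite /stable_density mulrCA; congr (_ * _).
have t0' : 0 < t^-1 by rewrite invr_gt0.
rewrite (@Rintegral_pos_scale _ _ t0'); last first.
  by apply: integrable_ray_im => //; rewrite cospi oppr_lt0.
apply: (congr1 ( *%R t^-1)).
apply: (@eq_Rintegral _ _ _ mu D (ray_im k (v * t `^ (- k)) 1 ^~ pi)) => r.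
rewrite inE/= in_itv/= andbT => r0.
rewrite /ray_im /ray_mod /ray_arg mulrA mulfV ?gt_eqF// !mul1r.
suff -> : v * (t^-1 * r) `^ k = v * t `^ (- k) * r `^ k by [].
rewrite powRM ?(ltW r0) ?(ltW t0')// mulrA; congr (_ * _ * _).
by rewrite -powR_inv1 ?(ltW t0)// -powRrM mulN1r.
Qed.

Lemma ml_density_kernel (v t : R) : 0 < v -> 0 < t ->
  t `^ (- k) * ml_density k (v * t `^ (- k)) = (k * v)^-1 * (t * stable_density k v t).
Proof.
move=> v0 t0; have /andP[k0 k1] := kI; have p0 : 0 < t `^ (- k) by exact: powR_gt0.
rewrite ml_densityE ?mulr_gt0// [stable_density k v t]stable_density_scale//.
by field; rewrite (gt_eqF k0) (gt_eqF v0) (gt_eqF t0) (gt_eqF p0).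
Qed.

Lemma ml_density_ge0 (u : R) : 0 < u -> 0 <= ml_density k u.
Proof.
move=> u0; have /andP[k0 k1] := kI; rewrite ml_densityE// mulr_ge0 ?stable_density_ge0//.
by rewrite invr_ge0 ltW// mulr_gt0.
Qed.

Lemma measurable_ml_density : measurable_fun D (ml_density k).
Proof.
have /andP[k0 k1] := kI.
(* Continuity of the stable density has been shown in t for fixed v; scaling moves the variable u
   from v to t = u^(-1/k) with v = 1. *)
apply: (@eq_measurable_fun _ _ _ _ _ (fun u => (k * u)^-1 * (u `^ (- k^-1) * stable_density k 1 (u `^ (- k^-1))))).
  move=> u; rewrite inE/= in_itv/= andbT => u0.
  have p0 : 0 < u `^ (- k^-1) by exact: powR_gt0.
  rewrite ml_densityE// (stable_density_scale ltr01 p0); congr (_ * _).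
  rewrite mulrA mulfV ?gt_eqF// mul1r.
  by rewrite -powRrM mulrNN mulVf ?gt_eqF// powRr1 ?mul1r// ltW.
apply: measurable_pos_continuous => u u0.
have ku0 : 0 < k * u by rewrite mulr_gt0.
have p0 : 0 < u `^ (- k^-1) by exact: powR_gt0.
apply: cont_atP; apply: ct_mul; first by apply: ct_inv; [rewrite gt_eqF|repeat ct1].
have cp : cont_at (fun u => u `^ (- k^-1)) u by repeat ct1.
apply: ct_mul => //; split.
apply: (@continuous_comp _ _ _ (fun u => u `^ (- k^-1)) (stable_density k 1)); first exact: cont_atP.
exact: continuous_stable_density.
Qed.

Lemma laplace_ml_kernel (v s : R) : 0 < v -> 0 < s ->
  (\int[mu]_(t in D) (expR (- (s * t)) * (t `^ (- k) * ml_density k (v * t `^ (- k))))%:E =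
   (s `^ (k - 1) * expR (- (v * s `^ k)))%:E)%E.
Proof.
move=> v0 s0; have /andP[k0 k1] := kI.
have [i e] := laplace_mul_stable_density kI v0 s0.
transitivity (\int[mu]_(t in D) ((k * v)^-1 * (t * (expR (- (s * t)) * stable_density k v t)))%:E)%E.
  apply: eq_integral => t; rewrite inE/= in_itv/= andbT => t0.
  by rewrite ml_density_kernel//; congr EFin; ring.
have ii : mu.-integrable D (EFin \o (fun t => (k * v)^-1 * (t * (expR (- (s * t)) * stable_density k v t)))).
  exact: integrable_scale.
rewrite -[LHS]fineK; last exact: integrable_fin_num ii.
congr EFin; rewrite -[LHS]/(Rintegral _ _ _) RintegralZl// e.
by field; rewrite (gt_eqF k0) (gt_eqF v0).
Qed.
End ml_density_theory.

Section ml_mixture.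
Context {R : realType} (k : R) (kI : 0 < k < 1).
Local Notation mu := (@lebesgue_measure R).
Local Notation D := (`]0, +oo[%classic : set R).

(* The substitution [u = v / t^k] turns the mixture over [U] into a mixture over
   the kernel [laplace_ml_kernel], whose Laplace transform in [t] is explicit. *)
Lemma ml_density_mixture (p : R -> R) (s : R) : 0 < s ->
  measurable_fun setT p -> (forall x, 0 <= p x) ->
  (\int[mu]_(t in D) \int[mu]_(u in D) (expR (- (s * t)) * (ml_density k u * p (t `^ k * u)))%:E =
   \int[mu]_(v in D) (p v * (s `^ (k - 1) * expR (- (v * s `^ k))))%:E)%E.
Proof.
move=> s0 mp p0; have mD : measurable (D : set (measurableTypeR R)) by [].
have mf := measurable_ml_density kI.
have L := fun v v0 => @laplace_ml_kernel _ _ kI v s v0 s0.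
have f0 := ml_density_ge0 kI; move: (ml_density k) mf f0 L => f mf f0 L.
have mul_c (c : R) : measurable_fun setT (fun x : R => c * x) by me.
have mpc (c : R) : measurable_fun setT (fun x : R => p (c * x)) by exact: measurableT_comp mp (mul_c c).
pose h (t v : R) := p v * (expR (- (s * t)) * (t `^ (- k) * f (v * t `^ (- k)))).
transitivity (\int[mu]_(t in D) \int[mu]_(v in D) (h t v)%:E)%E.
  apply: eq_integral => t; rewrite inE/= in_itv/= andbT => t0.
  have a0 : 0 < t `^ (- k) by exact: powR_gt0.
  rewrite (ge0_integral_pos_scale a0).
  - rewrite -ge0_integralZl_EFin ?(ltW a0)//; first last.
    + apply/measurable_EFinP.
      apply: (@measurable_comp _ _ _ _ _ _ D (fun u => expR (- (s * t)) * (f u * p (t `^ k * u)))).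
      * exact: mD.
      * by move=> _ [x]/= + <-; rewrite /= !in_itv/= !andbT; exact: mulr_gt0.
      * apply: measurable_funM; first exact: measurable_cst.
        apply: measurable_funM => //; apply: measurable_funTS.
        exact: mpc.
      * exact: measurable_funTS (mul_c _).
    + move=> v; rewrite /= in_itv/= andbT => v0; rewrite lee_fin !mulr_ge0 ?expR_ge0//.
      by rewrite f0// mulr_gt0.
    apply: eq_integral => v _; rewrite -EFinM /h; congr EFin.
    by rewrite [t `^ k * _]mulrA powR_gt0N// mul1r [v * _]mulrC; ring.
  - apply/measurable_EFinP; apply: measurable_funM; first exact: measurable_cst.
    apply: measurable_funM => //; apply: measurable_funTS.
    exact: mpc.
  - move=> u; rewrite /= in_itv/= andbT => u0; rewrite lee_fin !mulr_ge0 ?expR_ge0//.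
    exact: f0.
rewrite (@tonelli_subsets _ _ (measurableTypeR R) (measurableTypeR R) R mu mu D D (fun t v => (h t v)%:E))//.
- apply: eq_integral => v; rewrite inE/= in_itv/= andbT => v0.
  transitivity ((p v)%:E * \int[mu]_(t in D) (expR (- (s * t)) * (t `^ (- k) * f (v * t `^ (- k))))%:E)%E.
    rewrite -ge0_integralZl_EFin//.
    + move=> t; rewrite /= in_itv/= andbT => t0; rewrite lee_fin !mulr_ge0 ?expR_ge0 ?powR_ge0//.
      by rewrite f0// mulr_gt0// powR_gt0.
    + apply/measurable_EFinP; apply: measurable_funM; first by apply: measurable_funTS; me.
      apply: measurable_funM; first by apply: measurable_funTS; me.
      apply: (@measurable_comp _ _ _ _ _ _ D (f)) => //.
      * by move=> _ [x]/= + <-; rewrite /= !in_itv/= !andbT => x0; rewrite mulr_gt0// powR_gt0.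
      * by apply: measurable_funTS; me.
  by rewrite L// -EFinM.
- apply/measurable_EFinP.
  (* The density is known to be measurable only on [D]; its extension by 0 can be composed with maps
     of the whole plane. *)
  pose f' := f \_ D.
  have mf' : measurable_fun setT f' by apply: (measurable_restrictT _ _).1.
  pose g (z : measurableTypeR R * measurableTypeR R) := p z.2 * (expR (- (s * z.1)) * (z.1 `^ (- k) * f' (z.2 * z.1 `^ (- k)))).
  apply: (@eq_measurable_fun _ _ _ _ _ g).
    move=> [t v]; rewrite inE/= !in_itv/= !andbT => -[t0 v0]; rewrite /g /h /f' patchE.
    by rewrite ifT// inE/= in_itv/= andbT mulr_gt0// powR_gt0.
  apply: measurable_funTS; rewrite /g; apply: meas_funP.
  apply: me_mul; first by apply: me_comp => //; exact: me_snd.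
  apply: me_mul; first by apply: me_exp; apply: me_opp; apply: me_mul; [exact: me_cst|exact: me_fst].
  apply: me_mul; first by apply: me_pow; exact: me_fst.
  apply: me_comp => //; apply: me_mul; [exact: me_snd|]; apply: me_pow; exact: me_fst.
- move=> t v; rewrite /= !in_itv/= !andbT => t0 v0.
  rewrite lee_fin !mulr_ge0 ?expR_ge0 ?powR_ge0//.
  by rewrite f0// mulr_gt0// powR_gt0.
Qed.
End ml_mixture.

(** * Poisson mixtures over a Mittag-Leffler law *)

Section density.
Context {R : realType}.
Local Notation mu := (@lebesgue_measure R).
Local Notation D := (`]0, +oo[%classic : set R).
Local Open Scope ereal_scope.

(** [L] is given by its values on sets only. It is absolutely continuous, and its Radon-Nikodym
    derivative agrees almost everywhere with [f] extended by 0, since both have the same integral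
    over every measurable set. *)
Lemma ge0_integral_density (L : probability (measurableTypeR R) R) (f : R -> R) :
  measurable_fun D f -> (forall u, (0 < u)%R -> (0 <= f u)%R) ->
  (forall A : set R, measurable A -> L A = \int[mu]_(u in A `&` D) (f u)%:E) ->
  forall phi : R -> \bar R, measurable_fun setT phi -> (forall u, 0 <= phi u) ->
  \int[L]_u phi u = \int[mu]_(u in D) ((f u)%:E * phi u).
Proof.
move=> mf f0 LE phi mphi phi0.
have mD : measurable (D : set (measurableTypeR R)) by [].
pose g : R -> \bar R := (EFin \o f) \_ D.
have mg : measurable_fun setT g.
  by apply: (measurable_restrictT _ _).1 => //; exact/measurable_EFinP.
have gE A : measurable A -> L A = \int[mu]_(u in A) g u.
  by move=> mA; rewrite LE// /g integral_mkcondr.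
have Lmu : L `<< mu.
  apply/null_content_dominatesP => A mA A0; rewrite gE//.
  by apply: null_set_integral => //; exact: measurable_funTS.
pose RN := Radon_Nikodym_SigmaFinite.f L mu.
have iRN : mu.-integrable setT RN by exact: Radon_Nikodym_SigmaFinite.f_integrable.
have h := @Radon_Nikodym_SigmaFinite.change_of_variables _ (measurableTypeR R) R L mu Lmu phi setT phi0 measurableT mphi.
transitivity (\int[mu]_u (phi u * g u)).
  rewrite -h; apply: ae_eq_integral => //.
  - by apply: emeasurable_funM => //; exact: measurable_int iRN.
  - exact: emeasurable_funM.
  - apply: ae_eqe_mul2l; apply: integral_ae_eq => // A _ mA.
    by rewrite -gE// -Radon_Nikodym_SigmaFinite.f_integral.
rewrite [RHS]integral_mkcond; apply: eq_integral => u _.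
by rewrite /g !patchE; case: ifPn => _; rewrite ?mule0// muleC.
Qed.
End density.

Section gamma_integrals.
Context {R : realType} (a : R) (a0 : 0 < a).
Local Notation mu := (@lebesgue_measure R).
Local Notation D := (`]0, +oo[%classic : set R).
Local Notation q n := (fun v : R => v ^+ n / n`!%:R * expR (- (a * v))).

Lemma expn_expRN_le (n : nat) (v : R) : 0 <= v ->
  q n v <= (2 / a) ^+ n * expR (- (a / 2 * v)).
Proof.
move=> v0; have a2 : 0 < a / 2 by rewrite divr_gt0.
have -> : expR (- (a * v)) = expR (- (a / 2 * v)) * expR (- (a / 2 * v)).
  by rewrite -expRD; congr expR; field.
rewrite mulrA ler_pM2r ?expR_gt0// expRN ler_pdivrMr ?expR_gt0//.
have -> : v ^+ n / n`!%:R = (2 / a) ^+ n * ((a / 2 * v) ^+ n / n`!%:R).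
  rewrite mulrA -exprMn; congr (_ ^+ _ / _).
  by field; rewrite gt_eqF.
rewrite ler_pM2l ?exprn_gt0 ?divr_gt0//; apply: expn_fact_le_expR.
by rewrite mulr_ge0// ltW.
Qed.

Lemma expn_expRN_ge0 (n : nat) (v : R) : 0 <= v -> 0 <= q n v.
Proof. by move=> v0; rewrite mulr_ge0 ?expR_ge0// divr_ge0// exprn_ge0. Qed.

Let measurable_q (n : nat) : measurable_fun setT (q n).
Proof. by me. Qed.

Lemma integrable_expn_expRN (n : nat) : mu.-integrable D (EFin \o q n).
Proof.
have i : mu.-integrable D (EFin \o (fun v => (2 / a) ^+ n * expR (- (a / 2 * v)))).
  by apply: integrable_scale => //; apply: integrable_expRN; rewrite divr_gt0.
apply: (@dominated_integrable _ (measurableTypeR R) R mu D _ _ _ _ i) => //.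
  exact: measurable_funTS (measurable_q n).
move=> v; rewrite /= in_itv/= andbT => v0.
by rewrite ger0_norm ?expn_expRN_ge0 ?expn_expRN_le// ltW.
Qed.

Let cvg_q (n : nat) : q n m.+2%:R @[m --> \oo] --> 0.
Proof.
have a2 : 0 < a / 2 by rewrite divr_gt0.
have h : (2 / a) ^+ n * expR (- (a / 2 * m.+2%:R)) @[m --> \oo] --> 0.
  rewrite -[X in _ --> X](mulr0 ((2 / a) ^+ n)); apply: cvgM; first exact: cvg_cst.
  exact: cvg_expRN_mulrn.
apply: (@squeeze_cvgr _ _ _ _ (fun=> 0) _ _ _ _ _ h); last exact: cvg_cst.
by apply: nearW => m; rewrite expn_expRN_ge0//= expn_expRN_le.
Qed.

Let q_antiderivative (n : nat) (v : R) : is_derive v 1 (fun v => - a^-1 * q n.+1 v) (q n.+1 v - a^-1 * q n v).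
Proof.
have f0 : (n`!%:R : R) != 0 by rewrite pnatr_eq0 -lt0n fact_gt0.
have n0 : (n.+1%:R : R) != 0 by rewrite pnatr_eq0.
der; rewrite /= factS natrM.
move: (expR _) => X.
move: (n.+1%:R : R) (n`!%:R : R) n0 f0 => N F N0 F0.
by field; rewrite N0 F0 gt_eqF.
Qed.

Lemma integral_expn_expRN (n : nat) : \int[mu]_(v in D) q n v = (a ^+ n.+1)^-1.
Proof.
elim: n => [|n ih].
  transitivity (0 - - a^-1); last by rewrite expr1 sub0r opprK.
  refine (@FTC2_0y R (q 0) (fun v => - a^-1 * q 0 v) (- a^-1) 0 _ _ _ _ _).
  - exact: integrable_expn_expRN.
  - move=> v _; der; rewrite /= fact0; move: (expR _) => X; field; by rewrite gt_eqF.
  - by move=> v _; ct.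
  - rewrite [X in _ --> X](_ : _ = - a^-1 * q 0 0); last by rewrite expr0 fact0 divr1 mulr0 oppr0 expR0 !mulr1.
    by apply: (@cvg_comp_harmonic _ (fun v => - a^-1 * q 0 v)); ct.
  - rewrite -[X in _ --> X](mulr0 (- a^-1)); apply: cvgM; [exact: cvg_cst|exact: cvg_q].
have i1 := integrable_expn_expRN n.+1.
have i2 : mu.-integrable D (EFin \o (fun v => a^-1 * q n v)).
  by apply: integrable_scale => //; exact: integrable_expn_expRN.
have : \int[mu]_(v in D) (q n.+1 v - a^-1 * q n v) = 0 - 0.
  refine (@FTC2_0y R (fun v => q n.+1 v - a^-1 * q n v) (fun v => - a^-1 * q n.+1 v) 0 0 _ _ _ _ _).
  - exact: integrable_sub.
  - by move=> v _; exact: q_antiderivative.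
  - by move=> v _; ct.
  - rewrite [X in _ --> X](_ : _ = - a^-1 * q n.+1 0); last by rewrite expr0n/= !mul0r mulr0.
    by apply: (@cvg_comp_harmonic _ (fun v => - a^-1 * q n.+1 v)); ct.
  - rewrite -[X in _ --> X](mulr0 (- a^-1)); apply: cvgM; [exact: cvg_cst|exact: cvg_q].
rewrite subr0 RintegralB// RintegralZl//; last exact: integrable_expn_expRN.
by move=> /subr0_eq ->; rewrite ih [in RHS]exprS invfM.
Qed.

Lemma ge0_integral_expn_expRN (n : nat) :
  (\int[mu]_(v in D) (q n v)%:E = ((a ^+ n.+1)^-1)%:E)%E.
Proof.
rewrite -integral_expn_expRN /Rintegral fineK//.
exact: integrable_fin_num (integrable_expn_expRN n).
Qed.
End gamma_integrals.

Section poisson_laplace.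
Context {R : realType}.
Local Notation mu := (@lebesgue_measure R).
Local Notation D := (`]0, +oo[%classic : set R).

Lemma poisson_pmf_le1 (x : R) (n : nat) : poisson_pmf x n <= 1.
Proof.
rewrite /poisson_pmf; case: ifPn => // x0.
by rewrite expRN ler_pdivrMr ?expR_gt0// mul1r; apply: expn_fact_le_expR; exact: ltW.
Qed.

Lemma measurable_poisson_pmfM (c : R) (n : nat) :
  measurable_fun setT (fun u : R => poisson_pmf (c * u) n).
Proof. by apply: (measurableT_comp (@measurable_poisson_pmf R setT n measurableT)); me. Qed.

Lemma integral_poisson_pmf (nu s b : R) (n : nat) : 0 < nu -> 0 < s -> 0 <= b ->
  (\int[mu]_(v in D) (poisson_pmf (nu * v) n * (b * expR (- (v * s))))%:E =
   (b * nu ^+ n / (nu + s) ^+ n.+1)%:E)%E.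
Proof.
move=> nu0 s0 b0; have a0 : 0 < nu + s by rewrite addr_gt0.
transitivity (\int[mu]_(v in D) ((b * nu ^+ n)%:E * (v ^+ n / n`!%:R * expR (- ((nu + s) * v)))%:E))%E.
  apply: eq_integral => v; rewrite inE/= in_itv/= andbT => v0.
  rewrite -EFinM; congr EFin; rewrite /poisson_pmf mulr_gt0// exprMn.
  have -> : - ((nu + s) * v) = - (nu * v) + - (v * s) by ring.
  rewrite expRD; ring.
rewrite ge0_integralZl_EFin//.
- by rewrite ge0_integral_expn_expRN.
- by move=> v; rewrite /= in_itv/= andbT => v0; rewrite lee_fin expn_expRN_ge0// ltW.
- by apply/measurable_EFinP; apply: measurable_funTS; me.
- by rewrite mulr_ge0// exprn_ge0// ltW.
Qed.
End poisson_laplace.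

Section ml_law.
Context {R : realType} (k : R) (k0 : 0 < k) (k1 : k <= 1).
Local Notation mu := (@lebesgue_measure R).
Local Notation D := (`]0, +oo[%classic : set R).

(** In [ml_density_mixture] with p = 1 and s = 1, the left side factors into the integral of e^(-t),
    which is 1, and the total mass, while the right side is 1. *)
Lemma integral_ml_density : k < 1 -> (\int[mu]_(u in D) (ml_density k u)%:E = 1)%E.
Proof.
move=> k1'; have kI : 0 < k < 1 by rewrite k0.
have mf := measurable_ml_density kI; have f0 := ml_density_ge0 kI.
have e1 : (\int[mu]_(v in D) (expR (- v))%:E = 1)%E.
  rewrite (_ : 1%E = ((1 ^+ 1)^-1 : R)%:E); last by rewrite expr1 invr1.
  rewrite -(@ge0_integral_expn_expRN _ 1 ltr01 0); apply: eq_integral => v _.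
  by rewrite expr0 fact0 divr1 !mul1r.
have := @ml_density_mixture _ k kI (fun=> 1) 1 ltr01 (measurable_cst _) (fun _ => ler01).
have -> : (\int[mu]_(v in D) (1 * (1 `^ (k - 1) * expR (- (v * 1 `^ k))))%:E = 1)%E.
  by rewrite -[RHS]e1; apply: eq_integral => v _; rewrite !powR1 mulr1 !mul1r.
move=> <-.
have mE : measurable_fun D (fun v : R => (expR (- v))%:E).
  by apply/measurable_EFinP; apply: measurable_funTS; me.
have mfE : measurable_fun D (fun u => (ml_density k u)%:E) by exact/measurable_EFinP.
have f0' u : D u -> (0 <= (ml_density k u)%:E)%E.
  by rewrite /= in_itv/= andbT lee_fin; exact: f0.
transitivity (\int[mu]_(t in D) ((expR (- t))%:E * \int[mu]_(u in D) (ml_density k u)%:E))%E.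
  rewrite ge0_integralZr// ?e1 ?mul1e//; exact: integral_ge0.
apply: eq_integral => t _; rewrite -ge0_integralZl_EFin ?expR_ge0//.
by apply: eq_integral => u _; rewrite -EFinM mulr1 mul1r.
Qed.

(** The condition [is_ML] for a law instead of a random variable: the comparison involves U only
    through its law, and the construction produces the law before any variable. *)
Definition is_ML_law (L : probability (measurableTypeR R) R) : Prop :=
  forall A : set R, measurable A ->
    L A = if k < 1 then (\int[mu]_(u in A `&` D) (ml_density k u)%:E)%E else \d_(1 : R) A.

Context (L : probability (measurableTypeR R) R) (LE : is_ML_law L).

Lemma ml_law_pos : L D = 1%E.
Proof.
rewrite LE//; case: ifPn => [k1'|_]; first by rewrite setIid integral_ml_density.
by rewrite diracE mem_set//= in_itv/= ltr01.
Qed.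

Lemma ml_law_mixture (p : R -> R) (s : R) : 0 < s ->
  measurable_fun setT p -> (forall x, 0 <= p x) ->
  (\int[mu]_(t in D) \int[L]_u (expR (- (s * t)) * p (t `^ k * u))%:E =
   \int[mu]_(v in D) (p v * (s `^ (k - 1) * expR (- (v * s `^ k))))%:E)%E.
Proof.
move=> s0 mp p0.
have mpt (t : R) : measurable_fun setT (fun u : measurableTypeR R => (expR (- (s * t)) * p (t `^ k * u))%:E).
  apply/measurable_EFinP; apply: measurable_funM; first exact: measurable_cst.
  apply: (measurableT_comp mp); by me.
have [k1'|k1'] := ltP k 1.
  have kI : 0 < k < 1 by rewrite k0.
  rewrite -ml_density_mixture//; apply: eq_integral => t _.
  rewrite (@ge0_integral_density _ L (ml_density k)).
  - by apply: eq_integral => u _; rewrite -EFinM; congr EFin; ring.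
  - exact: measurable_ml_density.
  - by move=> u; exact: ml_density_ge0.
  - by move=> A mA; rewrite LE// k1'.
  - exact: mpt.
  - by move=> u; rewrite lee_fin mulr_ge0 ?expR_ge0.
(* With U = 1 and s^(k-1) = 1 both sides are the integral of p(t) e^(-s t); this makes the formula
   hold for k < 1 and k = 1 alike. *)
have {}k1' : k = 1 by apply/eqP; rewrite eq_le k1 k1'.
apply: eq_integral => t; rewrite inE/= in_itv/= andbT => t0.
transitivity (\int[\d_(1%R : measurableTypeR R)]_u (expR (- (s * t)) * p (t `^ k * u))%:E)%E.
  apply: eq_measure_integral => A mA _; have := LE mA; rewrite k1' ltxx; exact.
rewrite integral_dirac// diracT mul1e; congr (_%:E).
rewrite k1' subrr powRr0 !powRr1 ?ltW// mulr1 mul1r [s * t]mulrC; ring.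
Qed.
End ml_law.

Section mixed_poisson.
Context {R : realType} (k : R) (k0 : 0 < k) (k1 : k <= 1).
Context (L : probability (measurableTypeR R) R) (LE : is_ML_law k L) (nu : R) (nu0 : 0 < nu).
Local Notation mu := (@lebesgue_measure R).
Local Notation D := (`]0, +oo[%classic : set R).

Definition mixed_pmf (n : nat) (t : R) : R :=
  \int[L]_u poisson_pmf (nu * (t `^ k * u)) n.

Lemma measurable_mixed_pmf (n : nat) (t : R) :
  measurable_fun setT (fun u : measurableTypeR R => poisson_pmf (nu * (t `^ k * u)) n).
Proof.
apply: (measurableT_comp (@measurable_poisson_pmf R setT n measurableT)).
by me.
Qed.

Lemma integrable_mixed_pmf (n : nat) (t : R) :
  L.-integrable setT (EFin \o (fun u : measurableTypeR R => poisson_pmf (nu * (t `^ k * u)) n)).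
Proof.
apply: (@dominated_integrable _ (measurableTypeR R) R L setT _ (fun=> 1)) => //.
- exact: measurable_mixed_pmf.
- by apply: finite_measure_integrable_cst.
- by move=> u _; rewrite ger0_norm ?poisson_pmf_ge0// poisson_pmf_le1.
Qed.

Lemma mixed_pmf_ge0 n t : 0 <= mixed_pmf n t.
Proof. by apply: Rintegral_ge0 => u _; exact: poisson_pmf_ge0. Qed.

Lemma mixed_pmf_le1 n t : mixed_pmf n t <= 1.
Proof.
have -> : (1 : R) = \int[L]_u (1 : R).
  rewrite Rintegral_cst// mul1r; exact/esym/(congr1 fine (probability_setT L)).
apply: le_Rintegral => //; first exact: integrable_mixed_pmf.
  by apply: finite_measure_integrable_cst.
by move=> u _; exact: poisson_pmf_le1.
Qed.

Lemma continuous_mixed_pmf (n : nat) (t : R) : 0 < t -> {for t, continuous (mixed_pmf n)}.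
Proof.
move=> t0.
have i1 : L.-integrable setT (EFin \o (fun=> 1)) by exact: finite_measure_integrable_cst.
have I0 x : x \in (`]t / 2, 2 * t[%classic : set R) -> 0 < x.
  by rewrite inE/= in_itv/= => /andP[h _]; lra.
have h := @continuity_under_integral R _ (measurableTypeR R) L
  (fun t u => poisson_pmf (nu * (t `^ k * u)) n) setT measurableT (t / 2) (2 * t) _ _ (fun=> 1) i1 _.
apply: h => //.
- by move=> x _; exact: integrable_mixed_pmf.
- apply: aeW => u _ x /I0 x0; have [u0|u0] := leP u 0.
    (* For u <= 0 the rate is nonpositive at every time, and [poisson_pmf] has the constant default
       value 1 there. *)
    rewrite (_ : (fun _ => _) = cst 1); first exact: cst_continuous.
    apply/funext => y; rewrite /poisson_pmf ifF//; apply/negbTE; rewrite -leNgt.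
    by rewrite pmulr_rle0// mulr_ge0_le0// powR_ge0.
  pose g (y : R) := (nu * (y `^ k * u)) ^+ n / n`!%:R * expR (- (nu * (y `^ k * u))).
  have gE y : 0 < y -> poisson_pmf (nu * (y `^ k * u)) n = g y.
    by move=> y0; rewrite /poisson_pmf ifT// !mulr_gt0// powR_gt0.
  rewrite /continuous_at gE//.
  have cg : {for x, continuous g} by rewrite /g; ct.
  apply: cvg_trans cg; apply: near_eq_cvg; near=> y; apply/esym/gE.
  by near: y; exact: lt_nbhsr.
- move=> x _; apply: aeW => u _; rewrite ger0_norm ?poisson_pmf_ge0//.
  exact: poisson_pmf_le1.
- by rewrite inE/= in_itv/=; apply/andP; split; lra.
Unshelve. all: end_near. Qed.

Lemma measurable_mixed_pmf_time (n : nat) : measurable_fun D (mixed_pmf n).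
Proof. by apply: measurable_pos_continuous => t; exact: continuous_mixed_pmf. Qed.

Lemma laplace_mixed_pmf (n : nat) (s : R) : 0 < s ->
  \int[mu]_(t in D) (expR (- (s * t)) * mixed_pmf n t) =
  s `^ (k - 1) * nu ^+ n / (nu + s `^ k) ^+ n.+1.
Proof.
move=> s0; have sk : 0 < s `^ k by exact: powR_gt0.
have := ml_law_mixture k0 k1 LE s0 (measurable_poisson_pmfM nu n) (fun v => poisson_pmf_ge0 _ _).
rewrite integral_poisson_pmf ?powR_ge0// => h.
rewrite /Rintegral; transitivity (fine (s `^ (k - 1) * nu ^+ n / (nu + s `^ k) ^+ n.+1)%:E) => //.
rewrite -h; congr fine; apply: eq_integral => t _.
have fi := integrable_fin_num measurableT (integrable_mixed_pmf n t).
rewrite /mixed_pmf /Rintegral EFinM fineK// -ge0_integralZl_EFin ?expR_ge0//.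
- by move=> u _; rewrite lee_fin poisson_pmf_ge0.
- by apply/measurable_EFinP; exact: measurable_mixed_pmf.
Qed.
End mixed_poisson.

(** * The Laplace transform of the waiting times *)

Section gamma_bounds.
Context {R : realType}.
Local Notation mu := (@lebesgue_measure R).
Local Notation D := (`]0, +oo[%classic : set R).

Lemma integrable_expRN_powR (s p : R) : 0 < s -> 0 <= p ->
  mu.-integrable D (EFin \o (fun t => expR (- (s * t)) * t `^ p)).
Proof.
move=> s0 p0; pose n := (Num.truncn p).+1.
have pn : p <= n%:R by rewrite ltW// truncnS_gt.
have f0 m : (m`!%:R : R) != 0 by rewrite pnatr_eq0 -lt0n fact_gt0.
have i m : mu.-integrable D (EFin \o (fun v => expR (- (s * v)) * v ^+ m)).
  have j : mu.-integrable D (EFin \o (fun v => m`!%:R * (v ^+ m / m`!%:R * expR (- (s * v))))).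
    by apply: integrable_scale => //; exact: integrable_expn_expRN.
  apply: eq_integrable j => // v _ /=; congr EFin.
  by rewrite mulrA mulrCA mulfV// mulr1 mulrC.
have mD : measurable (D : set (measurableTypeR R)) by [].
have i2 := integrable_add mD (i 0%N) (i n).
have mm : measurable_fun setT (fun t : R => expR (- (s * t)) * t `^ p) by me.
apply: (@dominated_integrable _ (measurableTypeR R) R mu D _ _ _ _ i2) => //.
  exact: measurable_funTS mm.
move=> x; rewrite /= in_itv/= andbT => x0.
rewrite ger0_norm ?mulr_ge0 ?powR_ge0 ?expR_ge0// -mulrDr.
rewrite ler_wpM2l ?expR_ge0// expr0.
have [x1|x1] := leP x 1.
  apply: (@le_trans _ _ 1); last by rewrite lerDl exprn_ge0// ltW.
  have -> : (1 : R) = 1 `^ p by rewrite powR1.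
  apply: ge0_ler_powR => //; rewrite nnegrE//; exact: ltW.
apply: (@le_trans _ _ (x ^+ n)); last by rewrite lerDr.
by rewrite -powR_mulrn ?(ltW x0)// ler_powR// ltW.
Qed.

Lemma GammaE (p : R) : Gamma (p + 1) = \int[mu]_(x in D) (expR (- (1 * x)) * x `^ p).
Proof. by apply: eq_Rintegral => x _; rewrite addrK mul1r mulrC. Qed.

(** Only the interval [A, A + 1] of Euler's integral is kept. The free parameter A makes this crude
    bound do the work of Stirling's formula in estimating the Mittag-Leffler series. *)
Lemma Gamma_ge (A p : R) : 0 < A -> 0 <= p -> A `^ p * expR (- (A + 1)) <= Gamma (p + 1).
Proof.
move=> A0 p0; rewrite GammaE.
have AA : A <= A + 1 by rewrite lerDl.
have <- : \int[mu]_(t in D) (A `^ p * expR (- (A + 1)) * \1_(`[A, A + 1]%classic) t) = A `^ p * expR (- (A + 1)).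
  rewrite RintegralZl//.
    by rewrite Rintegral_pos_indic_itv// addrAC subrr add0r mulr1.
  apply: (@integrableS _ (measurableTypeR R) R mu setT) => //.
  exact: integrable_indic_itv.
apply: le_Rintegral => //.
- apply: integrable_scale => //.
  apply: (@integrableS _ (measurableTypeR R) R mu setT) => //.
  exact: integrable_indic_itv.
- exact: integrable_expRN_powR.
move=> x; rewrite /= in_itv/= andbT => x0; rewrite indicE.
have [xI|_] := boolP (x \in _); last first.
  by rewrite mulr0 mulr_ge0 ?powR_ge0 ?expR_ge0.
have /andP[h1 h2] : A <= x <= A + 1 by move: xI; rewrite in_setE /= in_itv.
rewrite mulr1 mul1r [leRHS]mulrC; apply: ler_pM; rewrite ?powR_ge0 ?expR_ge0//.
  by apply: ge0_ler_powR => //; rewrite nnegrE// ltW.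
by rewrite ler_expR lerN2.
Qed.

Lemma Gamma_gt0 (p : R) : 0 <= p -> 0 < Gamma (p + 1).
Proof.
move=> p0; apply: lt_le_trans (Gamma_ge ltr01 p0).
by rewrite powR1 mul1r expR_gt0.
Qed.

Lemma laplace_powR (s p : R) : 0 < s -> 0 <= p ->
  \int[mu]_(t in D) (expR (- (s * t)) * t `^ p) = Gamma (p + 1) / s `^ (p + 1).
Proof.
move=> s0 p0; have sp : 0 < s `^ p by exact: powR_gt0.
have i := integrable_expRN_powR s0 p0.
have -> : Gamma (p + 1) = s * (s `^ p * \int[mu]_(t in D) (expR (- (s * t)) * t `^ p)).
  rewrite GammaE (Rintegral_pos_scale s0); last exact: integrable_expRN_powR.
  congr (_ * _); rewrite -RintegralZl//.
  apply: eq_Rintegral => t; rewrite inE/= in_itv/= andbT => t0.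
  by rewrite mul1r powRM ?(ltW s0) ?(ltW t0)//; ring.
by rewrite -mulr_powR//; field; rewrite (gt_eqF s0) (gt_eqF sp).
Qed.
End gamma_bounds.

(** * Termwise transform of the Mittag-Leffler function *)

Section mittag_leffler_laplace.
Context {R : realType} (k : R) (k0 : 0 < k) (nu : R) (nu0 : 0 < nu).
Local Notation mu := (@lebesgue_measure R).
Local Notation D := (`]0, +oo[%classic : set R).

(** Defined by a^k = 2 nu, where the 2 produces the geometric ratio 1/2. The series is then bounded
    by a multiple of e^(a t), so [a] is the abscissa beyond which it is integrated term by term. *)
Let a : R := (2 * nu) `^ k^-1.
Let term (t : R) (m : nat) : R := (- nu * t `^ k) ^+ m / Gamma (k * m%:R + 1).

Let a0 : 0 < a.
Proof. by rewrite powR_gt0// mulr_gt0. Qed.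

Let km0 (m : nat) : 0 <= k * m%:R.
Proof. by rewrite mulr_ge0// ltW. Qed.

Let powRkm (t : R) (m : nat) : t `^ (k * m%:R) = (t `^ k) ^+ m.
Proof. by rewrite powRrM powR_mulrn// powR_ge0. Qed.

(* Gamma_ge with [A = a t] beats the power [(nu t^k)^m] by the factor [2^m]. *)
Let norm_term_le (t : R) (m : nat) : 0 < t -> `|term t m| <= expR (a * t + 1) * 2^-1 ^+ m.
Proof.
move=> t0; have at0 : 0 < a * t by rewrite mulr_gt0.
have x0 : 0 < nu * t `^ k by rewrite mulr_gt0// powR_gt0.
have ak : (a * t) `^ k = 2 * (nu * t `^ k).
  by rewrite powRM ?(ltW a0) ?(ltW t0)// /a -powRrM mulVf ?gt_eqF// powRr1 ?mulrA// mulr_ge0// ltW.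
have G0 := Gamma_gt0 (km0 m); have := Gamma_ge at0 (km0 m).
rewrite powRkm ak exprMn => h.
rewrite /term mulNr normrM normrX normrN (gtr0_norm x0) gtr0_norm ?invr_gt0//.
have c0 : 0 <= expR (a * t + 1) * 2^-1 ^+ m by rewrite mulr_ge0 ?expR_ge0// exprn_ge0.
rewrite ler_pdivrMr//; apply: le_trans (ler_wpM2l c0 h).
rewrite le_eqVlt; apply/orP; left; apply/eqP.
have E0 := expR_gt0 (a * t + 1); have p0 : (2 : R) ^+ m != 0 by rewrite expf_neq0.
by rewrite expRN exprVn; field; rewrite p0 (gt_eqF E0).
Qed.

Let sum_half_le (n : nat) : \sum_(0 <= m < n) 2^-1 ^+ m <= 2 :> R.
Proof.
suff -> : \sum_(0 <= m < n) 2^-1 ^+ m = 2 - 2 * 2^-1 ^+ n :> R by rewrite gerBl mulr_ge0// exprn_ge0.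
elim: n => [|n ih]; first by rewrite big_geq// expr0; lra.
by rewrite big_nat_recr//= ih exprS; field.
Qed.

Let norm_series_le (t : R) (n : nat) : 0 < t -> `|series (term t) n| <= 2 * expR (a * t + 1).
Proof.
move=> t0; apply: (le_trans (ler_norm_sum _ _ _)).
apply: (@le_trans _ _ (\sum_(0 <= m < n) expR (a * t + 1) * 2^-1 ^+ m)).
  by apply: ler_sum => m _; exact: norm_term_le.
by rewrite -mulr_sumr mulrC ler_wpM2r ?expR_ge0// sum_half_le.
Qed.

Let cvg_series_term (t : R) : 0 < t -> series (term t) n @[n --> \oo] --> mittag_leffler k (- nu * t `^ k).
Proof.
move=> t0; apply: normed_cvg.
apply: (@series_le_cvg _ _ (geometric (expR (a * t + 1)) 2^-1)) => //.
- by move=> n; exact: normr_ge0.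
- by move=> n; rewrite /geometric /= mulr_ge0 ?expR_ge0// exprn_ge0.
- by move=> n; exact: norm_term_le.
- by apply: is_cvg_geometric_series; rewrite gtr0_norm ?invr_gt0//; lra.
Qed.

(** The transforms of the terms form a geometric series of ratio - nu / s^k, of modulus less than 1
    for these s. *)
Lemma laplace_mittag_leffler (s : R) : (2 * nu) `^ k^-1 < s ->
  mu.-integrable D (EFin \o (fun t => expR (- (s * t)) * mittag_leffler k (- nu * t `^ k))) /\
  \int[mu]_(t in D) (expR (- (s * t)) * mittag_leffler k (- nu * t `^ k)) =
  s `^ k / (s * (nu + s `^ k)).
Proof.
move=> as_; have s0 : 0 < s by exact: lt_trans as_.
have sk : 0 < s `^ k by exact: powR_gt0.
have sk2 : 2 * nu < s `^ k.
  have -> : 2 * nu = a `^ k by rewrite /a -powRrM mulVf ?gt_eqF// powRr1// mulr_ge0// ltW.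
  by apply: gt0_ltr_powR => //; rewrite ?nnegrE ltW.
have iterm m : mu.-integrable D (EFin \o (fun t => expR (- (s * t)) * term t m)) /\
    \int[mu]_(t in D) (expR (- (s * t)) * term t m) = s^-1 * (- nu / s `^ k) ^+ m.
  have i := integrable_expRN_powR s0 (km0 m).
  have e : (fun t => expR (- (s * t)) * term t m) =
    (fun t => ((- nu) ^+ m / Gamma (k * m%:R + 1)) * (expR (- (s * t)) * t `^ (k * m%:R))).
    by apply/funext => t; rewrite /term powRkm exprMn; ring.
  rewrite e; split; first exact: integrable_scale.
  rewrite RintegralZl// laplace_powR// -mulr_powR// powRkm expr_div_n.
  have G0 := Gamma_gt0 (km0 m).
  have skm : s `^ k ^+ m != 0 by rewrite expf_neq0// gt_eqF.
  by field; rewrite (gt_eqF s0) (gt_eqF G0) skm.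
pose z := - nu / s `^ k.
have z1 : `|z| < 1.
  rewrite normrM normrN (gtr0_norm nu0) gtr0_norm ?invr_gt0// ltr_pdivrMr// mul1r.
  by rewrite (lt_trans _ sk2)// ltr_pMl// ltr1n.
have mD : measurable (D : set (measurableTypeR R)) by [].
have ipart n : mu.-integrable D (EFin \o (fun t => expR (- (s * t)) * series (term t) n)) /\
    \int[mu]_(t in D) (expR (- (s * t)) * series (term t) n) = series (geometric s^-1 z) n.
  elim: n => [|n [ih1 ih2]].
    have e : (fun t => expR (- (s * t)) * series (term t) 0) = (fun=> 0).
      by apply/funext => t; rewrite /series/= big_geq// mulr0.
    rewrite e; split; first exact: integrable0.
    by rewrite Rintegral_cst// mul0r /series/= big_geq.
  have e : (fun t => expR (- (s * t)) * series (term t) n.+1) =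
    (fun t => expR (- (s * t)) * series (term t) n + expR (- (s * t)) * term t n).
    by apply/funext => t; rewrite /series/= big_nat_recr//= mulrDr.
  have [i1 i2] := iterm n.
  rewrite e; split; first exact: (integrable_add mD ih1 i1).
  by rewrite RintegralD// ih2 i2 /series/= big_nat_recr.
have ig : mu.-integrable D (EFin \o (fun t => (2 * expR 1) * expR (- ((s - a) * t)))).
  by apply: integrable_scale => //; apply: integrable_expRN; rewrite subr_gt0.
have D0 (t : R) : D t -> 0 < t by rewrite /= in_itv/= andbT.
have mS n : measurable_fun D (fun t => expR (- (s * t)) * series (term t) n).
  by apply/measurable_EFinP; exact: measurable_int (ipart n).1.
have cS (t : R) : D t -> expR (- (s * t)) * series (term t) n @[n --> \oo] -->
    expR (- (s * t)) * mittag_leffler k (- nu * t `^ k).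
  by move=> /D0 t0; apply: cvgM; [exact: cvg_cst|exact: cvg_series_term].
have mE : measurable_fun D (fun t => expR (- (s * t)) * mittag_leffler k (- nu * t `^ k)).
  exact: measurable_fun_cvg mS cS.
have bS n (t : R) : D t -> `|expR (- (s * t)) * series (term t) n| <= 2 * expR 1 * expR (- ((s - a) * t)).
  move=> /D0 t0; rewrite normrM (ger0_norm (expR_ge0 _)).
  apply: le_trans (ler_wpM2l (expR_ge0 _) (norm_series_le n t0)) _.
  rewrite mulrCA -!mulrA ler_pM2l// -!expRD ler_expR; lra.
have [|i c] := @Rintegral_dominated_cvg _ (measurableTypeR R) R mu D
  (fun n t => expR (- (s * t)) * series (term t) n)
  (fun t => expR (- (s * t)) * mittag_leffler k (- nu * t `^ k)) _ mD mS mE bS ig.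
  by apply: aeW => t; exact: cS.
split => //; apply: cvg_seqr_unique c _.
under eq_fun do rewrite (ipart _).2.
have -> : s `^ k / (s * (nu + s `^ k)) = s^-1 / (1 - z).
  have snu : nu + s `^ k != 0 by rewrite gt_eqF// addr_gt0.
  have -> : 1 - z = (nu + s `^ k) / s `^ k.
    by rewrite /z; move: (s `^ k) sk => S S0; field; rewrite gt_eqF.
  by move: (s `^ k) sk snu => S S0 snu; field; rewrite snu (gt_eqF s0) (gt_eqF S0).
exact: cvg_geometric_series.
Qed.
End mittag_leffler_laplace.

Section waiting_time.
Context {R : realType} (k : R) (k0 : 0 < k) (nu : R) (nu0 : 0 < nu).
Context d (T : measurableType d) (P : probability T R) (X : {RV P >-> R}).
Hypothesis cdfX : forall t : R, 0 < t -> cdf X t = (1 - mittag_leffler k (- nu * t `^ k))%:E.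
Local Notation mu := (@lebesgue_measure R).
Local Notation D := (`]0, +oo[%classic : set R).

Lemma ge0_integral_expRN (s : R) : 0 < s ->
  (\int[mu]_(t in D) (s * expR (- (s * t)))%:E = 1)%E.
Proof.
move=> s0; transitivity (\int[mu]_(t in D) (s%:E * (t ^+ 0 / 0`!%:R * expR (- (s * t)))%:E))%E.
  by apply: eq_integral => t _; rewrite -EFinM expr0 fact0 divr1 mul1r.
rewrite ge0_integralZl_EFin ?(ltW s0)//.
- by rewrite ge0_integral_expn_expRN// -EFinM expr1 mulfV// gt_eqF.
- by move=> t; rewrite /= in_itv/= andbT => t0; rewrite lee_fin expn_expRN_ge0// ltW.
- have mm : measurable_fun setT (fun t : R => t ^+ 0 / 0`!%:R * expR (- (s * t))) by me.
  by apply/measurable_EFinP; exact: measurable_funTS mm.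
Qed.

Lemma laplace_waiting_time (s : R) : (2 * nu) `^ k^-1 < s ->
  (\int[mu]_(t in D) ((s * expR (- (s * t)))%:E * cdf X t) = (nu / (nu + s `^ k))%:E)%E.
Proof.
move=> as_; have s0 : 0 < s by apply: lt_trans as_; rewrite powR_gt0// mulr_gt0.
have sk : 0 < s `^ k by exact: powR_gt0.
have [i e] := laplace_mittag_leffler k0 nu0 as_.
have ie : mu.-integrable D (EFin \o (fun t => s * expR (- (s * t)))).
  by apply: integrable_scale => //; exact: integrable_expRN.
have is_ : mu.-integrable D (EFin \o (fun t => s * (expR (- (s * t)) * mittag_leffler k (- nu * t `^ k)))).
  exact: integrable_scale.
transitivity (\int[mu]_(t in D) (s * expR (- (s * t)) -
    s * (expR (- (s * t)) * mittag_leffler k (- nu * t `^ k)))%:E)%E.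
  apply: eq_integral => t; rewrite inE/= in_itv/= andbT => t0.
  by rewrite cdfX// -EFinM; congr EFin; ring.
have ii := integrable_sub (measurable_itv `]0, +oo[ : measurable (D : set (measurableTypeR R))) ie is_.
rewrite -[LHS]fineK; last exact: integrable_fin_num ii.
have e1 : \int[mu]_(t in D) (s * expR (- (s * t))) = 1.
  by rewrite /Rintegral ge0_integral_expRN.
have e2 : \int[mu]_(t in D) (s * (expR (- (s * t)) * mittag_leffler k (- nu * t `^ k))) =
    s * (s `^ k / (s * (nu + s `^ k))) by rewrite RintegralZl// e.
congr EFin; rewrite -[LHS]/(Rintegral _ _ _) RintegralB// e1 e2.
move: (s `^ k) sk => S S0; have nS : nu + S != 0 by rewrite gt_eqF// addr_gt0.
by field; rewrite nS gt_eqF.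
Qed.

(** The distribution function is prescribed for t > 0 only. A mass c on ]-oo, 0] would bound it
    below by c there, hence c <= nu / (nu + s^k) for all large s, and the right side tends to 0. *)
Lemma waiting_time_gt0 : P (X @^-1` `]-oo, 0]) = 0%E.
Proof.
pose c := fine (cdf X 0).
have cE : cdf X 0 = c%:E by rewrite /c fineK// fin_num_measure.
suff : c <= 0.
  move=> c0; apply/eqP; rewrite eq_le measure_ge0 andbT.
  by have := cE; rewrite /cdf /distribution /pushforward /= => ->; rewrite lee_fin.
have h (s : R) : (2 * nu) `^ k^-1 < s -> c <= nu / (nu + s `^ k).
  move=> as_; have s0 : 0 < s by apply: lt_trans as_; rewrite powR_gt0// mulr_gt0.
  rewrite -lee_fin -laplace_waiting_time// -[leLHS]mule1 -(ge0_integral_expRN s0).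
  have mE : measurable_fun setT (fun t : R => (s * expR (- (s * t)))%:E).
    by apply/measurable_EFinP; me.
  have c0 : 0 <= c by rewrite fine_ge0.
  rewrite -ge0_integralZl_EFin//; first last.
  - exact: measurable_funTS mE.
  - by move=> t _; rewrite lee_fin mulr_ge0 ?expR_ge0// ltW.
  apply: ge0_le_integral => //.
  - by move=> t _; rewrite -EFinM lee_fin !mulr_ge0 ?expR_ge0// ltW.
  - by apply: measurable_funTS; apply: emeasurable_funM.
  - by apply: emeasurable_funM; [exact: measurable_funTS mE|apply: measurable_funTS; exact: cdf_measurable].
  - move=> t; rewrite /= in_itv/= andbT => t0.
    rewrite muleC lee_pmul2l// ?lte_fin ?mulr_gt0 ?expR_gt0// -cE.
    by apply: cdf_nondecreasing; exact: ltW.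
rewrite leNgt; apply/negP => c0.
(* Large enough for the transform to be available and for s^k > nu / c, which contradicts c <= nu /
   (nu + s^k). *)
pose s := (2 * nu) `^ k^-1 + (nu / c) `^ k^-1 + 1.
have a0 : 0 <= (2 * nu) `^ k^-1 by exact: powR_ge0.
have b0 : 0 <= (nu / c) `^ k^-1 by exact: powR_ge0.
have : (2 * nu) `^ k^-1 < s by rewrite /s; lra.
move=> /h; apply/negP; rewrite -ltNge.
have s0 : 0 < s by rewrite /s; lra.
have sk : nu / c < s `^ k.
  have -> : nu / c = ((nu / c) `^ k^-1) `^ k.
    by rewrite -powRrM mulVf ?gt_eqF// powRr1// divr_ge0 ?ltW.
  by apply: gt0_ltr_powR => //; rewrite ?nnegrE ?powR_ge0 ?(ltW s0)// /s; lra.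
have sk0 : 0 < s `^ k by exact: powR_gt0.
rewrite ltr_pdivrMr ?addr_gt0// -ltr_pdivrMl// mulrC.
by rewrite (lt_trans sk)// ltrDr.
Qed.
End waiting_time.

(** * The renewal process *)

Section exponential_clock.
Context {R : realType} (s : R) (s0 : 0 < s).
Local Notation mu := (@lebesgue_measure R).
Local Notation D := (`]0, +oo[%classic : set R).

Definition exp_clock (x : R) : R := expR (- (s * Num.max x 0)).

(* [exp_clock x] is the probability that an exponential time of rate [s] exceeds
   [x]: it turns an expectation of [exp_clock X] into a Laplace transform of the
   distribution function of [X]. *)
Lemma exp_clockE (x : R) :
  (\int[mu]_(t in D) (s * expR (- (s * t)) * (if x <= t then 1 else 0))%:E = (exp_clock x)%:E)%E.
Proof.
have mw : measurable_fun setT (fun t : R => (s * expR (- (s * t)))%:E).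
  by apply/measurable_EFinP; me.
rewrite /exp_clock; have [x0|x0] := leP x 0.
  rewrite mulr0 oppr0 expR0 -(ge0_integral_expRN s0); apply: eq_integral => t.
  by rewrite inE/= in_itv/= andbT => t0; rewrite ifT ?mulr1// (le_trans x0)// ltW.
transitivity (\int[mu]_(t in `[x, +oo[) (s * expR (- (s * t)))%:E)%E.
  rewrite integral_mkcond [RHS]integral_mkcond; apply: eq_integral => t _.
  rewrite !patchE; have -> : (t \in (D : set _)) = (0 < t).
    by apply/idP/idP; rewrite inE/= in_itv/= andbT.
  have -> : (t \in (`[x, +oo[%classic : set R)) = (x <= t).
    by apply/idP/idP; rewrite inE/= in_itv/= andbT.
  case: ifPn => t0; case: ifPn => xt; rewrite ?mulr1 ?mulr0//.
  by move: t0; rewrite (lt_le_trans x0 xt).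
rewrite -integral_itv_obnd_cbnd; last exact: measurable_funTS mw.
rewrite integral_mkcond (@ge0_integral_affine _ 1 x)//; first last.
- by move=> t; rewrite patchE; case: ifP => // _; rewrite lee_fin mulr_ge0 ?expR_ge0// ltW.
- by apply: (measurable_restrictT _ _).1 => //; exact: measurable_funTS mw.
rewrite mul1e; transitivity (\int[mu]_(t in D) ((expR (- (s * x)))%:E * (s * expR (- (s * t)))%:E))%E.
  rewrite [RHS]integral_mkcond; apply: eq_integral => t _; rewrite !patchE mul1r.
  have -> : (t + x \in (`]x, +oo[%classic : set R)) = (t \in (D : set R)).
    by apply/idP/idP; rewrite !inE/= !in_itv/= !andbT ltrDr.
  case: ifP => // _; rewrite -EFinM mulrDr opprD expRD; congr EFin; ring.
rewrite ge0_integralZl_EFin ?expR_ge0//.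
- by rewrite ge0_integral_expRN// mule1.
- by move=> t _; rewrite lee_fin mulr_ge0 ?expR_ge0// ltW.
- exact: measurable_funTS mw.
Qed.

Lemma exp_clock_ge0 x : 0 <= exp_clock x.
Proof. exact: expR_ge0. Qed.

Lemma measurable_exp_clock : measurable_fun setT exp_clock.
Proof.
have mm : measurable_fun setT (fun x : R => expR (- (s * x))) by me.
by apply: (measurableT_comp mm); exact: measurable_maxr.
Qed.
End exponential_clock.

Section clock_expectation.
Context {R : realType} (s : R) (s0 : 0 < s).
Context d (T : measurableType d) (P : probability T R).
Local Notation mu := (@lebesgue_measure R).
Local Notation D := (`]0, +oo[%classic : set R).

(** [exp_clockE] writes the clock as an integral in t over the indicator of X <= t, and
    nonnegativity allows the exchange. *)
Lemma tonelli_exp_clock (B : set T) (G X : T -> R) : measurable B ->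
  measurable_fun setT G -> measurable_fun setT X -> (forall w, 0 <= G w) ->
  (\int[P]_(w in B) (G w * exp_clock s (X w))%:E =
   \int[mu]_(t in D) ((s * expR (- (s * t)))%:E *
     \int[P]_(w in B `&` X @^-1` `]-oo, t]) (G w)%:E))%E.
Proof.
move=> mB mG mX G0.
pose h (w : T) (t : R) : R := G w * (s * expR (- (s * t)) * (if X w <= t then 1 else 0)).
have h0 w t : 0 <= h w t.
  by rewrite /h !mulr_ge0 ?expR_ge0 ?(ltW s0)//; case: ifP.
have mh : measurable_fun setT (fun z : T * measurableTypeR R => h z.1 z.2).
  apply: measurable_funM; first exact: (measurableT_comp mG measurable_fst).
  apply: measurable_funM.
    apply: (measurableT_comp (_ : measurable_fun setT (fun t : R => s * expR (- (s * t)))) measurable_snd).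
    by me.
  apply: measurable_fun_ifT => //.
  by apply: measurable_fun_ler; [exact: (measurableT_comp mX measurable_fst)|exact: measurable_snd].
transitivity (\int[P]_(w in B) \int[mu]_(t in D) (h w t)%:E)%E.
  apply: eq_integral => w _; rewrite EFinM -(exp_clockE s0) -ge0_integralZl_EFin//.
  - by move=> t _; rewrite lee_fin !mulr_ge0 ?expR_ge0 ?(ltW s0)//; case: ifP.
  - apply/measurable_EFinP; apply: measurable_funTS.
    apply: measurable_funM; first by me.
    apply: measurable_fun_ifT => //; exact: measurable_fun_ler.
rewrite (@tonelli_subsets _ _ T (measurableTypeR R) R P mu B D (fun w t => (h w t)%:E))//; first last.
- by move=> w t _ _; rewrite lee_fin.
- by apply/measurable_EFinP; exact: measurable_funTS mh.
apply: eq_integral => t _.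
rewrite integral_mkcondr -ge0_integralZl_EFin//; first last.
- by rewrite mulr_ge0 ?expR_ge0// ltW.
- apply: (measurable_restrict _ _ _).1 => //.
    by rewrite -[X in measurable X]setTI; exact: mX.
  by apply/measurable_EFinP; exact: measurable_funTS mG.
- by move=> w _; rewrite patchE; case: ifP => // _; rewrite lee_fin.
apply: eq_integral => w _; rewrite patchE /h.
have -> : (w \in X @^-1` `]-oo, t]) = (X w <= t).
  by apply/idP/idP; rewrite inE/= in_itv.
case: ifP => _; rewrite ?mulr0 ?mule0// -EFinM mulr1; congr EFin; ring.
Qed.
End clock_expectation.

Section independent_product.
Context {R : realType} (s : R) (s0 : 0 < s) (q : R).
Context d (T : measurableType d) (P : probability T R) (X : nat -> {RV P >-> R}).
Hypothesis indX : mutually_independent X.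
Local Notation mu := (@lebesgue_measure R).
Local Notation D := (`]0, +oo[%classic : set R).
Hypothesis LX : forall n,
  (\int[mu]_(t in D) ((s * expR (- (s * t)))%:E * cdf (X n) t) = q%:E)%E.

Let event (J : seq nat) (A : nat -> set R) := \bigcap_(j in [set` J]) (X j @^-1` A j).

Let measurable_event J A : (forall j, measurable (A j)) -> measurable (event J A).
Proof.
move=> mA; apply: fin_bigcap_measurable; first exact: finite_seq.
by move=> j _; rewrite -[X in measurable X]setTI; exact: measurable_funPT.
Qed.

(* The extra event makes the induction go through: peeling off [X n] with
   [tonelli_exp_clock] adds the event [X n <= t]. *)
Let expectation_clock_event (n : nat) (J : seq nat) (A : nat -> set R) : uniq J ->
  (forall j, j \in J -> (n <= j)%N) -> (forall j, measurable (A j)) ->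
  (\int[P]_(w in event J A) (\prod_(0 <= j < n) exp_clock s (X j w))%:E =
   (q ^+ n)%:E * P (event J A))%E.
Proof.
elim: n J A => [|n ih] J A uJ nJ mA.
  under eq_integral do rewrite big_geq//.
  by rewrite integral_cst ?mul1e//; exact: measurable_event.
have nNJ : n \notin J by apply/negP => /nJ; rewrite ltnn.
have mG : measurable_fun setT (fun w => \prod_(0 <= j < n) exp_clock s (X j w)).
  apply: measurable_prod => j _; apply: (measurableT_comp (measurable_exp_clock s)).
  exact: measurable_funPT.
have mX : measurable_fun setT (X n) by exact: measurable_funPT.
under eq_integral do rewrite big_nat_recr//=.
rewrite (tonelli_exp_clock s0 P (measurable_event J mA) mG mX); last first.
  by move=> w; apply: prodr_ge0 => j _; exact: exp_clock_ge0.
(* The event X n <= t is recorded by giving index n, which is not in J, the set ]-oo, t];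
   independence over n :: J then splits off the distribution function of X n. *)
pose A' t j := if j == n then `]-oo, t]%classic else A j.
have mA' t j : measurable (A' t j) by rewrite /A'; case: ifP.
have eqA' t j : j \in J -> A' t j = A j.
  by move=> jJ; rewrite /A' ifF//; apply/negbTE; apply: contraNneq nNJ => <-.
have evE t : event J A `&` X n @^-1` `]-oo, t] = event (n :: J) (A' t).
  apply/seteqP; split => w.
    move=> [wJ wn] j; rewrite /= inE => /predU1P[->|jJ]; first by rewrite /A' eqxx.
    by rewrite eqA'//; exact: wJ.
  move=> h; split; last by have := h n; rewrite /= inE eqxx /A' eqxx; exact.
  by move=> j jJ; have := h j; rewrite /= inE (eqA' _ _ jJ) jJ orbT; exact.
have PE t : (P (event (n :: J) (A' t)) = cdf (X n) t * P (event J A))%E.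
  rewrite /event !indX//= ?nNJ// big_cons {1}/A' eqxx; congr (_ * _)%E.
  by apply: eq_big_seq => j jJ; rewrite eqA'.
have Efin : P (event J A) \is a fin_num by rewrite fin_num_measure//; exact: measurable_event.
have q0 : 0 <= q.
  rewrite -lee_fin -(LX n); apply: integral_ge0 => t _.
  by rewrite mule_ge0 ?cdf_ge0// lee_fin mulr_ge0 ?expR_ge0// ltW.
have mcdf : measurable_fun D (fun t => ((s * expR (- (s * t)))%:E * cdf (X n) t)%E).
  apply: emeasurable_funM; last by apply: measurable_funTS; exact: cdf_measurable.
  have mm : measurable_fun setT (fun t : R => s * expR (- (s * t))) by me.
  by apply/measurable_EFinP; exact: measurable_funTS mm.
transitivity (\int[mu]_(t in D) (((s * expR (- (s * t)))%:E * cdf (X n) t) *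
    ((q ^+ n)%:E * P (event J A))))%E.
  apply: eq_integral => t _; rewrite evE ih//.
  - by rewrite PE -[RHS]muleA; congr (_ * _)%E; rewrite muleCA.
  - by rewrite /= nNJ.
  - by move=> j; rewrite inE => /predU1P[->//|/nJ/ltnW].
rewrite ge0_integralZr//.
- by rewrite LX exprS EFinM muleA.
- by move=> t _; rewrite mule_ge0 ?cdf_ge0// lee_fin mulr_ge0 ?expR_ge0// ltW.
- by rewrite mule_ge0// lee_fin exprn_ge0.
Qed.

Lemma expectation_prod_exp_clock (n : nat) :
  (\int[P]_w (\prod_(0 <= j < n) exp_clock s (X j w))%:E = (q ^+ n)%:E)%E.
Proof.
have nil_ge (j : nat) : j \in [::] -> (n <= j)%N by [].
have := @expectation_clock_event n [::] (fun=> setT) isT nil_ge (fun=> measurableT).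
rewrite /event (_ : [set` [::]] = set0); last by apply/seteqP; split.
by rewrite bigcap_set0 probability_setT mule1.
Qed.
End independent_product.

(** * Uniqueness of Laplace transforms *)

Section laplace_uniqueness.
Context {R : realType}.
Local Notation mu := (@lebesgue_measure R).
Local Notation D := (`]0, +oo[%classic : set R).

(** [hausdorff_ge0] is applied to c and to - c with s0 = a + 1. It involves the transform only at
    points s0 + j, where it vanishes, so all the differences are 0. *)
Lemma laplace_eq0 (c : R -> R) (B a : R) : measurable_fun D c ->
  (forall t : R, 0 < t -> `|c t| <= B) ->
  (forall t e : R, 0 < t -> 0 < e -> exists2 d : R, 0 < d & forall x, t <= x <= t + d -> `|c x - c t| <= e) ->
  0 <= a -> (forall s, a < s -> \int[mu]_(t in D) (expR (- (s * t)) * c t) = 0) ->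
  forall t, 0 < t -> c t = 0.
Proof.
move=> mc cB rc a0 lc.
have i1 s : 0 < s -> mu.-integrable D (EFin \o (fun t => expR (- (s * t)) * c t)).
  by move=> s0; exact: integrable_expRN_bounded s0 mc cB.
have sgn_ge0 (sg : R) : `|sg| = 1 -> forall t, 0 < t -> 0 <= sg * c t.
  move=> sg1; have s00 : 0 < a + 1 by rewrite ltr_wpDl.
  have i s : 0 < s -> mu.-integrable D (EFin \o (fun t => expR (- (s * t)) * (sg * c t))).
    move=> s0; have h : mu.-integrable D (EFin \o (fun t => sg * (expR (- (s * t)) * c t))).
      by apply: integrable_scale => //; exact: i1.
    by apply: eq_integrable h => // t _ /=; rewrite mulrCA.
  apply: (@hausdorff_ge0 _ _ (a + 1) s00 (i _ s00)).
    move=> t e t0 e0; have [d d0 hd] := rc t e t0 e0; exists d => // x /hd.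
    by rewrite -mulrBr normrM sg1 mul1r.
  move=> m n; have s1 : 0 < a + 1 + n%:R by rewrite ltr_pwDl.
  rewrite hdiff_laplace// (@eq_hdiff _ _ _ (fun=> 0 * 0)); first by rewrite hdiffZ mul0r.
  move=> x xs; have ax : a < x by apply: lt_le_trans xs; rewrite -addrA ltrDl ltr_pwDl.
  transitivity (sg * \int[mu]_(t in D) (expR (- (x * t)) * c t)); last by rewrite lc// !mulr0.
  rewrite -RintegralZl//; last exact/i1/(le_lt_trans a0).
  by apply: eq_Rintegral => t _; rewrite mulrCA.
move=> t t0; apply/eqP; rewrite eq_le.
have h1 := sgn_ge0 1 (normr1 _) t t0.
have h2 := sgn_ge0 (-1) (normrN1 _) t t0.
by move: h1 h2; rewrite mul1r mulN1r oppr_ge0 => -> ->.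
Qed.
End laplace_uniqueness.

Section null_sets.
Context {R : realType} d (T : measurableType d) (P : {measure set T -> \bar R}).

Lemma measure_eq_null (A B Z : set T) : measurable A -> measurable B -> measurable Z ->
  P Z = 0%E -> A `\` Z = B `\` Z -> P A = P B.
Proof.
move=> mA mB mZ Z0 AB; have AZ0 C : measurable C -> P C = P (C `\` Z).
  move=> mC; have CZ0 : P (C `&` Z) = 0%E.
    apply/eqP; rewrite eq_le measure_ge0 andbT -Z0 le_measure ?inE//.
    exact: measurableI.
  by rewrite -[RHS]adde0 -CZ0; exact: measureDI.
by rewrite AZ0// AB -AZ0.
Qed.
End null_sets.

(** * Arrival times and the renewal count *)

Section renewal_process.
Context {R : realType} (k : R) (k0 : 0 < k) (nu : R) (nu0 : 0 < nu).
Context d (T : measurableType d) (P : probability T R) (Delta : nat -> {RV P >-> R}).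
Hypothesis hW : waiting_times nu k Delta.
Local Notation mu := (@lebesgue_measure R).
Local Notation D := (`]0, +oo[%classic : set R).
Local Notation S := (arrival_time (fun j => Delta j : T -> R)).
(** The waiting times are positive only almost surely. Off this null event the arrival times
    increase, and the clock of their sum is the product of the clocks. *)
Let Z := \bigcup_j (Delta j @^-1` `]-oo, 0]).

Let mDelta j : measurable_fun setT (Delta j).
Proof. exact: measurable_funPT. Qed.

Let mZ : measurable Z.
Proof.
by apply: bigcup_measurable => j _; rewrite -[X in measurable X]setTI; exact: mDelta.
Qed.

Let PZ0 : P Z = 0%E.
Proof.
apply/eqP; rewrite eq_le measure_ge0 andbT.
apply: (@le_trans _ _ (\sum_(j <oo) P (Delta j @^-1` `]-oo, 0%R]))%E).
  apply: measure_sigma_subadditive => //.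
  by move=> j; rewrite -[X in measurable X]setTI; exact: mDelta.
rewrite eseries0// => j _ _; exact: (waiting_time_gt0 k0 nu0 (hW.2 j)).
Qed.

Let notZ w j : ~ Z w -> 0 < Delta j w.
Proof. by move=> nZ; rewrite ltNge; apply/negP => h; apply: nZ; exists j => //=; rewrite in_itv. Qed.

Lemma measurable_arrival_time n : measurable_fun setT (S n).
Proof. by apply: measurable_sum => j. Qed.

Let measurable_arrival_le n t : measurable [set w | S n w <= t].
Proof.
rewrite (_ : [set w | _] = S n @^-1` `]-oo, t]).
  by rewrite -[X in measurable X]setTI; exact: measurable_arrival_time.
by apply/seteqP; split => w /=; rewrite in_itv.
Qed.

Let arrival_timeS n w : S n.+1 w = S n w + Delta n w.
Proof. by rewrite /arrival_time big_nat_recr. Qed.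

Let arrival_time_le n m w : ~ Z w -> (n <= m)%N -> S n w <= S m w.
Proof.
move=> nZ; elim: m => [|m ih]; first by rewrite leqn0 => /eqP ->.
rewrite leq_eqVlt => /predU1P[->//|]; rewrite ltnS => /ih h.
by rewrite (le_trans h)// arrival_timeS lerDl ltW// notZ.
Qed.

Let exp_clock_arrival s n w : ~ Z w ->
  exp_clock s (S n w) = \prod_(0 <= j < n) exp_clock s (Delta j w).
Proof.
move=> nZ; elim: n => [|n ih].
  by rewrite /arrival_time !big_geq// /exp_clock maxxx mulr0 oppr0 expR0.
rewrite big_nat_recr//= -ih /exp_clock arrival_timeS.
have S0 : 0 <= S n w by have := arrival_time_le nZ (leq0n n); rewrite {1}/arrival_time big_geq.
have D0 := notZ n nZ.
rewrite !max_l ?(ltW D0)// ?addr_ge0 ?(ltW D0)//.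
by rewrite -expRD; congr expR; ring.
Qed.

Lemma laplace_arrival_time n s : (2 * nu) `^ k^-1 < s ->
  (\int[mu]_(t in D) ((s * expR (- (s * t)))%:E * P [set w | (S n w <= t)%R]) =
   ((nu / (nu + s `^ k)) ^+ n)%:E)%E.
Proof.
move=> as_; have s0 : 0 < s by apply: lt_trans as_; rewrite powR_gt0// mulr_gt0.
have [ind cdfD] := hW.
have LX j := @laplace_waiting_time _ _ k0 _ nu0 _ _ P (Delta j) (cdfD j) s as_.
have <- := expectation_prod_exp_clock s0 ind LX n.
have mprod : measurable_fun setT (fun w => \prod_(0 <= j < n) exp_clock s (Delta j w)).
  by apply: measurable_prod => j _; exact: (measurableT_comp (measurable_exp_clock s)).
have mcl : measurable_fun setT (fun w => exp_clock s (S n w)).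
  apply: (measurableT_comp (measurable_exp_clock s)); exact: measurable_arrival_time.
transitivity (\int[P]_w (1 * exp_clock s (S n w))%:E)%E.
  rewrite (tonelli_exp_clock s0 P measurableT (measurable_cst _) (measurable_arrival_time n)); last first.
    by move=> w; exact: ler01.
  apply: eq_integral => t _; congr (_ * _)%E.
  have -> : [set: T] `&` S n @^-1` `]-oo, t] = [set w | S n w <= t].
    by rewrite setTI; apply/seteqP; split => w /=; rewrite in_itv.
  transitivity (\int[P]_(w in [set w | (S n w <= t)%R]) (cst 1%E w))%E => //.
  by rewrite integral_cst ?mul1e//; exact: measurable_arrival_le.
apply: ae_eq_integral => //.
- by apply/measurable_EFinP; under eq_fun do rewrite mul1r.
- by apply/measurable_EFinP.
exists Z; split => // w /=; apply: contra_notP => nZ _.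
by rewrite mul1r exp_clock_arrival.
Qed.

(** A supremum of natural numbers equal to n is attained, for otherwise n - 1 would be an upper
    bound; n = 0 is attained because T_0 = 0. Without monotone arrival times, every later index has
    to be excluded separately. *)
Lemma renewal_countP w n : renewal_count (fun j => Delta j : T -> R) 1 w = (n%:R)%:E <->
  S n w <= 1 /\ forall m, (n < m)%N -> 1 < S m w.
Proof.
rewrite /renewal_count; set E := [set _ | _ in _].
have mem m : S m w <= 1 -> E (m%:R)%:E by move=> h; exists m.
split=> [supE|[Sn Sm]].
  have ub m : S m w <= 1 -> (m <= n)%N.
    by move=> /mem/ereal_sup_ubound; rewrite supE lee_fin ler_nat.
  split; last by move=> m; rewrite ltnNge ltNge; apply: contra; exact: ub.
  rewrite leNgt; apply/negP => Sn.
  have h : (ereal_sup E <= (n.-1%:R)%:E)%E.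
    apply: ge_ereal_sup => _ [m Sm <-]; rewrite lee_fin ler_nat.
    have := ub m Sm; rewrite leq_eqVlt => /predU1P[mn|]; last by case: (n).
    by move: Sm Sn; rewrite /= mn => h1 h2; have := le_lt_trans h1 h2; rewrite ltxx.
  have n0 : (0 < n)%N.
    rewrite lt0n; apply/eqP => n0; move: Sn; rewrite n0 /arrival_time big_geq//.
    by apply/negP; rewrite -leNgt.
  by move: h; rewrite supE lee_fin ler_nat leqNgt prednK// leqnn.
apply/eqP; rewrite eq_le; apply/andP; split; last exact/ereal_sup_ubound/mem.
apply: ge_ereal_sup => _ [m Smw <-]; rewrite lee_fin ler_nat leqNgt.
by apply/negP => /Sm; apply/negP; rewrite -leNgt.
Qed.

(** Off the null event [Z] the conditions on all m > n reduce to the one on n + 1, and T_(n+1) <= 1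
    implies T_n <= 1. *)
Lemma renewal_count_prob n :
  P [set w | renewal_count (fun j => Delta j : T -> R) 1 w = (n%:R)%:E] =
  (P [set w | (S n w <= 1)%R] - P [set w | (S n.+1 w <= 1)%R])%E.
Proof.
have mS := measurable_arrival_le.
pose A n := [set w | S n w <= 1].
transitivity (P (A n `\` A n.+1)).
  have mE : measurable [set w | renewal_count (fun j => Delta j : T -> R) 1 w = (n%:R)%:E].
    rewrite (_ : [set w | _] = A n `&` \bigcap_(m in [set m | (n < m)%N]) ~` A m).
      apply: measurableI; first exact: mS.
      by apply: bigcap_measurableType => m _; apply: measurableC; exact: mS.
    apply/seteqP; split => w; rewrite /= renewal_countP => -[h1 h2]; split => // m /h2.
      by rewrite /A /= ltNge => /negP.
    by rewrite /A /= ltNge => /negP.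
  apply: (measure_eq_null mE _ mZ PZ0); first by apply: measurableD; exact: mS.
  apply/seteqP; split => w [].
    rewrite /= renewal_countP => -[h1 h2] nZ; split => //; split => //.
    by rewrite /A /=; apply/negP; rewrite -ltNge h2.
  move=> [h1 h2] nZ; split => //; rewrite /= renewal_countP; split => // m nm.
  rewrite ltNge; apply/negP => h; apply: h2; rewrite /A /=.
  exact: le_trans (arrival_time_le nZ nm) h.
rewrite measureD; [|exact: mS|exact: mS|by rewrite -ge0_fin_numE// fin_num_measure//; exact: mS].
congr (_ - _)%E; apply: (measure_eq_null _ _ mZ PZ0); [by apply: measurableI; exact: mS|exact: mS|].
apply/seteqP; split => w [] //=; first by move=> [h1 h2] nZ.
move=> h nZ; split => //; split => //.
exact: le_trans (arrival_time_le nZ (leqnSn n)) h.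
Qed.
End renewal_process.

Lemma norm_sub3_le {R : realFieldType} (e p q r p' q' r' : R) :
  `|p - p'| <= e / 3 -> `|q - q'| <= e / 3 -> `|r - r'| <= e / 3 ->
  `|p - q - r - (p' - q' - r')| <= e.
Proof.
by rewrite !ler_norml => /andP[? ?] /andP[? ?] /andP[? ?]; apply/andP; split; lra.
Qed.

Section renewal_mixture.
Context {R : realType} (k : R) (k0 : 0 < k) (k1 : k <= 1) (nu : R) (nu0 : 0 < nu).
Context d (T : measurableType d) (P : probability T R) (Delta : nat -> {RV P >-> R}).
Hypothesis hW : waiting_times nu k Delta.
Context (L : probability (measurableTypeR R) R) (LE : is_ML_law k L).
Local Notation mu := (@lebesgue_measure R).
Local Notation D := (`]0, +oo[%classic : set R).
Local Notation S := (arrival_time (fun j => Delta j : T -> R)).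
Let a (n : nat) (t : R) : R := fine (P [set w | S n w <= t]).

(** The arrival time as a random variable, so that measurability and right-continuity of [a n] come
    from those of distribution functions. *)
Let X n : {RV P >-> R} :=
  HB.pack (S n) (isMeasurableFun.Build _ _ _ _ (S n) (measurable_arrival_time Delta n)).

Let aE n t : P [set w | S n w <= t] = (a n t)%:E.
Proof.
rewrite /a fineK// fin_num_measure//.
rewrite (_ : [set w | _] = S n @^-1` `]-oo, t]).
  by rewrite -[X in measurable X]setTI; exact: measurable_arrival_time.
by apply/seteqP; split => w /=; rewrite in_itv.
Qed.

Let cdfE n t : cdf (X n) t = (a n t)%:E.
Proof.
by rewrite -aE /cdf /distribution /pushforward /=; congr (P _).
Qed.

Let measurable_a n : measurable_fun setT (a n).
Proof.
apply/measurable_EFinP; have := @cdf_measurable _ _ _ P (X n).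
by congr (measurable_fun _ _); apply/funext => t; rewrite /= cdfE.
Qed.

Let a01 n t : 0 <= a n t <= 1.
Proof. by rewrite -!lee_fin -cdfE cdf_ge0 cdf_le1. Qed.

Let right_a n (t e : R) : 0 < e ->
  exists2 d : R, 0 < d & forall x, t <= x <= t + d -> `|a n x - a n t| <= e.
Proof.
move=> e0; have h : a n x @[x --> t^'+] --> a n t.
  have := @cdf_right_continuous _ _ _ P (X n) t; rewrite cdfE => h.
  have E : fine \o cdf (X n) = a n by apply/funext => x /=; rewrite cdfE.
  by rewrite -[X in X x @[x --> _] --> _]E; apply: fine_cvg.
have /cvgrPdist_le/(_ e e0)[r /= r0 hr] := h.
exists (r / 2); first by rewrite divr_gt0.
move=> x /andP[tx xt]; rewrite distrC.
move: tx; rewrite le_eqVlt => /predU1P[<-|tx]; first by rewrite subrr normr0 ltW.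
apply: hr => //=; rewrite distrC gtr0_norm ?subr_gt0//; lra.
Qed.

Let laplace_a n s : (2 * nu) `^ k^-1 < s ->
  mu.-integrable D (EFin \o (fun t => expR (- (s * t)) * a n t)) /\
  \int[mu]_(t in D) (expR (- (s * t)) * a n t) = s^-1 * (nu / (nu + s `^ k)) ^+ n.
Proof.
move=> as_; have s0 : 0 < s by apply: lt_trans as_; rewrite powR_gt0// mulr_gt0.
have i : mu.-integrable D (EFin \o (fun t => expR (- (s * t)) * a n t)).
  apply: (@integrable_expRN_bounded _ _ 1) => //; first exact: measurable_funTS (measurable_a n).
  by move=> t _; have /andP[h1 h2] := a01 n t; rewrite ger0_norm.
split => //; have := laplace_arrival_time k0 nu0 hW n as_.
have -> : (\int[mu]_(t in D) ((s * expR (- (s * t)))%:E * P [set w | (S n w <= t)%R]) =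
    \int[mu]_(t in D) (s * (expR (- (s * t)) * a n t))%:E)%E.
  by apply: eq_integral => t _; rewrite aE -EFinM mulrA.
move=> h; have : \int[mu]_(t in D) (s * (expR (- (s * t)) * a n t)) = (nu / (nu + s `^ k)) ^+ n.
  by rewrite /Rintegral h.
by rewrite RintegralZl// => <-; rewrite mulrA mulVf ?mul1r// gt_eqF.
Qed.

(** With q = nu / (nu + s^k), the transforms agree because q^n - q^(n+1) = q^n s^k / (nu + s^k). *)
Lemma arrival_mixed_pmf (n : nat) (t : R) : 0 < t ->
  P [set w | S n w <= t] = (P [set w | (S n.+1 w <= t)%R] + (mixed_pmf k L nu n t)%:E)%E.
Proof.
pose c (t : R) := a n t - a n.+1 t - mixed_pmf k L nu n t.
move=> t0; rewrite !aE -EFinD; congr EFin; apply/eqP; rewrite -subr_eq0; apply/eqP.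
rewrite opprD addrA -/(c t).
have mcc (x : R) : 0 < x -> {for x, continuous (mixed_pmf k L nu n)}.
  exact: continuous_mixed_pmf.
have mm : measurable_fun D (mixed_pmf k L nu n) by exact: measurable_mixed_pmf_time.
have m01 (x : R) : 0 <= mixed_pmf k L nu n x <= 1 by rewrite mixed_pmf_ge0 mixed_pmf_le1.
apply: (@laplace_eq0 _ c 3 ((2 * nu) `^ k^-1)) => //.
- apply: measurable_funB => //; apply: measurable_funB; exact: measurable_funTS (measurable_a _).
- move=> x x0; have /andP[h1 h2] := a01 n x; have /andP[h3 h4] := a01 n.+1 x.
  by have /andP[h5 h6] := m01 x; rewrite /c ler_norml; apply/andP; split; lra.
- move=> x e x0 e0; have e3 : 0 < e / 3 by rewrite divr_gt0.
  have [d1 d10 h1] := right_a n x e3; have [d2 d20 h2] := right_a n.+1 x e3.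
  have [d3 d30 h3] := continuous_right_le (mcc x x0) e3.
  exists (Num.min d1 (Num.min d2 d3)); first by rewrite !lt_min d10 d20.
  move=> y /andP[xy]; rewrite -lerBlDl !le_min => /and3P[y1 y2 y3].
  have {}h1 := h1 y; have {}h2 := h2 y; have {}h3 := h3 y.
  move: h1 h2 h3; rewrite xy -!lerBlDl y1 y2 y3 => /(_ isT) h1 /(_ isT) h2 /(_ isT) h3.
  exact: norm_sub3_le.
- exact: powR_ge0.
move=> s as_; have s0 : 0 < s by apply: lt_trans as_; rewrite powR_gt0// mulr_gt0.
have [i1 e1] := laplace_a n as_; have [i2 e2] := laplace_a n.+1 as_.
have e3 := laplace_mixed_pmf k0 k1 LE nu0 n s0.
have i3 : mu.-integrable D (EFin \o (fun t => expR (- (s * t)) * mixed_pmf k L nu n t)).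
  apply: (@integrable_expRN_bounded _ _ 1) => // x _.
  by have /andP[h1 h2] := m01 x; rewrite ger0_norm.
have mD : measurable (D : set (measurableTypeR R)) by [].
have i12 := integrable_sub mD i1 i2.
transitivity (\int[mu]_(x in D) ((expR (- (s * x)) * a n x - expR (- (s * x)) * a n.+1 x) -
    expR (- (s * x)) * mixed_pmf k L nu n x)).
  by apply: eq_Rintegral => x _; rewrite /c; ring.
rewrite RintegralB// RintegralB// e1 e2 e3.
have sk : 0 < s `^ k by exact: powR_gt0.
have -> : s `^ (k - 1) = s `^ k / s.
  by rewrite -[k in RHS](subrK 1) -mulr_powR// mulfK// gt_eqF.
move: (s `^ k) sk => Sk Sk0; have nS : nu + Sk != 0 by rewrite gt_eqF// addr_gt0.
rewrite exprS [_ ^+ n.+1]exprS expr_div_n.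
have nSn : (nu + Sk) ^+ n != 0 by rewrite expf_neq0.
move: ((nu + Sk) ^+ n) nSn => N N0.
by field; rewrite N0 nS gt_eqF.
Qed.
End renewal_mixture.

(** * Construction of the mixture *)

Section unit_mass.
Context d (T : measurableType d) {R : realType} (m : {measure set T -> \bar R}).
Context (m1 : m setT = 1%E).

(** A copy of [m] under a name to which the structure of a probability can be attached by means of
    [m1]. *)
Definition unit_mass (A : set T) : \bar R := m A.

HB.instance Definition _ := isMeasure.Build _ _ _ unit_mass
  (measure0 m) (measure_ge0 m) (@measure_semi_sigma_additive _ _ _ m).

HB.instance Definition _ := @Measure_isProbability.Build _ _ R unit_mass m1.

Lemma probability_of_unit_mass : exists P : probability T R, P = m :> (set T -> \bar R).
Proof. by exists unit_mass. Qed.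
End unit_mass.

Section ml_probability.
Context {R : realType} (k : R) (k0 : 0 < k).
Local Notation mu := (@lebesgue_measure R).
Local Notation D := (`]0, +oo[%classic : set R).

Section density.
Context (k1 : k < 1).
Let kI : 0 < k < 1. Proof. by rewrite k0. Qed.
Let g : R -> \bar R := (EFin \o ml_density k) \_ D.

Let mg : measurable_fun setT g.
Proof.
apply: (measurable_restrictT _ _).1 => //.
by apply/measurable_EFinP; exact: measurable_ml_density.
Qed.

Let g0 u : (0 <= g u)%E.
Proof.
rewrite /g patchE; case: ifPn => //; rewrite inE/= in_itv/= andbT => u0.
by rewrite lee_fin ml_density_ge0.
Qed.

Definition ml_prob (A : set (measurableTypeR R)) : \bar R := (\int[mu]_(u in A) g u)%E.

Let ml_prob0 : ml_prob set0 = 0%E. Proof. by rewrite /ml_prob integral_set0. Qed.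
Let ml_prob_ge0 A : (0 <= ml_prob A)%E. Proof. exact: integral_ge0. Qed.
Let ml_prob_sigma_additive : semi_sigma_additive ml_prob.
Proof. exact: semi_sigma_additive_nng_induced. Qed.

HB.instance Definition _ := isMeasure.Build _ _ _ ml_prob
  ml_prob0 ml_prob_ge0 ml_prob_sigma_additive.

Let ml_prob_setT : ml_prob [set: _] = 1%E.
Proof. by rewrite /ml_prob -integral_mkcond integral_ml_density. Qed.

HB.instance Definition _ := @Measure_isProbability.Build _ _ R ml_prob ml_prob_setT.

Lemma is_ML_ml_prob : exists L : probability (measurableTypeR R) R, is_ML_law k L.
Proof.
exists ml_prob => A mA; rewrite k1 /=.
by rewrite /ml_prob /g integral_mkcondr.
Qed.
End density.

Lemma ml_law_exists : exists L : probability (measurableTypeR R) R, is_ML_law k L.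
Proof.
have [k1|k1] := ltP k 1; first exact: is_ML_ml_prob.
by exists (\d_(1 : measurableTypeR R)) => A mA; rewrite ltNge k1.
Qed.
End ml_probability.

(** * Mixed Poisson variables: their law and their existence *)

Section mixed_poisson_law.
Context {R : realType} (k : R) (k0 : 0 < k) (nu : R) (nu0 : 0 < nu).
Local Notation D := (`]0, +oo[%classic : set R).

Lemma mixed_pmf1 (L : probability (measurableTypeR R) R) (n : nat) :
  (mixed_pmf k L nu n 1)%:E = (\int[L]_u (poisson_pmf (nu * u) n)%:E)%E.
Proof.
have := integrable_fin_num measurableT (integrable_mixed_pmf k L nu n 1).
rewrite /mixed_pmf /Rintegral => /fineK ->; apply: eq_integral => u _.
by rewrite /= powR1 mul1r.
Qed.

(** Taking B = setT in the conditional law leaves an integral that depends on U only through its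
    law. *)
Lemma mixed_Poisson_prob d (T : measurableType d) (Q : probability T R)
    (M : {RV Q >-> nat}) (U : {RV Q >-> R}) : is_mixed_Poisson_ML nu k M U ->
  exists2 L : probability (measurableTypeR R) R, is_ML_law k L &
    forall n, distribution Q M [set n] = (mixed_pmf k L nu n 1)%:E.
Proof.
move=> [hU hM].
have mU : measurable_fun setT (U : T -> measurableTypeR R) by exact: (@measurable_funPT _ _ _ _ U).
(* The same function as U, typed with values in the space that carries the laws [L]. *)
pose U' : {mfun T >-> measurableTypeR R} :=
  HB.pack (U : T -> measurableTypeR R) (isMeasurableFun.Build _ _ _ _ (U : T -> measurableTypeR R) mU).
exists (distribution Q U' : probability (measurableTypeR R) R) => [A mA|n]; first exact: hU.
have mp : measurable_fun setT (fun u : measurableTypeR R => (poisson_pmf (nu * u) n)%:E).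
  by apply/measurable_EFinP; exact: measurable_poisson_pmfM.
have p0 (u : measurableTypeR R) : (0 <= (poisson_pmf (nu * u) n)%:E)%E by rewrite lee_fin poisson_pmf_ge0.
rewrite mixed_pmf1 (ge0_integral_distribution U' mp p0).
have := hM n setT measurableT; rewrite preimage_setT setIT => hn.
by rewrite /distribution /pushforward hn.
Qed.

(** On the product space, U and M are the coordinates under the semidirect product of [L] with the
    kernel sending u to the Poisson law of mean nu u. The source [unit] turns [L] into a kernel as
    well. *)
Lemma mixed_Poisson_exists (L : probability (measurableTypeR R) R) : k <= 1 -> is_ML_law k L ->
  exists (d : measure_display) (T : measurableType d) (Q : probability T R)
    (M : {RV Q >-> nat}) (U : {RV Q >-> R}), is_mixed_Poisson_ML nu k M U.
Proof.
move=> k1 LE.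
pose K1 : unit -> pprobability (measurableTypeR R) R := fun=> L.
have mK1 : measurable_fun setT K1 by exact: measurable_cst.
pose K2 : unit * measurableTypeR R -> pprobability nat R := fun z => poisson_prob (nu * z.2) 0.
have mK2 : measurable_fun setT K2.
  apply: (measurableT_comp (measurable_poisson_prob 0)).
  by apply: measurable_funM => //; exact: measurable_snd.
pose Q0 : {measure set (measurableTypeR R * nat) -> \bar R} :=
  mkproduct (kprobability mK1) (kprobability mK2) tt.
have Q0E (B : set (measurableTypeR R)) (C : set nat) : measurable B ->
    Q0 (B `*` C) = (\int[L]_(u in B) poisson_prob (nu * u) 0 C)%E.
  move=> mB; rewrite [RHS]integral_mkcond; apply: eq_integral => u _.
  rewrite patchE; case: ifPn => uB.
    transitivity (\int[poisson_prob (nu * u) 0]_z (\1_C z)%:E)%E.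
      by apply: eq_integral => z _; rewrite !indicE in_setX/= uB.
    by rewrite integral_indic// setIT.
  by apply: integral0_eq => z _; rewrite indicE in_setX/= (negbTE uB).
have Q0T : Q0 setT = 1%E.
  rewrite -setXTT Q0E//; transitivity (\int[L]_(u in setT) (cst 1%E u))%E.
    by apply: eq_integral => u _; exact: (@probability_setT _ _ _ (poisson_prob (nu * u) 0)).
  by rewrite integral_cst// mul1e; exact: (probability_setT L).
have [Q QE] := probability_of_unit_mass Q0T.
pose M : {RV Q >-> nat} := HB.pack (snd : measurableTypeR R * nat -> nat)
  (isMeasurableFun.Build _ _ _ _ (snd : measurableTypeR R * nat -> nat) measurable_snd).
have mfst : measurable_fun setT (fst : measurableTypeR R * nat -> R) by exact: measurable_fst.
pose U : {RV Q >-> R} := HB.pack (fst : measurableTypeR R * nat -> R)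
  (isMeasurableFun.Build _ _ _ _ (fst : measurableTypeR R * nat -> R) mfst).
have UE (B : set R) : measurable B -> Q (U @^-1` B) = L B.
  move=> mB; rewrite (_ : U @^-1` B = B `*` setT); last first.
    by apply/seteqP; split => -[u n] //= [].
  transitivity (\int[L]_(u in B) (cst 1%E u))%E.
    rewrite QE Q0E//.
    by apply: eq_integral => u _; exact: (@probability_setT _ _ _ (poisson_prob (nu * u) 0)).
  by rewrite integral_cst// mul1e.
exists _, _, Q, M, U; split=> [B mB|n B mB].
  by rewrite /distribution /pushforward UE//; exact: LE.
pose p (u : measurableTypeR R) : \bar R := (poisson_pmf (nu * u) n)%:E.
have mp : measurable_fun setT p.
  by apply/measurable_EFinP; exact: measurable_poisson_pmfM.
transitivity (\int[L]_(u in B) poisson_prob (nu * u) 0 [set n])%E.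
  rewrite (_ : _ `&` _ = B `*` [set n]) ?QE ?Q0E//.
  by apply/seteqP; split => -[u m] /= [].
transitivity (\int[L]_(u in B) p u)%E.
  apply: ae_eq_integral => //.
  - have mk := measurable_kernel (kprobability mK2) [set n] (I : measurable [set n]).
    have mpair : measurable_fun setT (fun u : measurableTypeR R => (tt, u)).
      by apply: measurable_fun_pair; [exact: measurable_cst|exact: measurable_id].
    exact: measurable_funTS (measurableT_comp mk mpair).
  - exact: measurable_funTS mp.
  (* [poisson_prob] and [poisson_pmf] need not agree at rates <= 0, that is for u outside [D], a
     null set for [L]. *)
  exists (~` (D : set (measurableTypeR R))); split; first exact: measurableC.
    by have := probability_setC L (measurable_itv `]0, +oo[ : measurable (D : set (measurableTypeR R)));
      rewrite (ml_law_pos k0 LE) subee.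
  move=> u /=; apply: contra_not => u0 uB.
  have nuu : 0 < nu * u by move: u0; rewrite in_itv/= andbT => u0; rewrite mulr_gt0.
  by rewrite /poisson_prob nuu esum_set1// lee_fin poisson_pmf_ge0.
have mU : measurable_fun setT (U : _ -> measurableTypeR R) by exact: measurable_fst.
pose U' : {mfun (measurableTypeR R * nat)%type >-> measurableTypeR R} :=
  HB.pack (U : _ -> measurableTypeR R) (isMeasurableFun.Build _ _ _ _ (U : _ -> measurableTypeR R) mU).
rewrite integral_mkcond [RHS]integral_mkcond.
transitivity (\int[distribution Q U']_u (p \_ B) u)%E.
  by apply: eq_measure_integral => A mA _; exact/esym/UE.
rewrite ge0_integral_distribution//.
- by apply: (measurable_restrictT _ _).1 => //; exact: measurable_funTS mp.
- by move=> u; rewrite patchE; case: ifP => // _; rewrite lee_fin poisson_pmf_ge0.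
Qed.
End mixed_poisson_law.

Section main.
Context {R : realType} (k : R) (k0 : 0 < k) (k1 : k <= 1) (nu : R) (nu0 : 0 < nu).

Lemma FP_mixed_pmf d (T : measurableType d) (P : probability T R) (N : {RV P >-> nat})
    (L : probability (measurableTypeR R) R) (n : nat) :
  is_FP nu k N -> is_ML_law k L -> distribution P N [set n] = (mixed_pmf k L nu n 1)%:E.
Proof.
move=> [d0 [T0 [P0 [Delta [hW ->]]]]] LE.
rewrite (renewal_count_prob k0 nu0 hW) (arrival_mixed_pmf k0 k1 nu0 hW LE n ltr01).
rewrite addeAC subee ?add0e// fin_num_measure//.
rewrite (_ : [set w | _] = arrival_time (fun j => Delta j : T0 -> R) n.+1 @^-1` `]-oo, 1]).
  by rewrite -[X in measurable X]setTI; exact: measurable_arrival_time.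
by apply/seteqP; split => w /=; rewrite in_itv.
Qed.

Lemma eq_measure_nat (m1 m2 : {measure set nat -> \bar R}) :
  (forall n, m1 [set n] = m2 [set n]) -> forall A, m1 A = m2 A.
Proof.
move=> h A; have AE : A = \bigcup_(n in A) [set n].
  by apply/seteqP; split => [n An|n [m Am ->]//]; exists n.
rewrite AE.
have tA : trivIset A (fun n : nat => [set n]) by move=> i j _ _ [x [/= -> ->]].
rewrite !measure_bigcup//; by apply: eq_eseriesr => n _.
Qed.
End main.

(** The space of N may be too small to carry U, so the representation is a statement about laws:
    every mixture has the law of N, and a mixture exists, so that this is not vacuous. *)
Theorem corollary5p1 (R : realType) (nu kappa : R)
    (nu_gt0 : 0 < nu) (kappa_gt0 : 0 < kappa) (kappa_le1 : kappa <= 1)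
    (d : measure_display) (T : measurableType d) (P : probability T R)
    (N : {RV P >-> nat}) (hN : is_FP nu kappa N) :
  (exists (d' : measure_display) (T' : measurableType d')
     (Q : probability T' R) (M : {RV Q >-> nat}) (U : {RV Q >-> R}),
     is_mixed_Poisson_ML nu kappa M U /\
     (forall A : set nat, distribution Q M A = distribution P N A)) /\
  (forall (d' : measure_display) (T' : measurableType d')
     (Q : probability T' R) (M : {RV Q >-> nat}) (U : {RV Q >-> R}),
     is_mixed_Poisson_ML nu kappa M U ->
     forall A : set nat, distribution Q M A = distribution P N A).
Proof.
have law d' (T' : measurableType d') (Q : probability T' R) (M : {RV Q >-> nat})
    (U : {RV Q >-> R}) : is_mixed_Poisson_ML nu kappa M U ->
    forall A : set nat, distribution Q M A = distribution P N A.
  move=> hMU; have [L LE hM] := mixed_Poisson_prob hMU.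
  apply: (@eq_measure_nat _ (distribution Q M) (distribution P N)) => n.
  apply: etrans (hM n) (esym _).
  exact: (FP_mixed_pmf kappa_gt0 kappa_le1 nu_gt0 n hN LE).
split; last exact: law.
have [L LE] := ml_law_exists kappa_gt0.
have [d' [T' [Q [M [U hMU]]]]] := mixed_Poisson_exists kappa_gt0 nu_gt0 kappa_le1 LE.
exists d', T', Q, M, U; split => //; exact: law hMU.
Qed.
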